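(* Assume that condition (AR1) (defined in the context) holds for a DG $B$-module $N$. Then the following conditions are equivalent: (i) $N$ is naively liftable to $A$; (ii) the DG $B$-module homomorphism $\operatorname{id}_N\otimes_B\omega^0\colon N\otimes_B\mathbb{B}\to N\otimes_B(\mathbb{B}/\mathbb{B}^{\le 0})$ is null-homotopic; (iii) the DG $B$-module homomorphisms $\operatorname{id}_N\otimes_B\omega^\ell\colon N\otimes_B\mathbb{B}\to N\otimes_B(\mathbb{B}/\mathbb{B}^{\le \ell})$ are null-homotopic for all integers $\ell\geq 0$; (iv) the DG $B$-module homomorphism $\operatorname{id}_N\otimes_B\omega^\ell\colon N\otimes_B\mathbb{B}\to N\otimes_B(\mathbb{B}/\mathbb{B}^{\le \ell})$ is null-homotopic for some integer $\ell\geq 1$.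
   Context: **DG conventions.** $R$ is a commutative ring. A DG $R$-algebra $A$ is a non-negatively graded $R$-algebra $A=\bigoplus_{n\ge 0}A_n$ with $ab=(-1)^{|a||b|}ba$ for homogeneous $a,b$ and $a^2=0$ for $|a|$ odd, together with an $R$-linear differential $d^A$ of degree $-1$ satisfying the Leibniz rule $d^A(ab)=d^A(a)b+(-1)^{|a|}a\,d^A(b)$. DG modules are right DG modules: $\mathbb{Z}$-graded right modules with a differential of degree $-1$ satisfying $\partial(ma)=\partial(m)a+(-1)^{|m|}m\,d(a)$. The shift $\mathsf{\Sigma}^iM$ has $(\mathsf{\Sigma}^iM)_j=M_{j-i}$ and $\partial^{\mathsf{\Sigma}^iM}_j=(-1)^i\partial^M_{j-i}$; $\mathsf{\Sigma}=\mathsf{\Sigma}^1$. $\mathcal{C}(A)$ is the category of DG $A$-modules and DG $A$-module homomorphisms (degree $0$, commuting with differentials), $\mathcal{K}(A)$ its homotopy category ($f\sim g$ iff $f-g=\partial h+h\partial$ for a graded $A$-linear $h\colon M\to\mathsf{\Sigma}^{-1}N$); $f$ is null-homotopic if $f\sim 0$. A DG $A$-module $P$ is semifree if it has a well-ordered subset $F$ (a semifree basis) that is a basis of the underlying graded $A$-module with $\partial^P(f)\in\sum_{e<f}eA$ for every $f\in F$. A DG $A$-module is perfect if it is quasiisomorphic to a semifree DG $A$-module with a finite semifree basis. **Setting.** $\varphi\colon A\to B$ is a homomorphism of DG $R$-algebras such that $B$ is semifree as a DG $A$-module; $A$ is regarded as a DG $R$-subalgebra of $B$, $\overline{B}=B/A$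 is a semifree DG $A$-module, and $\overline{B}$ is positively graded ($\overline{B}_n=0$ for $n\le 0$). **Diagonal ideal.** $B^e=B\otimes_A B$ with $(b_1\otimes b_2)(b_1'\otimes b_2')=(-1)^{|b_1'||b_2|}b_1b_1'\otimes b_2b_2'$; $\pi_B\colon B^e\to B$, $b\otimes b'\mapsto bb'$; $J=\ker\pi_B$ (a DG $B^e$-module, hence a $B$-bimodule), and $J^{\otimes_B0}=B$. Applying $-\otimes_BJ^{\otimes_Bn}$ to $0\to J\to B^e\to B\to0$ gives short exact sequences of DG $B^e$-modules $$0\to J^{\otimes_B(n+1)}\xrightarrow{\iota_n}B\otimes_AJ^{\otimes_Bn}\xrightarrow{\pi_n}J^{\otimes_Bn}\to0,\qquad n\ge0,$$ with $\pi_n(b\otimes x)=bx$ and $\iota_n$ induced by the inclusion $J\hookrightarrow B^e$. **The DG $B^e$-module $(\mathbb{B},\mathbb{D})$.** As a graded $B^e$-module $\mathbb{B}=B\otimes_A\bigl(\bigoplus_{n\ge0}(\mathsf{\Sigma}J)^{\otimes_Bn}\bigr)=\bigoplus_{n\ge0}\mathsf{\Sigma}^n(B\otimes_AJ^{\otimes_Bn})$. Its differential $\mathbb{D}$ is the total differential obtained by splicing the short exact sequences $0\to J^{\otimes_B(n+1)}\xrightarrow{\iota_n}B\otimes_AJ^{\otimes_Bn}\xrightarrow{\pi_n}J^{\otimes_Bn}\to0$ for $n\ge0$: on the summand $\mathsf{\Sigma}^n(B\otimes_AJ^{\otimes_Bn})$ it is the sum of the differential of $\mathsf{\Sigma}^n(B\otimes_AJ^{\otimes_Bn})$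 and (for $n\ge1$) the degree $-1$ map to $\mathsf{\Sigma}^{n-1}(B\otimes_AJ^{\otimes_B(n-1)})$ induced by $\iota_{n-1}\circ\pi_n$. It is a semifree resolution of the DG $B^e$-module $B$. For $\ell\ge0$ let $\mathbb{B}^{\le\ell}=B\otimes_A\bigl(\bigoplus_{n=0}^{\ell}(\mathsf{\Sigma}J)^{\otimes_Bn}\bigr)$, a DG $B^e$-submodule of $(\mathbb{B},\mathbb{D})$ (so $\mathbb{B}^{\le0}=B^e$), and let $\omega^\ell\colon\mathbb{B}\to\mathbb{B}/\mathbb{B}^{\le\ell}$ be the natural projection, a DG $B^e$-module homomorphism. **Condition (AR1)** holds for a DG $B$-module $N$ if: (1) $N$ is a semifree DG $B$-module that is non-negatively graded; (2) $B$ and $N$ are perfect considered as DG $A$-modules via $\varphi$; (3) $\operatorname{Hom}_{\mathcal{K}(B)}(N,\mathsf{\Sigma}^nB)=0$ for all $n\ge1$. **Naive liftability.** A semifree DG $B$-module $N$ is naively liftable to $A$ if the DG $B$-module epimorphism $\pi_N\colon N|_A\otimes_AB\to N$, $n\otimes_Ab\mapsto nb$, has a right inverse in $\mathcal{C}(B)$, where $N|_A$ is $N$ regarded as a DG $A$-module via $\varphi$. *)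

(* Defs.v *)
From HB Require Import structures.
From mathcomp Require Import all_boot all_algebra.
From mathcomp Require Import boolp wochoice.
From mathcomp Require Import freeg.
From Stdlib Require Import Relation_Operators.

Set Implicit Arguments.
Unset Strict Implicit.
Unset Printing Implicit Defensive.

Import GRing.Theory.
Local Open Scope ring_scope.
#[local] Obligation Tactic := idtac.

Definition mkAdd (U V : zmodType) (f : U -> V) (fB : zmod_morphism f) :
  {additive U -> V} := HB.pack f (GRing.isZmodMorphism.Build U V f fB).

Definition sgn (V : zmodType) (n : int) (x : V) : V := x *~ (-1) ^ n.

Section Sgn.
Variable V : zmodType.
Implicit Types x y : V.

Lemma sgnB n : zmod_morphism (@sgn V n).
Proof. by move=> x y; rewrite /sgn mulrzBl. Qed.

HB.instance Definition _ n :=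
  GRing.isZmodMorphism.Build V V (@sgn V n) (sgnB n).

Lemma m1int_unit : (-1 : int) \is a GRing.unit. Proof. by []. Qed.

Lemma sgnD m n x : sgn (m + n) x = sgn m (sgn n x).
Proof. by rewrite /sgn exprzDr ?m1int_unit// mulrC mulrzA. Qed.

Lemma sgn0 x : sgn 0 x = x. Proof. by rewrite /sgn expr0z mulr1z. Qed.
Lemma sgn1 x : sgn 1 x = - x. Proof. by rewrite /sgn expr1z mulrN1z. Qed.
Lemma sgnK n x : sgn n (sgn n x) = x.
Proof.
rewrite -sgnD /sgn exprzDr ?m1int_unit// -exprzMl ?m1int_unit//.
by rewrite mulrNN mulr1 exp1rz mulr1z.
Qed.
Lemma sgnN n x : sgn (- n) x = sgn n x.
Proof. by rewrite -[in RHS](sgnK (- n) x) -sgnD subrr sgn0. Qed.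
Lemma sgnC m n x : sgn m (sgn n x) = sgn n (sgn m x).
Proof. by rewrite -!sgnD addrC. Qed.
End Sgn.

Lemma sgn_add (U V : zmodType) (f : {additive U -> V}) n x :
  f (sgn n x) = sgn n (f x).
Proof. by rewrite /sgn raddfMz. Qed.

(* A Z-graded abelian group, given by its projections onto the homogeneous
   components, with a differential of degree -1. *)
Record cpx (V : zmodType) := Cpx {
  pr : int -> {additive V -> V};
  pr_pr : forall i j x, pr i (pr j x) = if i == j then pr j x else 0;
  pr_sum : forall x, exists2 s : seq int, uniq s & x = \sum_(i <- s) pr i x;
  dif : {additive V -> V};
  dif_deg : forall n x, pr n x = x -> pr (n - 1) (dif x) = dif x;
  dif_dif : forall x, dif (dif x) = 0 }.
Arguments pr {V} c n.
Arguments dif {V} c.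

(* Membership in the component of degree n. *)
Definition homog (V : zmodType) (C : cpx V) (n : int) (x : V) : Prop :=
  pr C n x = x.

Section CpxTheory.
Variables (V : zmodType) (C : cpx V).
Implicit Types x y : V.

Lemma homog_pr n x : homog C n (pr C n x).
Proof. by rewrite /homog pr_pr eqxx. Qed.

Lemma pr_homog i n x : homog C n x -> pr C i x = if i == n then x else 0.
Proof. by move=> <-; rewrite pr_pr. Qed.

Lemma homog0 n : homog C n 0. Proof. exact: raddf0. Qed.
Lemma homogB n x y : homog C n x -> homog C n y -> homog C n (x - y).
Proof. by rewrite /homog raddfB => -> ->. Qed.
Lemma homogD n x y : homog C n x -> homog C n y -> homog C n (x + y).
Proof. by rewrite /homog raddfD => -> ->. Qed.
Lemma homog_sgn k n x : homog C n x -> homog C n (sgn k x).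
Proof. by rewrite /homog sgn_add => ->. Qed.

Lemma homog_ind (P : V -> Prop) :
  P 0 -> (forall x y, P x -> P y -> P (x + y)) ->
  (forall n x, homog C n x -> P x) -> forall x, P x.
Proof.
move=> P0 PD Ph x; have [s _ ->] := pr_sum C x.
by elim/big_ind: _ => // i _; apply: Ph (homog_pr i x).
Qed.

Lemma additive_homog (W : zmodType) (f g : V -> W) :
  zmod_morphism f -> zmod_morphism g ->
  (forall n x, homog C n x -> f x = g x) -> f =1 g.
Proof.
move=> fB gB fg x; have [s _ ->] := pr_sum C x.
rewrite -[f]/(mkAdd fB : V -> W) -[g]/(mkAdd gB : V -> W) !raddf_sum.
by apply: eq_bigr => i _; apply: fg (homog_pr i x).
Qed.

Lemma pr_notin (s : seq int) x i :
  x = \sum_(j <- s) pr C j x -> i \notin s -> pr C i x = 0.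
Proof.
move=> xs is'; rewrite [in LHS]xs raddf_sum big_seq big1// => j js.
by rewrite pr_pr; case: eqP => // ij; rewrite ij js in is'.
Qed.

Definition supp x : seq int := s2val (cid2 (pr_sum C x)).

Lemma supp_uniq x : uniq (supp x).
Proof. exact: (s2valP (cid2 (pr_sum C x))). Qed.
Lemma supp_sum x : x = \sum_(i <- supp x) pr C i x.
Proof. exact: (s2valP' (cid2 (pr_sum C x))). Qed.

Lemma sum_supp (W : zmodType) (F : int -> W) (s : seq int) x : uniq s ->
  x = \sum_(j <- s) pr C j x -> (forall i, pr C i x = 0 -> F i = 0) ->
  forall t : seq int, uniq t -> (forall i, i \notin t -> pr C i x = 0) ->
  \sum_(i <- s) F i = \sum_(i <- t) F i.
Proof.
move=> us xs F0 t ut xt.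
have E (u v : seq int) : (forall i, i \notin v -> pr C i x = 0) ->
    \sum_(i <- u) F i = \sum_(i <- u | i \in v) F i.
  move=> uv; rewrite [LHS](bigID (mem v))/= [X in _ + X]big1 ?addr0// => i /uv.
  exact: F0.
rewrite (E s t xt) (E t s); last by move=> i; apply: pr_notin xs.
rewrite -[LHS]big_filter -[RHS]big_filter; apply: perm_big.
apply: uniq_perm; rewrite ?filter_uniq// => i.
by rewrite !mem_filter andbC.
Qed.

(* Additive when every [F n] is: it then agrees with [F n] in degree n. *)
Definition glue (W : zmodType) (F : int -> V -> W) x : W :=
  \sum_(i <- supp x) F i (pr C i x).

Lemma glueE (W : zmodType) (F : int -> V -> W) (s : seq int) x :
  (forall i, F i 0 = 0) -> uniq s -> (forall i, i \notin s -> pr C i x = 0) ->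
  glue F x = \sum_(i <- s) F i (pr C i x).
Proof.
move=> F0 us xs; apply: (sum_supp (supp_uniq x) (supp_sum x)) => // i ->.
exact: F0.
Qed.

Lemma glueB (W : zmodType) (F : int -> V -> W) :
  (forall i, zmod_morphism (F i)) -> zmod_morphism (glue F).
Proof.
move=> FB x y.
have F0 i : F i 0 = 0 by rewrite -[0 in LHS](subrr 0) FB subrr.
pose s := undup (supp x ++ supp y).
have xs i : i \notin s -> pr C i x = 0.
  rewrite mem_undup mem_cat negb_or => /andP[+ _]; exact/pr_notin/supp_sum.
have ys i : i \notin s -> pr C i y = 0.
  rewrite mem_undup mem_cat negb_or => /andP[_ +]; exact/pr_notin/supp_sum.
have us : uniq s by apply: undup_uniq.
rewrite !(glueE F0 us)//; last by move=> i si; rewrite raddfB xs// ys// subrr.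
by rewrite -sumrB; apply: eq_bigr => i _; rewrite raddfB FB.
Qed.

Lemma glue_homog (W : zmodType) (F : int -> V -> W) n x :
  (forall i, F i 0 = 0) -> homog C n x -> glue F x = F n x.
Proof.
move=> F0 xn; rewrite (glueE (s := [:: n]))// ?big_seq1 ?xn// => i.
by rewrite inE (pr_homog _ xn) => /negPf ->.
Qed.

(* Multiplication by (-1)^(kn) in degree n. *)
Definition twist (k : int) : V -> V := glue (fun n x => sgn (k * n) x).

Lemma twistB k : zmod_morphism (twist k).
Proof. by apply: glueB => i x y; rewrite raddfB. Qed.
HB.instance Definition _ k :=
  GRing.isZmodMorphism.Build V V (twist k) (twistB k).

Lemma twist_homog k n x : homog C n x -> twist k x = sgn (k * n) x.
Proof. by apply: glue_homog => i; rewrite raddf0. Qed.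

Lemma homog_twist k n x : homog C n x -> homog C n (twist k x).
Proof. by move=> xn; rewrite (twist_homog _ xn); apply: homog_sgn. Qed.

Lemma pr_dif n x : pr C n (dif C x) = dif C (pr C (n + 1) x).
Proof.
move: x; apply: additive_homog => [x y|x y|m x xm]; rewrite ?raddfB//.
rewrite (pr_homog _ (dif_deg xm)) (pr_homog _ xm) -subr_eq0 opprB addrA subr_eq0.
by case: eqP; rewrite ?raddf0.
Qed.

Lemma twist_dif k x : twist k (dif C x) = sgn k (dif C (twist k x)).
Proof.
move: x; apply: (homog_ind) => [|x y|m x xm]; first by rewrite !raddf0.
  by rewrite !raddfD /= => -> ->.
rewrite (twist_homog _ (dif_deg xm)) (twist_homog _ xm) sgn_add.
by rewrite mulrBr mulr1 addrC sgnD sgnN.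
Qed.

End CpxTheory.

Section Subquotient.
Variables (V : zmodType) (S : zmodClosed V).

Definition subg := {x : V | x \in S}.
HB.instance Definition _ := SubType.on subg.
HB.instance Definition _ := Choice.on subg.
HB.instance Definition _ := [SubChoice_isSubZmodule of subg by <:].

Definition quo : zmodType := Quotient.quot S.
Definition qpi : {additive V -> quo} := \pi_(Quotient.quot S)%qT.

Lemma qpi_surj (q : quo) : exists x, q = qpi x.
Proof. by exists (repr q); rewrite /qpi /= reprK. Qed.

Lemma qpi_eq0 x : qpi x = 0 <-> x \in S.
Proof.
rewrite -(raddf0 qpi) -[x in x \in S]subr0 Quotient.idealrBE.
by split=> [->|/eqP].
Qed.

Section Lift.
Variables (W : zmodType) (f : {additive V -> W}).
Hypothesis fS : forall x, x \in S -> f x = 0.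

Lemma qlift_repr x : f (repr (qpi x)) = f x.
Proof.
apply/eqP; rewrite -subr_eq0 -raddfB; apply/eqP/fS/qpi_eq0.
by rewrite raddfB /qpi /= reprK subrr.
Qed.

Lemma qliftB : zmod_morphism (fun q : quo => f (repr q)).
Proof.
move=> q1 q2; have [x ->] := qpi_surj q1; have [y ->] := qpi_surj q2.
by rewrite -raddfB !qlift_repr raddfB.
Qed.

Definition qlift : {additive quo -> W} := mkAdd qliftB.

Lemma qliftE x : qlift (qpi x) = f x. Proof. exact: qlift_repr. Qed.
End Lift.

End Subquotient.

Definition mkZmodClosed (V : zmodType) (S : {pred V}) (h : zmod_closed S) :
  zmodClosed V := HB.pack (S : V -> bool) (GRing.isZmodClosed.Build V S h).

Section SubquotientCpx.
Variables (V : zmodType) (C : cpx V) (S : zmodClosed V).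
Hypothesis S_pr : forall n x, x \in S -> pr C n x \in S.
Hypothesis S_dif : forall x, x \in S -> dif C x \in S.

Let spr n (x : subg S) : subg S := exist _ (pr C n (val x)) (S_pr n (valP x)).
Let sdif (x : subg S) : subg S := exist _ (dif C (val x)) (S_dif (valP x)).

Fact sub_prB n : zmod_morphism (spr n).
Proof. by move=> x y; apply: val_inj; rewrite /= !raddfB. Qed.
Fact sub_difB : zmod_morphism sdif.
Proof. by move=> x y; apply: val_inj; rewrite /= !raddfB. Qed.

Program Definition sub_cpx : cpx (subg S) :=
  @Cpx (subg S) (fun n => mkAdd (sub_prB n)) _ _ (mkAdd sub_difB) _ _.
Next Obligation.
by move=> i j x; apply: val_inj; rewrite /= pr_pr; case: eqP.
Qed.
Next Obligation.
move=> x; have [s us xs] := pr_sum C (val x); exists s => //.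
by apply: val_inj; rewrite raddf_sum.
Qed.
Next Obligation.
move=> n x /(congr1 val)/= xn; apply: val_inj; exact: dif_deg.
Qed.
Next Obligation. by move=> x; apply: val_inj; apply: dif_dif. Qed.

Lemma sub_homog n (x : subg S) : homog sub_cpx n x <-> homog C n (val x).
Proof. by split=> [/(congr1 val)|xn]//; apply: val_inj. Qed.

Fact quo_pr_subproof n x : x \in S -> (qpi S \o pr C n) x = 0.
Proof. by move=> xS; apply/qpi_eq0/S_pr. Qed.
Fact quo_dif_subproof x : x \in S -> (qpi S \o dif C) x = 0.
Proof. by move=> xS; apply/qpi_eq0/S_dif. Qed.

Let quo_pr n := qlift (@quo_pr_subproof n).
Let quo_dif := qlift quo_dif_subproof.
Let quo_prE' n x : quo_pr n (qpi S x) = qpi S (pr C n x).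
Proof. exact: qliftE. Qed.
Let quo_difE' x : quo_dif (qpi S x) = qpi S (dif C x).
Proof. exact: qliftE. Qed.

Program Definition quo_cpx : cpx (quo S) := @Cpx (quo S) quo_pr _ _ quo_dif _ _.
Next Obligation.
move=> i j q; have [x ->] := qpi_surj q.
by rewrite !quo_prE' pr_pr; case: eqP; rewrite ?raddf0.
Qed.
Next Obligation.
move=> q; have [x ->] := qpi_surj q; have [s us xs] := pr_sum C x; exists s => //.
by rewrite [in LHS]xs raddf_sum; apply: eq_bigr => i _; rewrite quo_prE'.
Qed.
Next Obligation.
move=> n q; have [x ->] := qpi_surj q; rewrite quo_difE' !quo_prE'.
by rewrite pr_dif subrK -quo_difE' => ->; rewrite quo_difE'.
Qed.
Next Obligation.
by move=> q; have [x ->] := qpi_surj q; rewrite !quo_difE' dif_dif raddf0.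
Qed.

Lemma quo_prE n x : pr quo_cpx n (qpi S x) = qpi S (pr C n x).
Proof. exact: qliftE. Qed.
Lemma quo_difE x : dif quo_cpx (qpi S x) = qpi S (dif C x).
Proof. exact: qliftE. Qed.
Lemma quo_homog n x : homog C n x -> homog quo_cpx n (qpi S x).
Proof. by rewrite /homog quo_prE => ->. Qed.
Lemma quo_homogP n q : homog quo_cpx n q -> exists2 x, q = qpi S x & homog C n x.
Proof.
have [x ->] := qpi_surj q; rewrite /homog quo_prE => <-.
by exists (pr C n x) => //; apply: homog_pr.
Qed.

End SubquotientCpx.

(* The structure map from R has image in degree 0; together with graded
   commutativity and A_n = 0 for n < 0 this makes A an R-algebra and the
   differential R-linear. *)
Record dgAlg (R : comPzRingType) := DGAlg {
  dga_ring :> pzRingType;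
  dga_cpx :> cpx dga_ring;
  dga_scal : {rmorphism R -> dga_ring};
  dga_scal_deg : forall r, homog dga_cpx 0 (dga_scal r);
  dga_mul_deg : forall i j a b, homog dga_cpx i a -> homog dga_cpx j b ->
    homog dga_cpx (i + j) (a * b);
  dga_nneg : forall n a, n < 0 -> homog dga_cpx n a -> a = 0;
  dga_comm : forall i j a b, homog dga_cpx i a -> homog dga_cpx j b ->
    a * b = sgn (i * j) (b * a);
  dga_sqr : forall i a, odd `|i|%N -> homog dga_cpx i a -> a * a = 0;
  dga_leibniz : forall i a b, homog dga_cpx i a ->
    dif dga_cpx (a * b) = dif dga_cpx a * b + sgn i (a * dif dga_cpx b) }.

Record dgAlgHom (R : comPzRingType) (A B : dgAlg R) := DGAlgHom {
  dgah :> {rmorphism A -> B};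
  dgah_scal : forall r, dgah (dga_scal A r) = dga_scal B r;
  dgah_deg : forall n a, homog A n a -> homog B n (dgah a);
  dgah_dif : forall a, dgah (dif A a) = dif B (dgah a) }.

(* Right DG modules; R acts through A. *)
Record dgMod (R : comPzRingType) (A : dgAlg R) := DGMod {
  dgm_car :> zmodType;
  dgm_cpx :> cpx dgm_car;
  act : dgm_car -> A -> dgm_car;
  actBl : forall a, zmod_morphism (act^~ a);
  actBr : forall x, zmod_morphism (act x);
  act1 : forall x, act x 1 = x;
  actA : forall x a b, act (act x a) b = act x (a * b);
  act_deg : forall i j x a, homog dgm_cpx i x -> homog A j a ->
    homog dgm_cpx (i + j) (act x a);
  act_leibniz : forall i x a, homog dgm_cpx i x ->
    dif dgm_cpx (act x a) = act (dif dgm_cpx x) a + sgn i (act x (dif A a)) }.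
Arguments act {R A d}.

Record dgHom (R : comPzRingType) (A : dgAlg R) (M N : dgMod A) := DGHom {
  dgh :> {additive M -> N};
  dgh_act : forall x a, dgh (act x a) = act (dgh x) a;
  dgh_deg : forall n x, homog M n x -> homog N n (dgh x);
  dgh_dif : forall x, dgh (dif M x) = dif N (dgh x) }.

(* Right DG T-modules with a commuting left action of S. *)
Record dgBimod (R : comPzRingType) (S T : dgAlg R) := DGBimod {
  dgb_mod :> dgMod T;
  lact : S -> dgb_mod -> dgb_mod;
  lactBl : forall x, zmod_morphism (lact^~ x);
  lactBr : forall s, zmod_morphism (lact s);
  lact1 : forall x, lact 1 x = x;
  lactA : forall s t x, lact s (lact t x) = lact (s * t) x;
  lact_act : forall s x t, lact s (act x t) = act (lact s x) t;
  lact_deg : forall i j s x, homog S i s -> homog dgb_mod j x ->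
    homog dgb_mod (i + j) (lact s x);
  lact_leibniz : forall i s x, homog S i s ->
    dif dgb_mod (lact s x) =
      lact (dif S s) x + sgn i (lact s (dif dgb_mod x)) }.
Arguments lact {R S T d}.

Record dgBiHom (R : comPzRingType) (S T : dgAlg R) (M N : dgBimod S T) :=
  DGBiHom {
  dgbh :> dgHom M N;
  dgbh_lact : forall s x, dgbh (lact s x) = lact s (dgbh x) }.

Section ModTheory.
Variables (R : comPzRingType).

Section Alg.
Variable (A : dgAlg R).

Lemma dga_scalC r (a : A) : dga_scal A r * a = a * dga_scal A r.
Proof.
move: a; apply: (additive_homog (C := A)) => [x y|x y|j a aj].
- by rewrite mulrBr.
- by rewrite mulrBl.
by rewrite (dga_comm (dga_scal_deg A r) aj) mul0r sgn0.
Qed.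

Lemma dif_scal r (a : A) : dif A (dga_scal A r * a) = dga_scal A r * dif A a.
Proof.
rewrite (dga_leibniz _ (dga_scal_deg A r)) sgn0.
have -> : dif A (dga_scal A r) = 0.
  by apply: (dga_nneg (n := 0 - 1)) => //; apply: dif_deg (dga_scal_deg A r).
by rewrite mul0r add0r.
Qed.

Lemma homog1 : homog A 0 (1 : A).
Proof. by rewrite -(rmorph1 (dga_scal A)); apply: dga_scal_deg. Qed.

Lemma twistM k (a b : A) : twist A k (a * b) = twist A k a * twist A k b.
Proof.
move: a; apply: (additive_homog (C := A)) => [x y|x y|m a am].
- by rewrite mulrBl raddfB.
- by rewrite raddfB mulrBl.
move: b; apply: (additive_homog (C := A)) => [x y|x y|n b bn].
- by rewrite mulrBr raddfB.
- by rewrite raddfB mulrBr.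
rewrite (twist_homog k (dga_mul_deg am bn)) (twist_homog k am).
rewrite (twist_homog k bn) mulrDr sgnD /sgn mulrzAl mulrzAr.
by rewrite -!mulrzA mulrC.
Qed.

Lemma dif_mul (a b : A) : dif A (a * b) = dif A a * b + twist A 1 a * dif A b.
Proof.
move: a; apply: (additive_homog (C := A)) => [x y|x y|m a am].
- by rewrite mulrBl raddfB.
- by rewrite !raddfB !mulrBl addrACA -opprD.
by rewrite (dga_leibniz _ am) (twist_homog 1 am) mul1r /sgn mulrzAl.
Qed.

Lemma twist1 k : twist A k 1 = 1.
Proof. by rewrite (twist_homog k homog1) mulr0 sgn0. Qed.
End Alg.

Section Mod.
Variables (A : dgAlg R) (M : dgMod A).

HB.instance Definition _ (x : M) :=
  GRing.isZmodMorphism.Build A M (act x) (actBr x).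

Lemma act0l (a : A) : act (0 : M) a = 0. Proof. exact: raddf0 (mkAdd (actBl a)). Qed.
Lemma actDl (a : A) : {morph act^~ a : x y / (x : M) + y}.
Proof. exact: raddfD (mkAdd (actBl a)). Qed.
Lemma act_sgnl n (a : A) (x : M) : act (sgn n x) a = sgn n (act x a).
Proof. exact: (sgn_add (mkAdd (actBl a))). Qed.
Lemma act_sgnr n (a : A) (x : M) : act x (sgn n a) = sgn n (act x a).
Proof. exact: (sgn_add (act x)). Qed.

Lemma dif_act (x : M) (a : A) :
  dif M (act x a) = act (dif M x) a + act (twist M 1 x) (dif A a).
Proof.
move: x; apply: (additive_homog (C := M)) => [x y|x y|m x xm].
- by rewrite actBl raddfB.
- by rewrite !raddfB !actBl addrACA -opprD.
by rewrite (act_leibniz _ xm) (twist_homog 1 xm) mul1r act_sgnl.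
Qed.

Lemma twist_act k (x : M) (a : A) :
  twist M k (act x a) = act (twist M k x) (twist A k a).
Proof.
move: x; apply: (additive_homog (C := M)) => [x y|x y|m x xm].
- by rewrite actBl raddfB.
- by rewrite raddfB actBl.
move: a; apply: (additive_homog (C := A)) => [a b|a b|n a an].
- by rewrite actBr raddfB.
- by rewrite raddfB actBr.
rewrite (twist_homog k (act_deg xm an)) (twist_homog k xm) (twist_homog k an).
by rewrite act_sgnl act_sgnr -sgnD mulrDr.
Qed.

End Mod.

Section Bimod.
Variables (S T : dgAlg R) (M : dgBimod S T).

HB.instance Definition _ (s : S) :=
  GRing.isZmodMorphism.Build M M (lact s) (lactBr s).

Lemma lact0l (x : M) : lact (0 : S) x = 0. Proof. exact: raddf0 (mkAdd (lactBl x)). Qed.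
Lemma lactDl (x : M) (s t : S) : lact (s + t) x = lact s x + lact t x.
Proof. exact: (raddfD (mkAdd (lactBl x)) s t). Qed.
Lemma lact_sgnl n (s : S) (x : M) : lact (sgn n s) x = sgn n (lact s x).
Proof. exact: (sgn_add (mkAdd (lactBl x))). Qed.
Lemma lact_sgnr n (s : S) (x : M) : lact s (sgn n x) = sgn n (lact s x).
Proof. exact: (sgn_add (lact s)). Qed.

Lemma dif_lact (s : S) (x : M) :
  dif M (lact s x) = lact (dif S s) x + lact (twist S 1 s) (dif M x).
Proof.
move: s; apply: (additive_homog (C := S)) => [s t|s t|m s sm].
- by rewrite lactBl raddfB.
- by rewrite !raddfB !lactBl addrACA -opprD.
by rewrite (lact_leibniz _ sm) (twist_homog 1 sm) mul1r lact_sgnl.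
Qed.

Lemma twist_lact k (s : S) (x : M) :
  twist M k (lact s x) = lact (twist S k s) (twist M k x).
Proof.
move: x; apply: (additive_homog (C := M)) => [x y|x y|m x xm].
- by rewrite !raddfB.
- by rewrite !raddfB.
move: s; apply: (additive_homog (C := S)) => [a b|a b|n s sn].
- by rewrite lactBl raddfB.
- by rewrite raddfB lactBl.
rewrite (twist_homog k (lact_deg sn xm)) (twist_homog k xm) (twist_homog k sn).
by rewrite lact_sgnl lact_sgnr -sgnD mulrDr.
Qed.
End Bimod.

Lemma dgh_pr (A : dgAlg R) (M N : dgMod A) (f : dgHom M N) n (x : M) :
  f (pr M n x) = pr N n (f x).
Proof.
move: x; apply: (additive_homog (C := M)) => [x y|x y|m x xm].
- by rewrite !raddfB.
- by rewrite !raddfB.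
by rewrite (pr_homog _ xm) (pr_homog _ (dgh_deg f xm)); case: eqP; rewrite ?raddf0.
Qed.

Lemma pr_act (A : dgAlg R) (M : dgMod A) n j (x : M) (a : A) : homog A j a ->
  pr M n (act x a) = act (pr M (n - j) x) a.
Proof.
move=> aj; move: x; apply: (additive_homog (C := M)) => [x y|x y|m x xm].
- by rewrite actBl raddfB.
- by rewrite raddfB actBl.
rewrite (pr_homog _ (act_deg xm aj)) (pr_homog _ xm) subr_eq.
by case: eqP; rewrite ?act0l.
Qed.

Lemma pr_lact (S T : dgAlg R) (M : dgBimod S T) n j (s : S) (x : M) :
  homog S j s -> pr M n (lact s x) = lact s (pr M (n - j) x).
Proof.
move=> sj; move: x; apply: (additive_homog (C := M)) => [x y|x y|m x xm].
- by rewrite !raddfB.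
- by rewrite !raddfB.
rewrite (pr_homog _ (lact_deg sj xm)) (pr_homog _ xm) subr_eq addrC.
by case: eqP; rewrite ?raddf0.
Qed.

End ModTheory.

Section Constructions.
Variable R : comPzRingType.

Section Regular.
Variable B : dgAlg R.

Program Definition reg_mod : dgMod B :=
  @DGMod R B B B (fun x b => x * b) _ _ _ _ _ _.
Next Obligation. by move=> a x y; rewrite mulrBl. Qed.
Next Obligation. by move=> x a b; rewrite mulrBr. Qed.
Next Obligation. by move=> x /=; rewrite mulr1. Qed.
Next Obligation. by move=> x a b /=; rewrite mulrA. Qed.
Next Obligation. exact: dga_mul_deg. Qed.
Next Obligation. by move=> i x a xi; apply: dga_leibniz. Qed.

Program Definition reg : dgBimod B B :=
  @DGBimod R B B reg_mod (fun b x => b * x) _ _ _ _ _ _ _.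
Next Obligation. by move=> x s t; rewrite mulrBl. Qed.
Next Obligation. by move=> s x y; rewrite mulrBr. Qed.
Next Obligation. by move=> x /=; rewrite mul1r. Qed.
Next Obligation. by move=> s t x /=; rewrite mulrA. Qed.
Next Obligation. by move=> s x t; rewrite /= mulrA. Qed.
Next Obligation. exact: dga_mul_deg. Qed.
Next Obligation. by move=> i s x si; apply: dga_leibniz. Qed.
End Regular.

Section Restriction.
Variables (A B : dgAlg R) (phi : dgAlgHom A B).

Program Definition res (M : dgMod B) : dgMod A :=
  @DGMod R A M M (fun x a => act x (phi a)) _ _ _ _ _ _.
Next Obligation. by move=> M a x y /=; rewrite actBl. Qed.
Next Obligation. by move=> M x a b /=; rewrite raddfB actBr. Qed.
Next Obligation. by move=> M x /=; rewrite rmorph1 act1. Qed.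
Next Obligation. by move=> M x a b /=; rewrite actA rmorphM. Qed.
Next Obligation. by move=> M i j x a xi /(dgah_deg phi); apply: act_deg. Qed.
Next Obligation. by move=> M i x a xi /=; rewrite dgah_dif; apply: act_leibniz. Qed.

Program Definition rres (S : dgAlg R) (M : dgBimod S B) : dgBimod S A :=
  @DGBimod R S A (res M) (fun s x => lact s (x : M)) _ _ _ _ _ _ _.
Next Obligation. by move=> S M /=; apply: lactBl. Qed.
Next Obligation. by move=> S M /=; apply: lactBr. Qed.
Next Obligation. by move=> S M /=; apply: lact1. Qed.
Next Obligation. by move=> S M /=; apply: lactA. Qed.
Next Obligation. by move=> S M s x t /=; apply: lact_act. Qed.
Next Obligation. by move=> S M /=; apply: lact_deg. Qed.
Next Obligation. by move=> S M /=; apply: lact_leibniz. Qed.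

Program Definition lres (T : dgAlg R) (M : dgBimod B T) : dgBimod A T :=
  @DGBimod R A T M (fun a x => lact (phi a) x) _ _ _ _ _ _ _.
Next Obligation. by move=> T M x a b /=; rewrite raddfB lactBl. Qed.
Next Obligation. by move=> T M a x y /=; rewrite lactBr. Qed.
Next Obligation. by move=> T M x /=; rewrite rmorph1 lact1. Qed.
Next Obligation. by move=> T M a b x /=; rewrite lactA rmorphM. Qed.
Next Obligation. by move=> T M a x t /=; rewrite lact_act. Qed.
Next Obligation. by move=> T M i j a x /(dgah_deg phi); apply: lact_deg. Qed.
Next Obligation.
by move=> T M i a x /(dgah_deg phi) ai; rewrite dgah_dif; apply: lact_leibniz.
Qed.
End Restriction.

Section Shift.
Variable k : int.

Program Definition shift_cpx (V : zmodType) (C : cpx V) : cpx V :=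
  @Cpx V (fun i => pr C (i - k)) _ _ (mkAdd (f := sgn k \o dif C) _) _ _.
Next Obligation.
by move=> V C i j x; rewrite pr_pr (inj_eq (addIr (- k))).
Qed.
Next Obligation.
move=> V C x; have [s us xs] := pr_sum C x.
exists [seq i + k | i <- s]; first by rewrite map_inj_uniq//; apply: addIr.
by rewrite big_map {1}xs; apply: eq_bigr => i _; rewrite addrK.
Qed.
Next Obligation. by move=> V C x y /=; rewrite !raddfB. Qed.
Next Obligation.
move=> V C n x xn /=; rewrite sgn_add; congr (sgn k _).
by rewrite addrAC; apply: dif_deg.
Qed.
Next Obligation. by move=> V C x /=; rewrite !sgn_add dif_dif !raddf0. Qed.

Program Definition shift (A : dgAlg R) (M : dgMod A) : dgMod A :=
  @DGMod R A M (shift_cpx M) (fun x a => act x a) _ _ _ _ _ _.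
Next Obligation. by move=> A M; apply: actBl. Qed.
Next Obligation. by move=> A M; apply: actBr. Qed.
Next Obligation. by move=> A M; apply: act1. Qed.
Next Obligation. by move=> A M; apply: actA. Qed.
Next Obligation.
by move=> A M i j x a /= xi aj; rewrite /homog /= addrAC; apply: act_deg.
Qed.
Next Obligation.
move=> A M i x a /= xi; rewrite (act_leibniz (d := M) a xi).
rewrite raddfD act_sgnl /= sgnD sgnN; congr (_ + _).
by rewrite (sgnC i k) sgnK.
Qed.

(* The left action picks up the sign (-1)^(k|s|). *)
Program Definition bshift (S T : dgAlg R) (M : dgBimod S T) : dgBimod S T :=
  @DGBimod R S T (shift M) (fun s x => lact (twist S k s) (x : M)) _ _ _ _ _ _ _.
Next Obligation. by move=> S T M x s t /=; rewrite raddfB lactBl. Qed.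
Next Obligation. by move=> S T M s; apply: lactBr. Qed.
Next Obligation. by move=> S T M x /=; rewrite twist1 lact1. Qed.
Next Obligation. by move=> S T M s t x /=; rewrite twistM lactA. Qed.
Next Obligation. by move=> S T M s x t /=; rewrite -lact_act. Qed.
Next Obligation.
move=> S T M i j s x si xj; rewrite /homog /= -addrA.
by apply: (lact_deg (d := M)) => //; apply: homog_twist.
Qed.
Next Obligation.
move=> S T M i s x si; rewrite /= (lact_leibniz (d := M) _ (homog_twist k si)).
rewrite raddfD twist_dif lact_sgnl /=; congr (_ + _).
by rewrite lact_sgnr sgnC.
Qed.
End Shift.

End Constructions.

Record dgSub (R : comPzRingType) (A : dgAlg R) (M : dgMod A) := DGSub {
  dgs :> {pred M};
  dgs_zmod : zmod_closed dgs;
  dgs_pr : forall n x, x \in dgs -> pr M n x \in dgs;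
  dgs_dif : forall x, x \in dgs -> dif M x \in dgs;
  dgs_act : forall x a, x \in dgs -> act x a \in dgs }.

Record dgBiSub (R : comPzRingType) (S T : dgAlg R) (M : dgBimod S T) :=
  DGBiSub {
  dgbs :> dgSub M;
  dgbs_lact : forall s x, x \in dgbs -> lact s x \in dgbs }.

Definition dgs_closed (R : comPzRingType) (A : dgAlg R) (M : dgMod A)
  (P : dgSub M) : zmodClosed M := mkZmodClosed (dgs_zmod P).

Section SubquotientModules.
Variable R : comPzRingType.

Section Mod.
Variables (A : dgAlg R) (M : dgMod A) (P : dgSub M).
Local Notation S := (dgs_closed P).

Definition sub_car : zmodType := subg S.
Definition sub_mod_cpx : cpx sub_car := 
  @sub_cpx M M S (@dgs_pr R A M P) (@dgs_dif R A M P).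
Definition sub_val (x : sub_car) : M := val x.
Lemma sub_val_in (x : sub_car) : sub_val x \in P. Proof. exact: valP x. Qed.

Let sact (x : sub_car) (a : A) : sub_car :=
  exist _ (act (sub_val x) a) (dgs_act a (sub_val_in x)).

Program Definition sub_mod : dgMod A :=
  @DGMod R A sub_car sub_mod_cpx sact _ _ _ _ _ _.
Next Obligation. by move=> a x y; apply: val_inj; apply: actBl. Qed.
Next Obligation. by move=> x a b; apply: val_inj; apply: actBr. Qed.
Next Obligation. by move=> x; apply: val_inj; apply: act1. Qed.
Next Obligation. by move=> x a b; apply: val_inj; apply: actA. Qed.
Next Obligation.
move=> i j x a /sub_homog xi aj; apply/sub_homog; exact: (act_deg (d := M)).
Qed.
Next Obligation.
move=> i x a /sub_homog xi; apply: val_inj; rewrite raddfD sgn_add.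
exact: (act_leibniz (d := M)).
Qed.

Definition quo_car : zmodType := quo S.
Definition quo_mod_cpx : cpx quo_car := 
  @quo_cpx M M S (@dgs_pr R A M P) (@dgs_dif R A M P).

Fact quo_act_subproof (a : A) x :
  x \in S -> (qpi S \o mkAdd (actBl (d := M) a)) x = 0.
Proof. by move=> xS; apply/qpi_eq0/(dgs_act (d := P)). Qed.

Let qact (q : quo_car) (a : A) : quo_car := qlift (quo_act_subproof a) q.
Let qactE x a : qact (qpi S x) a = qpi S (act x a).
Proof. exact: qliftE. Qed.

Let qdifE x : dif quo_mod_cpx (qpi S x) = qpi S (dif M x).
Proof. exact: quo_difE. Qed.

Program Definition quo_mod : dgMod A :=
  @DGMod R A quo_car quo_mod_cpx qact _ _ _ _ _ _.
Next Obligation. by move=> a x y; rewrite /qact raddfB. Qed.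
Next Obligation.
by move=> q a b; have [x ->] := qpi_surj q; rewrite !qactE actBr raddfB.
Qed.
Next Obligation. by move=> q; have [x ->] := qpi_surj q; rewrite qactE act1. Qed.
Next Obligation.
by move=> q a b; have [x ->] := qpi_surj q; rewrite !qactE actA.
Qed.
Next Obligation.
move=> i j q a /quo_homogP[x -> xi] aj; rewrite qactE.
by apply: quo_homog; apply: (act_deg (d := M)).
Qed.
Next Obligation.
move=> i q a /quo_homogP[x -> xi]; rewrite qdifE !qactE qdifE.
by rewrite (act_leibniz (d := M) _ xi) raddfD sgn_add.
Qed.

Program Definition quo_proj : dgHom M quo_mod :=
  @DGHom R A M quo_mod (qpi S) _ _ _.
Next Obligation. by move=> x a; rewrite -qactE. Qed.
Next Obligation. by move=> n x; apply: quo_homog. Qed.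
Next Obligation. by move=> x; rewrite -qdifE. Qed.

End Mod.

Section Bimod.
Variables (S T : dgAlg R) (M : dgBimod S T) (P : dgBiSub M).
Local Notation Z := (dgs_closed P).

Let slact (s : S) (x : sub_mod P) : sub_mod P :=
  exist _ (lact s (sub_val x)) (dgbs_lact s (sub_val_in x)).

Program Definition sub_bimod : dgBimod S T :=
  @DGBimod R S T (sub_mod P) slact _ _ _ _ _ _ _.
Next Obligation. by move=> x s t; apply: val_inj; apply: lactBl. Qed.
Next Obligation. by move=> s x y; apply: val_inj; apply: lactBr. Qed.
Next Obligation. by move=> x; apply: val_inj; apply: lact1. Qed.
Next Obligation. by move=> s t x; apply: val_inj; apply: lactA. Qed.
Next Obligation. by move=> s x t; apply: val_inj; apply: lact_act. Qed.
Next Obligation.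
move=> i j s x si /sub_homog xj; apply/sub_homog; exact: (lact_deg (d := M)).
Qed.
Next Obligation.
move=> i s x si; apply: val_inj; rewrite raddfD sgn_add.
exact: (lact_leibniz (d := M)).
Qed.

Fact quo_lact_subproof (s : S) x :
  x \in Z -> (qpi Z \o mkAdd (lactBr (d := M) s)) x = 0.
Proof. by move=> xS; apply/qpi_eq0/(dgbs_lact (d := P)). Qed.

Let qlact (s : S) (q : quo_mod P) : quo_mod P := qlift (quo_lact_subproof s) q.
Let qlactE s x : qlact s (quo_proj P x) = quo_proj P (lact s x).
Proof. exact: qliftE. Qed.
Let proj_surj (q : quo_mod P) : exists x, q = quo_proj P x.
Proof. exact: qpi_surj. Qed.

Program Definition quo_bimod : dgBimod S T :=
  @DGBimod R S T (quo_mod P) qlact _ _ _ _ _ _ _.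
Next Obligation.
by move=> q s t; have [x ->] := proj_surj q; rewrite !qlactE lactBl raddfB.
Qed.
Next Obligation. by move=> s x y; rewrite /qlact raddfB. Qed.
Next Obligation. by move=> q; have [x ->] := proj_surj q; rewrite qlactE lact1. Qed.
Next Obligation.
by move=> s t q; have [x ->] := proj_surj q; rewrite !qlactE lactA.
Qed.
Next Obligation.
move=> s q t; have [x ->] := proj_surj q.
by rewrite -dgh_act !qlactE -dgh_act lact_act.
Qed.
Next Obligation.
move=> i j s q si /quo_homogP[x -> xj].
rewrite -[qpi _ x]/(quo_proj P x) qlactE; apply: dgh_deg; exact: lact_deg.
Qed.
Next Obligation.
move=> i s q si; have [x ->] := proj_surj q; rewrite -dgh_dif !qlactE -dgh_dif.
by rewrite (lact_leibniz _ si) raddfD sgn_add.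
Qed.

Program Definition quo_biproj : dgBiHom M quo_bimod :=
  @DGBiHom R S T M quo_bimod (quo_proj P) _.
Next Obligation. by move=> s x; rewrite -qlactE. Qed.

End Bimod.

Section KernelImage.

Program Definition ker_sub (A : dgAlg R) (M N : dgMod A) (f : dgHom M N) :
  dgSub M := @DGSub R A M [pred x | f x == 0] _ _ _ _.
Next Obligation.
move=> A M N f; split=> [|x y]; rewrite !inE ?raddf0// raddfB => /eqP-> /eqP->.
by rewrite subr0.
Qed.
Next Obligation. by move=> A M N f n x; rewrite !inE dgh_pr => /eqP->; rewrite raddf0. Qed.
Next Obligation. by move=> A M N f x; rewrite !inE dgh_dif => /eqP->; rewrite raddf0. Qed.
Next Obligation. by move=> A M N f x a; rewrite !inE dgh_act => /eqP->; rewrite act0l. Qed.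

Program Definition ker_bisub (S T : dgAlg R) (M N : dgBimod S T)
  (f : dgBiHom M N) : dgBiSub M := @DGBiSub R S T M (ker_sub f) _.
Next Obligation.
by move=> S T M N f s x; rewrite !inE dgbh_lact => /eqP->; rewrite raddf0.
Qed.

Definition ker_bimod (S T : dgAlg R) (M N : dgBimod S T) (f : dgBiHom M N) :
  dgBimod S T := sub_bimod (ker_bisub f).

Program Definition im_sub (A : dgAlg R) (M N : dgMod A) (f : dgHom M N) :
  dgSub N := @DGSub R A N [pred y | `[< exists x, y = f x >]] _ _ _ _.
Next Obligation.
move=> A M N f; split=> [|_ _ /asboolP[x ->] /asboolP[y ->]]; apply/asboolP.
  by exists 0; rewrite raddf0.
by exists (x - y); rewrite raddfB.
Qed.
Next Obligation.
move=> A M N f n _ /asboolP[x ->]; apply/asboolP.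
by exists (pr M n x); rewrite dgh_pr.
Qed.
Next Obligation.
move=> A M N f _ /asboolP[x ->]; apply/asboolP.
by exists (dif M x); rewrite dgh_dif.
Qed.
Next Obligation.
move=> A M N f _ a /asboolP[x ->]; apply/asboolP.
by exists (act x a); rewrite dgh_act.
Qed.

End KernelImage.
End SubquotientModules.

Section DirectSum.
Variable X : nat -> zmodType.

Record dsum := DSum {
  ds_fun :> forall n, X n;
  ds_fin : exists N : nat, forall n : nat, (N <= n)%N -> ds_fun n = 0 }.

Lemma dsumP (f g : dsum) : (forall n, f n = g n) -> f = g.
Proof.
case: f g => [f fP] [g gP] /= fg; have E : f = g by apply: functional_extensionality_dep.
by rewrite E in fP *; congr DSum; apply: Prop_irrelevance.
Qed.

HB.instance Definition _ := gen_eqMixin dsum.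
HB.instance Definition _ := gen_choiceMixin dsum.

Program Definition ds_zero : dsum := @DSum (fun n => 0) _.
Next Obligation. by exists 0%N. Qed.
Program Definition ds_opp (f : dsum) : dsum := @DSum (fun n => - f n) _.
Next Obligation.
by move=> f; have [N fN] := ds_fin f; exists N => n /fN ->; rewrite oppr0.
Qed.
Program Definition ds_add (f g : dsum) : dsum := @DSum (fun n => f n + g n) _.
Next Obligation.
move=> f g; have [N fN] := ds_fin f; have [K gK] := ds_fin g.
exists (maxn N K) => n; rewrite geq_max => /andP[/fN-> /gK->].
by rewrite addr0.
Qed.

Fact ds_addA : associative ds_add.
Proof. by move=> f g h; apply: dsumP => n /=; rewrite addrA. Qed.
Fact ds_addC : commutative ds_add.
Proof. by move=> f g; apply: dsumP => n /=; rewrite addrC. Qed.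
Fact ds_add0 : left_id ds_zero ds_add.
Proof. by move=> f; apply: dsumP => n /=; rewrite add0r. Qed.
Fact ds_addN : left_inverse ds_zero ds_opp ds_add.
Proof. by move=> f; apply: dsumP => n /=; rewrite addNr. Qed.
HB.instance Definition _ :=
  GRing.isZmodule.Build dsum ds_addA ds_addC ds_add0 ds_addN.

Definition ds_at n (f : dsum) : X n := f n.
Fact ds_atB n : zmod_morphism (ds_at n). Proof. by []. Qed.
HB.instance Definition _ n :=
  GRing.isZmodMorphism.Build dsum (X n) (ds_at n) (ds_atB n).

Lemma ds_addE (f g : dsum) n : (f + g) n = f n + g n. Proof. by []. Qed.
Lemma ds_subE (f g : dsum) n : (f - g) n = f n - g n. Proof. by []. Qed.
Lemma ds_0E n : (0 : dsum) n = 0. Proof. by []. Qed.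
Lemma ds_sumE (I : Type) (r : seq I) (F : I -> dsum) n :
  (\sum_(i <- r) F i) n = \sum_(i <- r) F i n.
Proof. exact: (raddf_sum (ds_at n)). Qed.
Lemma ds_sgnE k (f : dsum) n : (sgn k f) n = sgn k (f n).
Proof. exact: (sgn_add (ds_at n)). Qed.
End DirectSum.

(* For a sequence  ... -> X 2 -> X 1 -> X 0  of DG bimodules in which
   consecutive maps compose to 0, the direct sum of the shifts
   Sigma^n (X n) with the total differential. *)
Section Total.
Variables (R : comPzRingType) (S T : dgAlg R) (X : nat -> dgBimod S T).
Variable bd : forall n, dgBiHom (X n.+1) (X n).
Hypothesis bd_bd : forall n x, bd n (bd n.+1 x) = 0.

Let Y (n : nat) : dgBimod S T := bshift n%:Z (X n).
Let Z (n : nat) : zmodType := Y n.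
Let eB n : zmod_morphism (fun x : Y n.+1 => bd n x : Y n).
Proof. exact: raddfB (bd n). Qed.
Let e n : {additive Y n.+1 -> Y n} := mkAdd (@eB n).

Let e_deg n i (x : Y n.+1) : homog (Y n.+1) i x -> homog (Y n) (i - 1) (e n x).
Proof.
move=> xi; have : homog (X n) (i - n.+1%:Z) (bd n x) by apply: dgh_deg.
by rewrite /homog /= intS opprD addrA.
Qed.

Let e_dif n (x : Y n.+1) : e n (dif (Y n.+1) x) = - dif (Y n) (e n x).
Proof.
by rewrite /e /= sgn_add dgh_dif -sgn1 -sgnD intS.
Qed.

Let e_lact n i s (x : Y n.+1) : homog S i s ->
  e n (lact s x) = sgn i (lact s (e n x)).
Proof.
move=> si; rewrite /e /= dgbh_lact !(twist_homog _ si) !lact_sgnl -sgnD.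
by rewrite intS mulrDl mul1r.
Qed.

Program Definition tot_pr i (f : dsum Z) : dsum Z :=
  @DSum Z (fun n => pr (Y n) i (f n)) _.
Next Obligation.
move=> i f; have [N fN] := ds_fin f.
by exists N => n /fN->; rewrite raddf0.
Qed.
Fact tot_prB i : zmod_morphism (tot_pr i).
Proof. by move=> f g; apply: dsumP => n /=; rewrite raddfB. Qed.

Program Definition tot_dif (f : dsum Z) : dsum Z :=
  @DSum Z (fun n => dif (Y n) (f n) + bd n (f n.+1)) _.
Next Obligation.
move=> f; have [N fN] := ds_fin f; exists N => n Nn.
by rewrite fN// fN ?(leq_trans Nn)// !raddf0 addr0.
Qed.
Fact tot_difB : zmod_morphism tot_dif.
Proof.
move=> f g; apply: dsumP => n; rewrite ds_subE /=.
by rewrite !raddfB /= opprD addrACA.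
Qed.

Program Definition tot_cpx : cpx (dsum Z) :=
  @Cpx (dsum Z) (fun i => mkAdd (tot_prB i)) _ _ (mkAdd tot_difB) _ _.
Next Obligation.
move=> i j f; apply: dsumP => n.
transitivity (pr (Y n) i (pr (Y n) j (f n))); first by [].
by rewrite pr_pr; case: eqP.
Qed.
Next Obligation.
move=> f; have [N fN] := ds_fin f.
have [t [ut tP]] : exists t : seq int, uniq t /\
    forall n i, i \notin t -> pr (Y n) i (f n) = 0.
  exists (undup (flatten [seq supp (Y n) (f n) | n <- iota 0 N])).
  split=> [|n i]; first exact: undup_uniq.
  rewrite mem_undup => it; case: (ltnP n N) => [nN|/fN->]; last by rewrite raddf0.
  apply: pr_notin (supp_sum _ (f n)) _; apply: contra it => it.
  by apply/flatten_mapP; exists n; rewrite ?mem_iota.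
exists t => //; apply: dsumP => n; rewrite ds_sumE.
rewrite [LHS](supp_sum (Y n) (f n)).
apply: (sum_supp (C := Y n) (x := f n)) => //; first exact: supp_uniq.
  exact: supp_sum.
by move=> i; apply: tP.
Qed.
Next Obligation.
move=> i f fi; apply: dsumP => n.
have fn m : homog (Y m) i (f m) by have := congr1 (@ds_at Z m) fi.
apply: (homogD (C := Y n)); last exact: e_deg.
exact: (dif_deg (fn n)).
Qed.
Next Obligation.
move=> f; apply: dsumP => n; rewrite ds_0E.
transitivity (dif (Y n) (dif (Y n) (f n) + e n (f n.+1)) +
  e n (dif (Y n.+1) (f n.+1) + e n.+1 (f n.+2))); first by [].
rewrite !raddfD dif_dif add0r /= e_dif addrA subrr add0r.
exact: bd_bd.
Qed.

Program Definition tot_act (f : dsum Z) (t : T) : dsum Z :=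
  @DSum Z (fun n => act (f n : Y n) t) _.
Next Obligation.
by move=> f t; have [N fN] := ds_fin f; exists N => n /fN->; rewrite act0l.
Qed.

Program Definition tot_mod : dgMod T :=
  @DGMod R T (dsum Z) tot_cpx tot_act _ _ _ _ _ _.
Next Obligation. by move=> a f g; apply: dsumP => n; apply: (actBl (d := Y n)). Qed.
Next Obligation. by move=> f a b; apply: dsumP => n; apply: (actBr (d := Y n)). Qed.
Next Obligation. by move=> f; apply: dsumP => n; apply: (act1 (d := Y n)). Qed.
Next Obligation. by move=> f a b; apply: dsumP => n; apply: (actA (d := Y n)). Qed.
Next Obligation.
move=> i j f a fi aj; apply: dsumP => n; apply: (act_deg (d := Y n)) => //.
exact: (congr1 (@ds_at Z n) fi).
Qed.
Next Obligation.
move=> i f a fi; apply: dsumP => n; rewrite ds_addE ds_sgnE.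
have fn : homog (Y n) i (f n) by have := congr1 (@ds_at Z n) fi.
transitivity (dif (Y n) (act (f n : Y n) a) + bd n (act (f n.+1 : X n.+1) a)).
  by [].
rewrite (act_leibniz (d := Y n) a fn) dgh_act addrAC.
by congr (_ + _); rewrite -(actDl (M := Y n)).
Qed.

Program Definition tot_lact (s : S) (f : dsum Z) : dsum Z :=
  @DSum Z (fun n => lact s (f n : Y n)) _.
Next Obligation.
by move=> s f; have [N fN] := ds_fin f; exists N => n /fN->; rewrite raddf0.
Qed.

Program Definition tot_bimod : dgBimod S T :=
  @DGBimod R S T tot_mod tot_lact _ _ _ _ _ _ _.
Next Obligation. by move=> f s t; apply: dsumP => n; apply: (lactBl (d := Y n)). Qed.
Next Obligation. by move=> s f g; apply: dsumP => n; apply: (lactBr (d := Y n)). Qed.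
Next Obligation. by move=> f; apply: dsumP => n; apply: (lact1 (d := Y n)). Qed.
Next Obligation. by move=> s t f; apply: dsumP => n; apply: (lactA (d := Y n)). Qed.
Next Obligation. by move=> s f t; apply: dsumP => n; apply: (lact_act (d := Y n)). Qed.
Next Obligation.
move=> i j s f si fj; apply: dsumP => n; apply: (lact_deg (d := Y n)) => //.
exact: (congr1 (@ds_at Z n) fj).
Qed.
Next Obligation.
move=> i s f si; apply: dsumP => n; rewrite ds_addE ds_sgnE.
transitivity (dif (Y n) (lact s (f n : Y n)) + e n (lact s (f n.+1 : Y n.+1))).
  by [].
rewrite (lact_leibniz (d := Y n) (f n) si) (e_lact _ si) -addrA.
by congr (_ + _); rewrite -raddfD; congr (sgn i _); rewrite -raddfD.
Qed.

(* The summands with n <= l. *)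
Program Definition tot_le_sub (l : nat) : dgSub tot_mod :=
  @DGSub R T tot_mod
    [pred f : dsum Z | `[< forall n, (l < n)%N -> f n = 0 >]] _ _ _ _.
Next Obligation.
move=> l; split=> [|f g /asboolP f0 /asboolP g0]; apply/asboolP => // n ln.
by rewrite ds_subE f0// g0// subr0.
Qed.
Next Obligation.
move=> l i f /asboolP f0; apply/asboolP => n /f0 fn.
by rewrite /= fn raddf0.
Qed.
Next Obligation.
move=> l f /asboolP f0; apply/asboolP => n ln.
by rewrite /= (f0 n ln) (f0 n.+1 (leqW ln)) !raddf0 addr0.
Qed.
Next Obligation.
move=> l f a /asboolP f0; apply/asboolP => n /f0 fn.
by rewrite /= fn act0l.
Qed.

Program Definition tot_le (l : nat) : dgBiSub tot_bimod :=
  @DGBiSub R S T tot_bimod (tot_le_sub l) _.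
Next Obligation.
move=> l s f /asboolP f0; apply/asboolP => n /f0 fn.
by rewrite /= fn raddf0.
Qed.

End Total.

Inductive gen_subgroup (V : zmodType) (X : V -> Prop) : V -> Prop :=
| gen_in x : X x -> gen_subgroup X x
| gen_0 : gen_subgroup X 0
| gen_B x y : gen_subgroup X x -> gen_subgroup X y -> gen_subgroup X (x - y).

Section TensorGroup.
Variables (R : comPzRingType) (S T : dgAlg R) (M : dgMod S) (N : dgBimod S T).

Let F := {freeg (M * N)%type / int}.
Let g (x : M) (y : N) : F := << (x, y) >>.

Inductive tens_rel : F -> Prop :=
| tens_relDl x x' y : tens_rel (g (x + x') y - (g x y + g x' y))
| tens_relDr x y y' : tens_rel (g x (y + y') - (g x y + g x y'))
| tens_relA x s y : tens_rel (g (act x s) y - g x (lact s y)).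

Definition tens_kernel : {pred F} := [pred z | `[< gen_subgroup tens_rel z >]].

Fact tens_kernel_closed : zmod_closed tens_kernel.
Proof.
split=> [|x y /asboolP xK /asboolP yK]; apply/asboolP; first exact: gen_0.
exact: gen_B.
Qed.

Definition tens_car : zmodType := quo (mkZmodClosed tens_kernel_closed).

Definition tens_elt (x : M) (y : N) : tens_car := qpi _ (g x y).

Let rel0 (z : F) : tens_rel z ->
  qpi (mkZmodClosed tens_kernel_closed) z = 0.
Proof. by move=> zR; apply/qpi_eq0/asboolP/gen_in. Qed.

Lemma tens_eltDl x x' y : tens_elt (x + x') y = tens_elt x y + tens_elt x' y.
Proof.
apply/eqP; rewrite -subr_eq0 /tens_elt -raddfD -raddfB; apply/eqP/rel0.
exact: tens_relDl.
Qed.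
Lemma tens_eltDr x y y' : tens_elt x (y + y') = tens_elt x y + tens_elt x y'.
Proof.
apply/eqP; rewrite -subr_eq0 /tens_elt -raddfD -raddfB; apply/eqP/rel0.
exact: tens_relDr.
Qed.
Lemma tens_elt_bal x s y : tens_elt (act x s) y = tens_elt x (lact s y).
Proof.
apply/eqP; rewrite -subr_eq0 /tens_elt -raddfB; apply/eqP/rel0.
exact: tens_relA.
Qed.

Lemma tens_eltBl y : zmod_morphism (tens_elt^~ y).
Proof.
by move=> x x'; apply: (canRL (addrK _)); rewrite -tens_eltDl subrK.
Qed.
Lemma tens_eltBr x : zmod_morphism (tens_elt x).
Proof.
by move=> y y'; apply: (canRL (addrK _)); rewrite -tens_eltDr subrK.
Qed.
HB.instance Definition _ x :=
  GRing.isZmodMorphism.Build N tens_car (tens_elt x) (@tens_eltBr x).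

Lemma tens_elt0l y : tens_elt 0 y = 0.
Proof. exact: raddf0 (mkAdd (@tens_eltBl y)). Qed.
Lemma tens_elt_sgnl k x y : tens_elt (sgn k x) y = sgn k (tens_elt x y).
Proof. exact: (sgn_add (mkAdd (@tens_eltBl y))). Qed.
Lemma tens_elt_sgnr k x y : tens_elt x (sgn k y) = sgn k (tens_elt x y).
Proof. exact: sgn_add. Qed.

Lemma tens_ind (P : tens_car -> Prop) :
  P 0 -> (forall t u, P t -> P u -> P (t - u)) ->
  (forall x y, P (tens_elt x y)) -> forall t, P t.
Proof.
move=> P0 PB Pe t; have [z ->] := qpi_surj t.
have PN u : P u -> P (- u) by move=> Pu; rewrite -sub0r; apply: PB.
have PD u v : P u -> P v -> P (u + v).
  by move=> Pu Pv; rewrite -[v]opprK; apply: PB => //; apply: PN.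
rewrite -[z]freeg_sumE raddf_sum; elim/big_ind: _ => // -[x y] _.
have -> (k : int) : << k *g (x, y) >> = g x y *~ k.
  by rewrite /g freegU_mulz intz.
rewrite raddfMz; case: (coeff _ _) => n.
  rewrite -pmulrn; elim: n => [|n IH]; first by rewrite mulr0n.
  by rewrite mulrS; apply: PD IH; apply: Pe.
rewrite NegzE mulrNz -pmulrn; apply: PN.
elim: n => [|n IH]; first by rewrite mulr1n; apply: Pe.
by rewrite mulrS; apply: PD IH; apply: Pe.
Qed.

Section Lift.
Variables (W : zmodType) (f : M -> N -> W).

Definition balanced : Prop :=
  [/\ forall y, zmod_morphism (f^~ y), forall x, zmod_morphism (f x) &
      forall x s y, f (act x s) y = f x (lact s y)].

Hypothesis fP : balanced.

Definition free_lift (z : F) : W := 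
  fglift (fun p : (M * N)%type => f p.1 p.2 : zmodule W) z.

Fact free_liftB : zmod_morphism free_lift.
Proof.
move=> z z'; rewrite /free_lift.
exact: (lift_is_additive (fun p : (M * N)%type => f p.1 p.2 : zmodule W)).
Qed.

Fact free_liftE x y : free_lift (g x y) = f x y.
Proof. by rewrite /free_lift liftU scale1r. Qed.

Fact free_lift0 z : z \in mkZmodClosed tens_kernel_closed ->
  mkAdd free_liftB z = 0.
Proof.
case: fP => fBl fBr fbal.
move=> /asboolP; elim=> {z} [z [x x' y|x y y'|x s y]||z z' _ zK _ zK'].
- rewrite raddfB raddfD /= !free_liftE.
  by rewrite (raddfD (mkAdd (fBl y)) x x' : f (x + x') y = _) subrr.
- rewrite raddfB raddfD /= !free_liftE.
  by rewrite (raddfD (mkAdd (fBr x)) y y' : f x (y + y') = _) subrr.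
- by rewrite raddfB /= !free_liftE fbal subrr.
- exact: raddf0.
- by rewrite raddfB zK zK' subrr.
Qed.

Definition tens_lift : {additive tens_car -> W} := qlift free_lift0.

Lemma tens_liftE x y : tens_lift (tens_elt x y) = f x y.
Proof. by rewrite /tens_lift qliftE /= free_liftE. Qed.

End Lift.

Lemma tens_ext (W : zmodType) (f h : tens_car -> W) :
  zmod_morphism f -> zmod_morphism h ->
  (forall x y, f (tens_elt x y) = h (tens_elt x y)) -> f =1 h.
Proof.
move=> fB hB fh; apply: tens_ind => [|t u ft fu|//].
  exact: etrans (raddf0 (mkAdd fB)) (esym (raddf0 (mkAdd hB))).
by rewrite fB hB ft fu.
Qed.

End TensorGroup.

Section Finite.
Variables (V : zmodType) (q : int -> {additive V -> V}).
Hypothesis q_q : forall i j x, q i (q j x) = if i == j then q j x else 0.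

Definition fin_dec (x : V) : Prop :=
  exists2 s : seq int, uniq s & x = \sum_(i <- s) q i x.

Lemma fin_dec_big (s t : seq int) x : uniq s -> uniq t -> {subset s <= t} ->
  x = \sum_(i <- s) q i x -> x = \sum_(i <- t) q i x.
Proof.
move=> us ut st xs; rewrite (bigID (mem s))/= [X in _ + X]big1 ?addr0.
  rewrite -big_filter [LHS]xs; apply: perm_big; apply: uniq_perm => //.
    exact: filter_uniq.
  by move=> i; rewrite mem_filter; case: (boolP (i \in s)) => // /st ->.
move=> i is'; rewrite xs raddf_sum big_seq big1// => j js.
by rewrite q_q; case: eqP => // ij; rewrite ij js in is'.
Qed.

Lemma fin_decB x y : fin_dec x -> fin_dec y -> fin_dec (x - y).
Proof.
move=> [s us xs] [t ut yt]; have uu : uniq (undup (s ++ t)) by apply: undup_uniq.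
exists (undup (s ++ t)) => //.
under eq_bigr do rewrite raddfB.
rewrite sumrB; congr (_ - _).
  by apply: fin_dec_big xs => // i is'; rewrite mem_undup mem_cat is'.
by apply: fin_dec_big yt => // i it; rewrite mem_undup mem_cat it orbT.
Qed.

Lemma fin_dec0 : fin_dec 0. Proof. by exists [::]; rewrite ?big_nil. Qed.

Lemma fin_decD x y : fin_dec x -> fin_dec y -> fin_dec (x + y).
Proof.
move=> xf yf; rewrite -[y]opprK; apply: fin_decB => //; rewrite -sub0r.
exact: fin_decB fin_dec0 yf.
Qed.

Lemma fin_dec_homog n x : q n x = x -> fin_dec x.
Proof. by exists [:: n]; rewrite ?big_seq1. Qed.
End Finite.

Section TensorMod.
Variables (R : comPzRingType) (S T : dgAlg R) (M : dgMod S) (N : dgBimod S T).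
Local Notation tn := (@tens_elt R S T M N).

Definition tens_pr_fun k (x : M) (y : N) : tens_car M N :=
  glue M (fun i u => tn u (pr N (k - i) y)) x.

Lemma tens_pr_fun_homog k i (x : M) (y : N) : homog M i x ->
  tens_pr_fun k x y = tn x (pr N (k - i) y).
Proof. by apply: glue_homog => j; apply: tens_elt0l. Qed.

Fact tens_pr_fun_bal k : balanced (tens_pr_fun k).
Proof.
have fBl y : zmod_morphism ((tens_pr_fun k)^~ y).
  by apply: glueB => i u v; apply: tens_eltBl.
have fBr x : zmod_morphism (tens_pr_fun k x).
  move=> y z; rewrite /tens_pr_fun /glue -sumrB; apply: eq_bigr => i _.
  by rewrite !raddfB.
split=> // x s y; move: x; apply: (additive_homog (C := M)).
- by move=> u v; rewrite actBl; apply: fBl.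
- exact: fBl.
move=> i x xi; move: s; apply: (additive_homog (C := S)).
- by move=> u v; rewrite actBr; apply: fBl.
- by move=> u v; rewrite lactBl fBr.
move=> j s sj; rewrite (tens_pr_fun_homog k _ (act_deg xi sj)).
rewrite (tens_pr_fun_homog k _ xi) tens_elt_bal (pr_lact _ _ sj).
by rewrite opprD addrA.
Qed.

Definition tens_dif_fun (x : M) (y : N) : tens_car M N :=
  tn (dif M x) y + tn (twist M 1 x) (dif N y).

Fact tens_dif_fun_bal : balanced tens_dif_fun.
Proof.
split=> [y x x'|x y y'|x s y]; rewrite /tens_dif_fun.
- by rewrite !raddfB !tens_eltBl opprD addrACA.
- by rewrite !raddfB opprD addrACA.
rewrite dif_act tens_eltDl !tens_elt_bal dif_lact tens_eltDr twist_act.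
by rewrite tens_elt_bal addrA.
Qed.

Definition tens_pr k : {additive tens_car M N -> tens_car M N} :=
  tens_lift (tens_pr_fun_bal k).
Definition tens_dif : {additive tens_car M N -> tens_car M N} :=
  tens_lift tens_dif_fun_bal.

Lemma tens_prE k i x y : homog M i x -> tens_pr k (tn x y) = tn x (pr N (k - i) y).
Proof. by move=> xi; rewrite tens_liftE; apply: tens_pr_fun_homog. Qed.
Lemma tens_difE x y :
  tens_dif (tn x y) = tn (dif M x) y + tn (twist M 1 x) (dif N y).
Proof. exact: tens_liftE. Qed.

Lemma tens_prH k i j x y : homog M i x -> homog N j y ->
  tens_pr k (tn x y) = if k == i + j then tn x y else 0.
Proof.
move=> xi yj; rewrite (tens_prE _ _ xi) (pr_homog _ yj) subr_eq addrC.
by case: eqP; rewrite ?raddf0.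
Qed.

Lemma tens_ext_homog (W : zmodType) (f h : tens_car M N -> W) :
  zmod_morphism f -> zmod_morphism h ->
  (forall i j x y, homog M i x -> homog N j y -> f (tn x y) = h (tn x y)) ->
  f =1 h.
Proof.
move=> fB hB fh; apply: tens_ext => // x y; move: x.
apply: (additive_homog (C := M)) => [u v|u v|i x xi].
- by rewrite tens_eltBl fB.
- by rewrite tens_eltBl hB.
move: y; apply: (additive_homog (C := N)) => [u v|u v|j y yj].
- by rewrite tens_eltBr fB.
- by rewrite tens_eltBr hB.
exact: fh xi yj.
Qed.

Fact tens_pr_pr i j t : tens_pr i (tens_pr j t) = if i == j then tens_pr j t else 0.
Proof.
move: t; apply: tens_ext_homog => [t u|t u|k l x y xk yl].
- by rewrite !raddfB.
- by case: eqP => _; rewrite ?raddfB ?subr0.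
rewrite (tens_prH j xk yl); case: (eqVneq j (k + l)) => [->|jkl].
  by rewrite (tens_prH i xk yl).
by rewrite raddf0; case: eqP.
Qed.

Program Definition tens_cpx : cpx (tens_car M N) :=
  @Cpx (tens_car M N) tens_pr tens_pr_pr _ tens_dif _ _.
Next Obligation.
apply: tens_ind => [|t u|x y]; first exact: fin_dec0.
  exact/fin_decB/tens_pr_pr.
rewrite -/(fin_dec _ _); move: x; apply: (homog_ind (C := M)).
- by rewrite tens_elt0l; apply: fin_dec0.
- by move=> u v; rewrite tens_eltDl; apply/fin_decD/tens_pr_pr.
move=> i x xi; move: y; apply: (homog_ind (C := N)).
- by rewrite raddf0; apply: fin_dec0.
- by move=> u v; rewrite tens_eltDr; apply/fin_decD/tens_pr_pr.
move=> j y yj; apply: (fin_dec_homog (n := i + j)).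
by rewrite (tens_prH _ xi yj) eqxx.
Qed.
Next Obligation.
suff E n t : tens_pr n (tens_dif t) = tens_dif (tens_pr (n + 1) t).
  by move=> n x xn; rewrite E subrK xn.
move: t; apply: tens_ext_homog => [t u|t u|k l x y xk yl]; rewrite ?raddfB//.
rewrite tens_difE raddfD (tens_prH n (dif_deg xk) yl).
rewrite (tens_prH n (homog_twist 1 xk) (dif_deg yl)) (tens_prH _ xk yl).
rewrite addrAC addrA -[n == _]subr_eq opprK.
by case: eqP => _; rewrite ?tens_difE ?raddf0 ?addr0.
Qed.
Next Obligation.
apply: tens_ext => [t u|t u|x y]; rewrite ?raddfB ?subr0//.
rewrite tens_difE raddfD !tens_difE !dif_dif tens_elt0l raddf0 addr0 add0r.
by rewrite twist_dif tens_elt_sgnl sgn1 addNr.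
Qed.

Lemma tens_homog i j x y : homog M i x -> homog N j y ->
  homog tens_cpx (i + j) (tn x y).
Proof.
move=> xi yj; change (tens_pr (i + j) (tn x y) = tn x y).
by rewrite (tens_prH _ xi yj) eqxx.
Qed.

Fact tens_act_bal (t : T) : balanced (fun x y => tn x (act y t)).
Proof.
split=> [y u v|x u v|x s y] /=; first exact: tens_eltBl.
  by rewrite actBl raddfB.
by rewrite tens_elt_bal lact_act.
Qed.

Definition tens_act (z : tens_car M N) (t : T) : tens_car M N :=
  tens_lift (tens_act_bal t) z.

Lemma tens_actE x y t : tens_act (tn x y) t = tn x (act y t).
Proof. exact: tens_liftE. Qed.

Lemma tens_actBl t : zmod_morphism (tens_act^~ t).
Proof. by move=> z w; rewrite /tens_act raddfB. Qed.

Lemma tens_act0l t : tens_act 0 t = 0.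
Proof. exact: raddf0 (mkAdd (tens_actBl t)). Qed.
Lemma tens_actDl t z w : tens_act (z + w) t = tens_act z t + tens_act w t.
Proof. exact: (raddfD (mkAdd (tens_actBl t))). Qed.
Lemma tens_act_sgnl t k z : tens_act (sgn k z) t = sgn k (tens_act z t).
Proof. exact: (sgn_add (mkAdd (tens_actBl t))). Qed.

Lemma tens_actBr z : zmod_morphism (tens_act z).
Proof.
move=> t u; move: z; apply: tens_ext => [z w|z w|x y].
- exact: tens_actBl.
- by rewrite !tens_actBl opprD addrACA -opprD.
by rewrite !tens_actE actBr raddfB.
Qed.

Program Definition tens : dgMod T :=
  @DGMod R T (tens_car M N) tens_cpx tens_act tens_actBl tens_actBr _ _ _ _.
Next Obligation.
apply: tens_ext => [z w|z w|x y]; rewrite ?tens_actBl//.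
by rewrite tens_actE act1.
Qed.
Next Obligation.
move=> z a b; move: z; apply: tens_ext => [z w|z w|x y]; rewrite ?tens_actBl//.
by rewrite !tens_actE actA.
Qed.
Next Obligation.
move=> i j z a zi aj; rewrite /homog -[in RHS]zi.
change (tens_pr (i + j) (tens_act z a) = tens_act (tens_pr i z) a).
move: z {zi}; apply: tens_ext_homog => [z w|z w|k l x y xk yl].
- by rewrite tens_actBl raddfB.
- by rewrite raddfB tens_actBl.
rewrite tens_actE (tens_prH _ xk (act_deg yl aj)) (tens_prH _ xk yl) addrA.
rewrite (inj_eq (addIr j)).
by case: eqP; rewrite ?tens_actE ?tens_act0l.
Qed.
Next Obligation.
suff E a z : tens_dif (tens_act z a) = tens_act (tens_dif z) a +
    tens_act (twist tens_cpx 1 z) (dif T a).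
  move=> i z a zi; change (tens_dif (tens_act z a) =
    tens_act (tens_dif z) a + sgn i (tens_act z (dif T a))).
  rewrite E (twist_homog 1 zi) mul1r.
  by rewrite tens_act_sgnl.
move: z; apply: tens_ext_homog => [z w|z w|k l x y xk yl].
- by rewrite tens_actBl raddfB.
- by rewrite !raddfB !tens_actBl opprD addrACA.
rewrite tens_actE !tens_difE (twist_homog 1 (tens_homog xk yl)).
rewrite dif_act tens_eltDr addrA tens_actDl !tens_actE -addrA -addrA.
congr (_ + (_ + _)); rewrite (twist_homog 1 xk) (twist_homog 1 yl).
rewrite act_sgnl tens_elt_sgnl tens_elt_sgnr.
by rewrite -sgnD -mulrDr tens_act_sgnl tens_actE.
Qed.

End TensorMod.

Section HomConstructions.
Variable R : comPzRingType.

Lemma dgh_twist (A : dgAlg R) (M N : dgMod A) (f : dgHom M N) k (x : M) :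
  f (twist M k x) = twist N k (f x).
Proof.
move: x; apply: (additive_homog (C := M)) => [x y|x y|n x xn].
- by rewrite !raddfB.
- by rewrite !raddfB.
by rewrite (twist_homog k xn) (twist_homog k (dgh_deg f xn)) sgn_add.
Qed.

Program Definition sub_incl (A : dgAlg R) (M : dgMod A) (P : dgSub M) :
  dgHom (sub_mod P) M :=
  @DGHom R A (sub_mod P) M (mkAdd (f := @sub_val R A M P) _) _ _ _.
Next Obligation. by []. Qed.
Next Obligation. by []. Qed.
Next Obligation. by move=> A M P n x /sub_homog. Qed.
Next Obligation. by []. Qed.

Section TensorHom.
Variables (S T : dgAlg R) (M : dgMod S) (N : dgBimod S T).
Variables (L : dgMod T) (f : M -> N -> L).
Hypothesis f_bal : balanced f.
Hypothesis f_act : forall x y t, f x (act y t) = act (f x y) t.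
Hypothesis f_deg : forall i j x y, homog M i x -> homog N j y ->
  homog L (i + j) (f x y).
Hypothesis f_dif : forall x y,
  dif L (f x y) = f (dif M x) y + f (twist M 1 x) (dif N y).

Program Definition tens_hom : dgHom (tens M N) L :=
  @DGHom R T (tens M N) L (tens_lift f_bal) _ _ _.
Next Obligation.
move=> z t; change (tens_lift f_bal (tens_act z t) = act (tens_lift f_bal z) t).
move: z; apply: tens_ext => [z w|z w|x y].
- by rewrite tens_actBl raddfB.
- by rewrite raddfB actBl.
by rewrite tens_actE !tens_liftE f_act.
Qed.
Next Obligation.
move=> n z zn; rewrite /homog -[in RHS]zn.
change (pr L n (tens_lift f_bal z) = tens_lift f_bal (tens_pr M N n z)).
move: z {zn}; apply: tens_ext_homog => [z w|z w|i j x y xi yj].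
- by rewrite !raddfB.
- by rewrite !raddfB.
rewrite (tens_prH n xi yj) tens_liftE (pr_homog n (f_deg xi yj)).
by case: eqP; rewrite ?raddf0 ?tens_liftE.
Qed.
Next Obligation.
change (forall z, tens_lift f_bal (tens_dif M N z) = dif L (tens_lift f_bal z)).
apply: tens_ext => [z w|z w|x y]; rewrite ?raddfB//.
by rewrite tens_difE raddfD !tens_liftE f_dif.
Qed.

Lemma tens_homE x y : tens_hom (tens_elt x y) = f x y.
Proof. exact: tens_liftE. Qed.
End TensorHom.

Section TensorBimod.
Variables (U S T : dgAlg R) (M : dgBimod U S) (N : dgBimod S T).

Fact tens_lact_bal (u : U) : balanced (fun x y => tens_elt (lact u x) y : tens M N).
Proof.
split=> [y x x'|x y y'|x s y] /=.
- by rewrite lactBr tens_eltBl.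
- exact: tens_eltBr.
by rewrite lact_act tens_elt_bal.
Qed.

Definition tens_lact (u : U) (z : tens M N) : tens M N :=
  tens_lift (tens_lact_bal u) z.

Lemma tens_lactE u x y :
  tens_lact u (tens_elt x y) = tens_elt (lact u x) y :> tens M N.
Proof. exact: tens_liftE. Qed.

Lemma tens_lactBr u : zmod_morphism (tens_lact u).
Proof. by move=> z w; rewrite /tens_lact raddfB. Qed.

Lemma tens_lactBl z : zmod_morphism (tens_lact^~ z).
Proof.
move=> u v; move: z; apply: tens_ext => [z w|z w|x y].
- exact: tens_lactBr.
- by rewrite !tens_lactBr opprD addrACA -opprD.
by rewrite !tens_lactE lactBl tens_eltBl.
Qed.

Lemma tens_lact0r u : tens_lact u 0 = 0.
Proof. exact: raddf0 (mkAdd (tens_lactBr u)). Qed.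
Lemma tens_lactDr u z w : tens_lact u (z + w) = tens_lact u z + tens_lact u w.
Proof. exact: (raddfD (mkAdd (tens_lactBr u))). Qed.

Program Definition tens_bimod : dgBimod U T :=
  @DGBimod R U T (tens M N) tens_lact tens_lactBl tens_lactBr _ _ _ _ _.
Next Obligation.
by apply: tens_ext => [z w|z w|x y]; rewrite ?tens_lactBr// tens_lactE lact1.
Qed.
Next Obligation.
move=> u v; apply: tens_ext => [z w|z w|x y]; rewrite ?tens_lactBr//.
by rewrite !tens_lactE lactA.
Qed.
Next Obligation.
move=> u z t.
change (tens_lact u (tens_act z t) = tens_act (tens_lact u z) t).
move: z; apply: tens_ext => [z w|z w|x y].
- by rewrite tens_actBl tens_lactBr.
- by rewrite tens_lactBr tens_actBl.
by rewrite tens_actE !tens_lactE tens_actE.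
Qed.
Next Obligation.
move=> i j u z ui zj; rewrite /homog -[in RHS]zj.
change (tens_pr M N (i + j) (tens_lact u z) = tens_lact u (tens_pr M N j z)).
move: z {zj}; apply: tens_ext_homog => [z w|z w|k l x y xk yl].
- by rewrite tens_lactBr raddfB.
- by rewrite raddfB tens_lactBr.
rewrite tens_lactE (tens_prH _ (lact_deg ui xk) yl) (tens_prH _ xk yl) -addrA.
rewrite (inj_eq (addrI i)).
by case: eqP; rewrite ?tens_lactE ?tens_lact0r.
Qed.
Next Obligation.
suff E u z : tens_dif M N (tens_lact u z) =
    tens_lact (dif U u) z + tens_lact (twist U 1 u) (tens_dif M N z).
  move=> i u z ui; change (tens_dif M N (tens_lact u z) =
    tens_lact (dif U u) z + sgn i (tens_lact u (tens_dif M N z))).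
  rewrite E (twist_homog 1 ui) mul1r; congr (_ + _).
  exact: (sgn_add (mkAdd (tens_lactBl _))).
move: z; apply: tens_ext => [z w|z w|x y].
- by rewrite tens_lactBr raddfB.
- by rewrite !raddfB !tens_lactBr opprD addrACA.
rewrite tens_lactE !tens_difE dif_lact tens_eltDl tens_lactDr !tens_lactE.
by rewrite twist_lact addrA.
Qed.
End TensorBimod.

(* id_M (x) f *)
Section TensorMap.
Variables (S T : dgAlg R) (M : dgMod S) (N N' : dgBimod S T) (f : dgBiHom N N').

Let h (x : M) (y : N) : tens M N' := tens_elt x (f y).

Fact tens_map_bal : balanced h.
Proof.
rewrite /h; split=> [y|x y y'|x s y].
- exact: tens_eltBl.
- by rewrite !raddfB.
by rewrite tens_elt_bal dgbh_lact.
Qed.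

Fact tens_map_act x y t : h x (act y t) = act (h x y) t.
Proof. by rewrite /h dgh_act -tens_actE. Qed.

Fact tens_map_deg i j x y : homog M i x -> homog N j y ->
  homog (tens M N') (i + j) (h x y).
Proof. by move=> xi yj; apply: tens_homog => //; apply: dgh_deg. Qed.

Fact tens_map_dif x y :
  dif (tens M N') (h x y) = h (dif M x) y + h (twist M 1 x) (dif N y).
Proof. by rewrite /h dgh_dif -tens_difE. Qed.

Definition tens_map : dgHom (tens M N) (tens M N') :=
  tens_hom tens_map_bal tens_map_act tens_map_deg tens_map_dif.
End TensorMap.

End HomConstructions.

Section BarConstruction.
Variables (R : comPzRingType) (A B : dgAlg R) (phi : dgAlgHom A B).

(* N|_A (x)_A B -> N,  n (x) b |-> n b *)
Section PiN.
Variable N : dgMod B.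

Let h (x : res phi N) (b : lres phi (reg B)) : N := act (x : N) (b : B).

Fact piN_bal : balanced h.
Proof.
split=> [b|x|x a b].
- exact: (actBl (d := N)).
- exact: (actBr (d := N)).
exact: (actA (d := N)).
Qed.
Fact piN_act x b t : h x (act b t) = act (h x b) t.
Proof. by rewrite /h (actA (d := N)). Qed.
Fact piN_deg i j x b : homog (res phi N) i x -> homog (lres phi (reg B)) j b ->
  homog N (i + j) (h x b).
Proof. exact: (act_deg (d := N)). Qed.
Fact piN_dif x b : dif N (h x b) =
  h (dif (res phi N) x) b + h (twist (res phi N) 1 x) (dif (lres phi (reg B)) b).
Proof. exact: (dif_act (M := N)). Qed.

Definition piN : dgHom (tens (res phi N) (lres phi (reg B))) N :=
  tens_hom piN_bal piN_act piN_deg piN_dif.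
End PiN.

(* B (x)_A X, with B acting on the left factor from the left and on X from
   the right. *)
Definition BA (X : dgBimod B B) : dgBimod B B :=
  tens_bimod (rres phi (reg B)) (lres phi X).

(* b (x) x |-> b x *)
Section MulMap.
Variable X : dgBimod B B.

Let h (b : rres phi (reg B)) (x : lres phi X) : X := lact (b : B) (x : X).

Fact mulmap_bal : balanced h.
Proof.
split=> [x|b|b a x].
- exact: (lactBl (d := X)).
- exact: (lactBr (d := X)).
exact/esym/(lactA (d := X)).
Qed.
Fact mulmap_act b x t : h b (act x t) = act (h b x) t.
Proof. exact: (lact_act (d := X)). Qed.
Fact mulmap_deg i j b x : homog (rres phi (reg B)) i b ->
  homog (lres phi X) j x -> homog X (i + j) (h b x).
Proof. exact: (lact_deg (d := X)). Qed.
Fact mulmap_dif b x : dif X (h b x) =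
  h (dif (rres phi (reg B)) b) x +
  h (twist (rres phi (reg B)) 1 b) (dif (lres phi X) x).
Proof. exact: (dif_lact (M := X)). Qed.

Definition mulmap_hom : dgHom (BA X) X :=
  tens_hom mulmap_bal mulmap_act mulmap_deg mulmap_dif.

Lemma mulmap_homE b x :
  mulmap_hom (@tens_elt R A B (rres phi (reg B)) (lres phi X) b x) = lact (b : B) (x : X).
Proof. exact: tens_liftE. Qed.

Program Definition mulmap : dgBiHom (BA X) X :=
  @DGBiHom R B B (BA X) X mulmap_hom _.
Next Obligation.
move=> b; apply: tens_ext => [z w|z w|c x].
- by rewrite raddfB raddfB.
- by rewrite raddfB raddfB.
rewrite [X in mulmap_hom X]tens_lactE !mulmap_homE.
exact/esym/(lactA (d := X)).
Qed.
End MulMap.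

(* DG modules over the enveloping algebra B^e = B (x)_A B are handled as DG
   B-B-bimodules: x (b (x) b') = (-1)^(|b||x|) b x b'. *)
Definition Be : dgBimod B B := BA (reg B).

Definition J : dgBimod B B := ker_bimod (mulmap (reg B)).
Definition J_incl : dgHom J Be := sub_incl (ker_bisub (mulmap (reg B))).

(* J (x)_B X -> B (x)_A X,  (b (x) b') (x) x |-> b (x) b' x *)
Section Iota.
Variable X : dgBimod B B.
Local Notation te := (@tens_elt R A B (rres phi (reg B)) (lres phi X)).
Local Notation tb := (@tens_elt R A B (rres phi (reg B)) (lres phi (reg B))).

Fact contract_bal (x : X) :
  balanced (fun (b : rres phi (reg B)) (b' : lres phi (reg B)) =>
    te b (lact (b' : B) x)).
Proof.
split=> [b' b c|b b' c'|b a b'] /=.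
- exact: (@tens_eltBl R A B (rres phi (reg B)) (lres phi X) (lact (b' : B) x)).
- by rewrite (lactBl (d := X)) (raddfB (mkAdd (@tens_eltBr _ _ _ _ _ b))).
rewrite -(lactA (d := X)); exact: (tens_elt_bal b a (_ : lres phi X)).
Qed.

Definition contract (z : Be) (x : X) : BA X := tens_lift (contract_bal x) z.

Fact contractE b b' x : contract (tb b b') x = te b (lact (b' : B) x).
Proof. exact: tens_liftE. Qed.

Fact contractBl x : zmod_morphism (contract^~ x).
Proof. by move=> z w; rewrite /contract raddfB. Qed.

Fact contractBr z : zmod_morphism (contract z).
Proof.
move=> x y; move: z; apply: tens_ext => [z w|z w|b b'].
- exact: contractBl.
- by rewrite !contractBl opprD addrACA -opprD.
by rewrite !contractE (lactBr (d := X)) tens_eltBr.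
Qed.

Fact contract_bal_act (z : Be) (b : B) x : contract (act z b) x = contract z (lact b x).
Proof.
move: z; apply: tens_ext => [z w|z w|c c'].
- by rewrite actBl contractBl.
- exact: contractBl.
rewrite [X in contract X]tens_actE !contractE (lactA (d := X)).
by [].
Qed.

Fact contract_act (z : Be) x (t : B) : contract z (act x t) = act (contract z x) t.
Proof.
move: z; apply: tens_ext => [z w|z w|c c'].
- exact: contractBl.
- by rewrite contractBl actBl.
by rewrite !contractE [RHS]tens_actE (lact_act (d := X)).
Qed.

Fact contract_lact (z : Be) x (b : B) : contract (lact b z) x = lact b (contract z x).
Proof.
move: z; apply: tens_ext => [z w|z w|c c'].
- by rewrite lactBr contractBl.
- by rewrite contractBl lactBr.
by rewrite [Z in contract Z]tens_lactE !contractE [RHS]tens_lactE.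
Qed.

Fact contract_pr n j (z : Be) x : homog X j x ->
  contract (pr Be n z) x = pr (BA X) (n + j) (contract z x).
Proof.
move=> xj; move: z; apply: tens_ext_homog => [z w|z w|k l b b' bk bl].
- by rewrite raddfB contractBl.
- by rewrite contractBl raddfB.
rewrite [Z in contract Z](tens_prH n bk bl) contractE.
have xl : homog (lres phi X) (l + j) (lact (b' : B) x) by exact: (lact_deg (d := X)).
rewrite [RHS](tens_prH (n + j) bk xl) addrA (inj_eq (addIr j)).
by case: eqP => _; [rewrite contractE|apply: raddf0 (mkAdd (contractBl x))].
Qed.

Fact contract_deg i j (z : Be) x : homog Be i z -> homog X j x ->
  homog (BA X) (i + j) (contract z x).
Proof. by move=> zi xj; rewrite /homog -contract_pr// zi. Qed.

Fact contract_dif (z : Be) x : dif (BA X) (contract z x) =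
  contract (dif Be z) x + contract (twist Be 1 z) (dif X x).
Proof.
move: z; apply: tens_ext_homog => [z w|z w|k l b b' bk bl].
- by rewrite contractBl raddfB.
- by rewrite !raddfB !contractBl opprD addrACA.
rewrite contractE [LHS]tens_difE [Z in contract Z x]tens_difE.
rewrite (twist_homog (C := Be) 1 (tens_homog bk bl)).
have -> z w : contract (z + w) x = contract z x + contract w x.
  exact: (raddfD (mkAdd (contractBl x))).
have -> n z y : contract (sgn n z) y = sgn n (contract z y).
  exact: (sgn_add (mkAdd (contractBl y))).
rewrite !contractE -addrA; congr (_ + _).
rewrite (dif_lact (M := X)) tens_eltDr; congr (_ + _).
rewrite (twist_homog (C := reg B) 1 bk) (twist_homog (C := B) 1 bl).
rewrite (lact_sgnl (M := X)) tens_elt_sgnl tens_elt_sgnr -sgnD.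
by rewrite -mulrDr.
Qed.

Let h (z : J) (x : X) : BA X := contract (J_incl z) x.

Fact iota_bal : balanced h.
Proof.
split=> [x z w|z|z b x]; rewrite /h.
- by rewrite raddfB contractBl.
- exact: contractBr.
by rewrite dgh_act contract_bal_act.
Qed.
Fact iota_act z x t : h z (act x t) = act (h z x) t.
Proof. exact: contract_act. Qed.
Fact iota_deg i j z x : homog J i z -> homog X j x -> homog (BA X) (i + j) (h z x).
Proof. by move=> zi xj; apply: contract_deg => //; apply: dgh_deg. Qed.
Fact iota_dif z x : dif (BA X) (h z x) = h (dif J z) x + h (twist J 1 z) (dif X x).
Proof. by rewrite /h contract_dif !dgh_twist dgh_dif. Qed.

Definition iota_hom : dgHom (tens J X) (BA X) :=
  tens_hom iota_bal iota_act iota_deg iota_dif.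

Program Definition iota : dgBiHom (tens_bimod J X) (BA X) :=
  @DGBiHom R B B (tens_bimod J X) (BA X) iota_hom _.
Next Obligation.
move=> b; apply: tens_ext => [z w|z w|z x].
- by rewrite !raddfB.
- by rewrite !raddfB.
rewrite [Z in iota_hom Z]tens_lactE !tens_homE.
exact: contract_lact.
Qed.

Fact mulmap_contract z x : mulmap X (contract z x) = lact (mulmap (reg B) z : B) x.
Proof.
move: z; apply: tens_ext => [z w|z w|b b'].
- by rewrite contractBl raddfB.
- by rewrite raddfB (lactBl (d := X)).
by rewrite contractE !mulmap_homE (lactA (d := X)).
Qed.

Lemma mulmap_iota z : mulmap X (iota z) = 0.
Proof.
move: z; apply: (tens_ext (h := fun=> 0)) => [z w|z w|z x].
- by rewrite !raddfB.
- by rewrite subr0.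
rewrite [Z in mulmap X Z]tens_homE mulmap_contract.
have /eqP -> := sub_val_in z.
exact: lact0l.
Qed.
End Iota.

(* J^{(x)_B n} *)
Fixpoint Jpow (n : nat) : dgBimod B B :=
  if n is m.+1 then tens_bimod J (Jpow m) else reg B.

Definition iotan n : dgBiHom (Jpow n.+1) (BA (Jpow n)) := iota (Jpow n).
Definition pin n : dgBiHom (BA (Jpow n)) (Jpow n) := mulmap (Jpow n).

Program Definition dgh_comp (S T : dgAlg R) (M N P : dgBimod S T)
  (g : dgBiHom N P) (f : dgBiHom M N) : dgBiHom M P :=
  @DGBiHom R S T M P (@DGHom R T M P (mkAdd (f := g \o f) _) _ _ _) _.
Next Obligation. by move=> S T M N P g f x y /=; rewrite !raddfB. Qed.
Next Obligation. by move=> S T M N P g f x a /=; rewrite !dgh_act. Qed.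
Next Obligation. by move=> S T M N P g f n x xn; apply/dgh_deg/dgh_deg. Qed.
Next Obligation. by move=> S T M N P g f x /=; rewrite !dgh_dif. Qed.
Next Obligation. by move=> S T M N P g f s x /=; rewrite !dgbh_lact. Qed.

Definition bar_bd n : dgBiHom (BA (Jpow n.+1)) (BA (Jpow n)) :=
  dgh_comp (iotan n) (pin n.+1).

Fact bar_bd_bd n x : bar_bd n (bar_bd n.+1 x) = 0.
Proof.
change (iotan n (pin n.+1 (iotan n.+1 (pin n.+2 x))) = 0).
by rewrite [pin _ _]mulmap_iota raddf0.
Qed.

(* The direct sum of the Sigma^n (B (x)_A J^{(x)_B n}), spliced along the
   short exact sequences of the maps [iotan n] and [pin n]. *)
Definition bar : dgBimod B B := tot_bimod bar_bd_bd.
Definition bar_le (l : nat) : dgBiSub bar := tot_le bar_bd_bd l.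
Definition bar_quo (l : nat) : dgBimod B B := quo_bimod (bar_le l).
Definition omega (l : nat) : dgBiHom bar (bar_quo l) := quo_biproj (bar_le l).

End BarConstruction.

Section Homology.
Variables (V : zmodType) (C : cpx V).

Fact cycles_closed : zmod_closed [pred x : V | dif C x == 0].
Proof.
split=> [|x y]; rewrite !inE ?raddf0// raddfB => /eqP-> /eqP->.
by rewrite subr0.
Qed.
Definition cycles : zmodClosed V := mkZmodClosed cycles_closed.

Fact boundaries_closed :
  zmod_closed [pred z : subg cycles | `[< exists y, val z = dif C y >]].
Proof.
split=> [|z w /asboolP[x zx] /asboolP[y wy]]; apply/asboolP.
  by exists 0; rewrite raddf0.
by exists (x - y); rewrite [LHS]raddfB /= zx wy raddfB.
Qed.
Definition boundaries : zmodClosed (subg cycles) := mkZmodClosed boundaries_closed.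

Definition homology : zmodType := quo boundaries.
End Homology.

Section QuasiIso.
Variables (R : comPzRingType) (A : dgAlg R).

Section HomologyMap.
Variables (M N : dgMod A) (f : dgHom M N).

Fact cycles_map_subproof (z : subg (cycles M)) : f (val z) \in cycles N.
Proof.
by have := valP z; rewrite !inE -dgh_dif => /eqP->; rewrite raddf0.
Qed.
Let cmap (z : subg (cycles M)) : subg (cycles N) :=
  exist _ (f (val z)) (cycles_map_subproof z).
Fact cycles_mapB : zmod_morphism cmap.
Proof. by move=> z w; apply: val_inj; rewrite /= !raddfB. Qed.
Definition cycles_map : {additive subg (cycles M) -> subg (cycles N)} :=
  mkAdd cycles_mapB.

Fact homology_map_subproof z : z \in boundaries M ->
  (qpi (boundaries N) \o cycles_map) z = 0.
Proof.
move=> /asboolP[y zy]; apply/qpi_eq0/asboolP; exists (f y).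
by rewrite /= zy dgh_dif.
Qed.
Definition homology_map : {additive homology M -> homology N} :=
  qlift homology_map_subproof.
End HomologyMap.

Definition quasi_iso (M N : dgMod A) (f : dgHom M N) : Prop :=
  bijective (homology_map f).

(* Zigzags of quasiisomorphisms. *)
Definition quasi_isomorphic : dgMod A -> dgMod A -> Prop :=
  clos_refl_sym_trans (dgMod A) (fun M N => exists f : dgHom M N, quasi_iso f).
End QuasiIso.

Section Semifree.
Variables (R : comPzRingType) (A : dgAlg R).

Definition in_span (M : dgMod A) (F : {pred M}) (x : M) : Prop :=
  exists (s : seq M) (c : M -> A),
    {subset s <= F} /\ x = \sum_(f <- s) act f (c f).

Definition graded_basis (M : dgMod A) (F : {pred M}) : Prop :=
  [/\ forall f, f \in F -> exists n, homog M n f,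
      forall x, in_span F x &
      forall (s : seq M) (c : M -> A), uniq s -> {subset s <= F} ->
        \sum_(f <- s) act f (c f) = 0 -> forall f, f \in s -> c f = 0].

(* [le] is the non-strict well-order on F. *)
Definition semifree_basis (M : dgMod A) (F : {pred M}) (le : rel M) : Prop :=
  [/\ graded_basis F, wo_chain le F &
      forall f, f \in F ->
        in_span [pred e | [&& e \in F, le e f & e != f]] (dif M f)].

Definition semifree (M : dgMod A) : Prop :=
  exists (F : {pred M}) (le : rel M), semifree_basis F le.

Definition finite_semifree (M : dgMod A) : Prop :=
  exists (F : {pred M}) (le : rel M),
    semifree_basis F le /\ exists s : seq M, F =i s.

Definition perfect (M : dgMod A) : Prop :=
  exists2 P : dgMod A, finite_semifree P & quasi_isomorphic M P.
End Semifree.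

Section Homotopy.
Variables (R : comPzRingType) (A : dgAlg R).

Program Definition zero_hom (M N : dgMod A) : dgHom M N :=
  @DGHom R A M N (mkAdd (f := fun=> 0) _) _ _ _.
Next Obligation. by move=> M N x y; rewrite subr0. Qed.
Next Obligation. by move=> M N x a; rewrite /= act0l. Qed.
Next Obligation. by move=> M N n x _; apply: homog0. Qed.
Next Obligation. by move=> M N x; rewrite /= raddf0. Qed.

Definition homotopic (M N : dgMod A) (f g : dgHom M N) : Prop :=
  exists h : {additive M -> N},
  [/\ forall x a, h (act x a) = act (h x) a,
      forall n x, homog M n x -> homog (shift (-1) N) n (h x) &
      forall x, f x - g x = dif N (h x) + h (dif M x)].

Definition null_homotopic (M N : dgMod A) (f : dgHom M N) : Prop :=
  homotopic f (zero_hom M N).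

(* Hom_{K(A)}(M, N) = 0 *)
Definition homK_eq0 (M N : dgMod A) : Prop :=
  forall f : dgHom M N, null_homotopic f.
End Homotopy.

Section Setting.
Variables (R : comPzRingType) (A B : dgAlg R) (phi : dgAlgHom A B).

Program Definition dgah_mod : dgHom (reg A) (res phi (reg B)) :=
  @DGHom R A (reg A) (res phi (reg B)) (mkAdd (f := phi) _) _ _ _.
Next Obligation. by move=> x y; rewrite raddfB. Qed.
Next Obligation. by move=> x a; rewrite /= rmorphM. Qed.
Next Obligation. exact: dgah_deg. Qed.
Next Obligation. exact: dgah_dif. Qed.

Definition Bbar : dgMod A := quo_mod (im_sub dgah_mod).

(* B is a semifree extension of A, and Bbar = B/A is semifree over A and
   positively graded. *)
Definition setting : Prop :=
  [/\ injective phi, semifree (res phi (reg B)), semifree Bbar &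
      forall n q, n <= 0 -> homog Bbar n q -> q = 0].

Definition AR1 (N : dgMod B) : Prop :=
  [/\ semifree N /\ (forall n x, n < 0 -> homog N n x -> x = 0),
      perfect (res phi (reg B)) /\ perfect (res phi N) &
      forall n : nat, (1 <= n)%N -> homK_eq0 N (shift n%:Z (reg B))].

(* [tens (res phi N) (lres phi (reg B))] is N|_A (x)_A B. *)
Definition naively_liftable (N : dgMod B) : Prop :=
  exists s : dgHom N (tens (res phi N) (lres phi (reg B))),
    forall x, piN phi N (s x) = x.
End Setting.

(* Main.v *)
(* Write J for the diagonal ideal and delta b = b (x) 1 - 1 (x) b.

   (i) => (iii). As a complex of A-B-bimodules, bar is contracted onto
   1 (x)_A B by b (x) x |-> 1 (x) (delta b (x) x).  A section s of pi_N
   transports this contraction from N (x)_A bar to its retract N (x)_B bar,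
   and the defect lies in N (x)_B bar^{<=0}, which every omega^l kills.

   (iv) => (i). A graded B-linear section s0 of N (x)_A B -> N exists because
   N is semifree; the failure of s0 to commute with the differentials is a
   closed map N -> N (x)_B J of degree -1, the Atiyah class.  Its powers
   theta_n : N -> N (x)_B J^n are the obstructions met when id_N is lifted
   along N (x)_B bar -> N; as N is non-negatively graded these lifts form a
   finite sum on each element, so a null-homotopy of id_N (x) omega^l makes
   theta_(l+1) null-homotopic.  If theta_(n+1) is null-homotopic, then theta_n
   factors through a closed map N -> N (x)_A J^n of degree -n; for n >= 1 such
   maps are null-homotopic, and for n = 0 the factorization is a section of
   pi_N.

   The vanishing of Hom_K(N, Sigma^n (N (x)_A J^n)) for n >= 1 propagates from
   B: J (x)_B X is a right B-linear retract of B (x)_A X, and if M is a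
   perfect non-negatively graded A-module, the identity of M (x)_A X factors
   up to homotopy through a finite iterated extension of shifts Sigma^i X
   with i >= 0. *)
Require Import Defs.
From mathcomp Require Import all_boot all_order all_algebra.
From mathcomp Require Import boolp.

Set Implicit Arguments.
Unset Strict Implicit.
Unset Printing Implicit Defensive.

Import GRing.Theory Num.Theory Order.TTheory.
Local Open Scope ring_scope.

(** * Graded maps and homotopies *)

Lemma sgnNr (V : zmodType) n (x : V) : sgn n (- x) = - sgn n x.
Proof. exact: raddfN. Qed.
Lemma sgnDr (V : zmodType) n (x y : V) : sgn n (x + y) = sgn n x + sgn n y.
Proof. exact: raddfD. Qed.
Lemma sgnBr (V : zmodType) n (x y : V) : sgn n (x - y) = sgn n x - sgn n y.
Proof. exact: raddfB. Qed.
Lemma sgn0r (V : zmodType) n : sgn n (0 : V) = 0.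
Proof. exact: raddf0. Qed.

Section Additive.
Variables (M N : zmodType) (f : M -> N) (fB : zmod_morphism f).
Lemma zmor0 : f 0 = 0. Proof. exact: raddf0 (mkAdd fB). Qed.
Lemma zmorN : {morph f : x / - x}. Proof. exact: raddfN (mkAdd fB). Qed.
Lemma zmorD : {morph f : x y / x + y}. Proof. exact: raddfD (mkAdd fB). Qed.
Lemma zmor_sgn n x : f (sgn n x) = sgn n (f x). Proof. exact: (sgn_add (mkAdd fB)). Qed.
Lemma zmor_sum I (r : seq I) (F : I -> M) : f (\sum_(i <- r) F i) = \sum_(i <- r) f (F i).
Proof. exact: (raddf_sum (mkAdd fB)). Qed.
End Additive.

Section GradedMaps.
Variables (R : comPzRingType) (A : dgAlg R).
Implicit Types (L M N : dgMod A) (j k l n : int).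

Definition ghom M N k (f : M -> N) : Prop :=
  [/\ zmod_morphism f, forall x a, f (act x a) = act (f x) a &
      forall n x, homog M n x -> homog N (n + k) (f x)].

(** The differential of the Hom complex on maps of degree [k]; [gclosed] and [gexact] name its
    cycles and boundaries. On linear maps of degree 0 they mean chain map and null-homotopic map. *)
Definition dcomm M N k (f : M -> N) (x : M) : N :=
  dif N (f x) - sgn k (f (dif M x)).

Definition gclosed M N k (f : M -> N) : Prop := forall x, dcomm k f x = 0.

Definition gexact M N k (f : M -> N) : Prop :=
  exists2 h : M -> N, ghom (k + 1) h & forall x, f x = dcomm (k + 1) h x.

Lemma ghomB M N k (f : M -> N) : ghom k f -> zmod_morphism f. Proof. by case. Qed.

Lemma ghom_twist M N k (f : M -> N) : ghom k f ->
  forall n x, twist N n (f x) = sgn (n * k) (f (twist M n x)).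
Proof.
case=> fB _ fd n; apply: (additive_homog (C := M)) => [x y|x y|m x xm].
- by rewrite fB raddfB.
- by rewrite raddfB fB raddfB.
rewrite (twist_homog n (fd _ _ xm)) (twist_homog n xm) (zmor_sgn fB) -sgnD.
by rewrite -mulrDr addrC.
Qed.

Lemma dgh_ghom M N (f : dgHom M N) : ghom 0 f.
Proof.
split; [exact: raddfB|exact: dgh_act|].
by move=> n x; rewrite addr0; apply: dgh_deg.
Qed.

Lemma dgh_closed M N (f : dgHom M N) : gclosed 0 f.
Proof. by move=> x; rewrite /dcomm sgn0 dgh_dif subrr. Qed.

Lemma ghom_dgHom M N (f : M -> N) : ghom 0 f -> gclosed 0 f ->
  exists g : dgHom M N, forall x, g x = f x.
Proof.
case=> fB fl fd fc.
have fd' n x : homog M n x -> homog N n (mkAdd fB x).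
  by move=> xn; rewrite -[n]addr0; apply: fd.
have fc' x : mkAdd fB (dif M x) = dif N (mkAdd fB x).
  by apply/esym/eqP; rewrite -subr_eq0 -[X in _ - X]sgn0; apply/eqP/fc.
by exists (DGHom (dgh := mkAdd fB) fl fd' fc').
Qed.

Lemma ghom_comp L M N j k (g : M -> N) (f : L -> M) :
  ghom j g -> ghom k f -> ghom (j + k) (fun x => g (f x)).
Proof.
case=> gB gl gd [fB fl fd]; split=> [x y|x a|n x xn].
- by rewrite fB gB.
- by rewrite fl gl.
by rewrite (addrC j) addrA; apply/gd/fd.
Qed.

Lemma ghomD M N k (f g : M -> N) : ghom k f -> ghom k g ->
  ghom k (fun x => f x + g x).
Proof.
case=> fB fl fd [gB gl gd]; split=> [x y|x a|n x xn].
- by rewrite fB gB opprD addrACA.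
- by rewrite fl gl actDl.
by apply: homogD; [apply: fd|apply: gd].
Qed.

Lemma ghom_sgn M N k n (f : M -> N) : ghom k f -> ghom k (fun x => sgn n (f x)).
Proof.
case=> fB fl fd; split=> [x y|x a|m x xm].
- by rewrite fB raddfB.
- by rewrite fl act_sgnl.
exact/homog_sgn/fd.
Qed.

Lemma ghom0 M N k : ghom k (fun _ : M => 0 : N).
Proof.
by split=> [x y|x a|n x _]; [rewrite subr0|rewrite act0l|apply: homog0].
Qed.

Lemma ghom_sum M N k I (r : seq I) (F : I -> M -> N) :
  (forall i, ghom k (F i)) -> ghom k (fun x => \sum_(i <- r) F i x).
Proof.
move=> Fg; elim: r => [|i r IH].
  have -> : (fun x => \sum_(i <- [::]) F i x) = fun=> 0.
    by apply/funext => x; rewrite big_nil.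
  exact: ghom0.
have -> : (fun x => \sum_(j <- i :: r) F j x) = fun x => F i x + \sum_(j <- r) F j x.
  by apply/funext => x; rewrite big_cons.
exact: ghomD.
Qed.

Lemma ghomN M N k (f : M -> N) : ghom k f -> ghom k (fun x => - f x).
Proof.
by move=> fg; have := ghom_sgn 1 fg; rewrite (_ : (fun x => sgn 1 (f x)) = fun x => - f x) //; apply/funext => x; rewrite sgn1.
Qed.

Lemma ghom_id M : ghom 0 (fun x : M => x).
Proof. by split=> // n x; rewrite addr0. Qed.

(** Linearity holds because the two terms containing [dif A a] cancel: by [ghom_twist], twisting
    before or after [f] differs by the sign (-1)^k. *)
Lemma ghom_dcomm M N j k (f : M -> N) : ghom k f -> j = k - 1 -> ghom j (dcomm k f).
Proof.
move=> fg ->; have [fB fl fd] := fg; split=> [x y|x a|n x xn].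
- by rewrite /dcomm !(fB, raddfB)/= addrACA.
- rewrite /dcomm fl !dif_act (zmorD fB) !fl (ghom_twist fg) mul1r act_sgnl raddfD /=.
  by rewrite opprD addrACA subrr addr0 -act_sgnl actBl.
apply: homogB; first by rewrite addrA; apply/dif_deg/fd.
by rewrite addrCA addrC; apply/homog_sgn/fd/dif_deg.
Qed.

(** The Leibniz rule for composition; hence composing with closed maps preserves closed and exact
    maps. *)
Lemma dcomm_comp L M N j k l (g : M -> N) (f : L -> M) x :
  zmod_morphism g -> l = j + k ->
  dcomm l (fun x => g (f x)) x = dcomm j g (f x) + sgn j (g (dcomm k f x)).
Proof.
move=> gB ->; rewrite /dcomm gB (zmor_sgn gB) raddfB /= sgnD.
by rewrite addrA subrK.
Qed.

Lemma dcomm_comp_closedl L M N j k l (g : M -> N) (f : L -> M) x :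
  zmod_morphism g -> gclosed j g -> l = j + k ->
  dcomm l (fun x => g (f x)) x = sgn j (g (dcomm k f x)).
Proof. by move=> gB gc e; rewrite (dcomm_comp _ _ gB e) gc add0r. Qed.

Lemma dcomm_comp_closedr L M N j k l (g : M -> N) (f : L -> M) x :
  zmod_morphism g -> gclosed k f -> l = j + k ->
  dcomm l (fun x => g (f x)) x = dcomm j g (f x).
Proof. by move=> gB fc e; rewrite (dcomm_comp _ _ gB e) fc (zmor0 gB) raddf0 addr0. Qed.

Lemma gclosed_dcomm M N j k (f : M -> N) : zmod_morphism f -> j = k - 1 ->
  gclosed j (dcomm k f).
Proof.
move=> fB -> x; rewrite /dcomm dif_dif (zmor0 fB) raddf0 subr0 raddfB /= dif_dif.
by rewrite sub0r sgn_add sgnD sgnN sgn1 sgnNr opprK addNr.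
Qed.

Lemma gclosed_comp L M N j k l (g : M -> N) (f : L -> M) :
  zmod_morphism g -> l = j + k -> gclosed j g -> gclosed k f ->
  gclosed l (fun x => g (f x)).
Proof.
by move=> gB e gc fc x; rewrite (dcomm_comp_closedl _ _ gB gc e) fc (zmor0 gB) raddf0.
Qed.

Lemma dcommD M N k (f g : M -> N) x :
  dcomm k (fun x => f x + g x) x = dcomm k f x + dcomm k g x.
Proof. by rewrite /dcomm (raddfD (dif N)) sgnDr opprD addrACA. Qed.

Lemma dcomm_sgn M N k n (f : M -> N) x :
  dcomm k (fun x => sgn n (f x)) x = sgn n (dcomm k f x).
Proof. by rewrite /dcomm sgnBr (sgn_add (dif N)) (sgnC k). Qed.

Lemma dcommB M N k (f g : M -> N) x :
  dcomm k (fun x => f x - g x) x = dcomm k f x - dcomm k g x.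
Proof. by rewrite /dcomm (raddfB (dif N)) sgnBr !opprD !opprK addrACA. Qed.

Lemma gexact_ext M N k (f g : M -> N) : (forall x, g x = f x) ->
  gexact k f -> gexact k g.
Proof. by move=> gf [h hg fh]; exists h => // x; rewrite gf. Qed.

Lemma gexactD M N k (f g : M -> N) : gexact k f -> gexact k g ->
  gexact k (fun x => f x + g x).
Proof.
move=> [h hg fh] [h' hg' gh']; exists (fun x => h x + h' x); first exact: ghomD.
by move=> x; rewrite dcommD fh gh'.
Qed.

Lemma gexact_sgn M N k n (f : M -> N) : gexact k f -> gexact k (fun x => sgn n (f x)).
Proof.
move=> [h hg fh]; exists (fun x => sgn n (h x)); first exact: ghom_sgn.
by move=> x; rewrite dcomm_sgn fh.
Qed.

Lemma gexact_compl L M N j k l (g : M -> N) (f : L -> M) :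
  ghom j g -> gclosed j g -> gexact k f -> l = j + k -> gexact l (fun x => g (f x)).
Proof.
move=> gg gc [h hg fh] ->; exists (fun x => sgn j (g (h x))).
  by apply: ghom_sgn; rewrite -addrA; apply: ghom_comp.
move=> x; rewrite dcomm_sgn (dcomm_comp_closedl _ _ (ghomB gg) gc (esym (addrA j k 1))).
by rewrite fh sgnK.
Qed.

Lemma gexact_compr L M N j k l (g : M -> N) (f : L -> M) :
  ghom k f -> gclosed k f -> gexact j g -> l = j + k -> gexact l (fun x => g (f x)).
Proof.
move=> fg fc [h hg fh] ->; exists (fun x => h (f x)).
  by rewrite addrAC; apply: ghom_comp.
by move=> x; rewrite (dcomm_comp_closedr _ (ghomB hg) fc (addrAC _ _ _)) fh.
Qed.

(** The component of degree n of [shift (-1) N] is that of degree n + 1 of N, so homotopies are maps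
    of degree 1, and the sign in [dcomm 1] turns the commutator into a sum. *)
Lemma null_homotopicP M N (f : dgHom M N) :
  null_homotopic f <-> gexact 0 f.
Proof.
split=> [[h [hl hd fh]]|[h [hB hl hd] fh]].
  exists h.
    split=> [||n x /hd]; [exact: raddfB|exact: hl|].
    by rewrite /homog /= opprK add0r.
  by move=> x; have := fh x; rewrite subr0 add0r /dcomm sgn1 opprK.
exists (mkAdd hB); split=> [//|n x /hd|x].
  by rewrite /homog /= opprK add0r.
by rewrite subr0 fh /dcomm add0r sgn1 opprK.
Qed.

End GradedMaps.

(** * Bases of graded modules *)

Lemma eq_sum_supp (I : eqType) (W : zmodType) (F : I -> W) (s t : seq I) :
  uniq s -> uniq t -> (forall i, i \notin s -> F i = 0) ->
  (forall i, i \notin t -> F i = 0) ->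
  \sum_(i <- s) F i = \sum_(i <- t) F i.
Proof.
have E (u v : seq I) : (forall i, i \notin v -> F i = 0) ->
    \sum_(i <- u) F i = \sum_(i <- u | i \in v) F i.
  by move=> uv; rewrite [LHS](bigID (mem v))/= [X in _ + X]big1 ?addr0// => i /uv.
move=> us ut s0 t0; rewrite (E s t t0) (E t s s0) -[LHS]big_filter -[RHS]big_filter.
apply: perm_big; apply: uniq_perm; rewrite ?filter_uniq// => i.
by rewrite !mem_filter andbC.
Qed.

Section GradedBases.
Variables (R : comPzRingType) (A : dgAlg R).

(* A basis of the underlying graded module, given with its coordinate
   functionals; indexing avoids collisions over the zero ring. *)
Record gbasis (M : dgMod A) := GBasis {
  gix : eqType;
  gb : gix -> M;
  gdeg : gix -> int;
  gco : gix -> {additive M -> A};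
  gb_homog : forall i, homog M (gdeg i) (gb i);
  gco_act : forall i x a, gco i (act x a) = gco i x * a;
  gco_gb : forall i j, gco i (gb j) = if i == j then 1 else 0;
  gb_span : forall x, exists s : seq gix, [/\ uniq s,
    forall i, i \notin s -> gco i x = 0 & x = \sum_(i <- s) act (gb i) (gco i x)] }.

Lemma pr_act_homog (M : dgMod A) n m (x : M) (a : A) : homog M m x ->
  pr M n (act x a) = act x (pr A (n - m) a).
Proof.
move=> xm; move: a; apply: (additive_homog (C := A)) => [a b|a b|j a aj].
- by rewrite !raddfB.
- by rewrite !raddfB.
rewrite (pr_homog _ (act_deg xm aj)) (pr_homog _ aj) subr_eq addrC.
by case: eqP; rewrite ?raddf0.
Qed.

Section Coordinates.
Variables (M : dgMod A) (b : gbasis M).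
Implicit Types (i j : gix b) (x : M).

Definition gsupp x : seq (gix b) := sval (cid (gb_span b x)).

Lemma gsupp_uniq x : uniq (gsupp x).
Proof. by case: (svalP (cid (gb_span b x))). Qed.

Lemma gco_notin x i : i \notin gsupp x -> gco i x = 0.
Proof. by case: (svalP (cid (gb_span b x))) => _ + _; apply. Qed.

Lemma gsupp_sum x : x = \sum_(i <- gsupp x) act (gb i) (gco i x).
Proof. by case: (svalP (cid (gb_span b x))). Qed.

Lemma gco_gb_act i j a : gco i (act (gb j) a) = if i == j then a else 0.
Proof. by rewrite gco_act gco_gb; case: eqP; rewrite ?mul1r ?mul0r. Qed.

Lemma gb_ext (W : zmodType) (f g : M -> W) :
  zmod_morphism f -> zmod_morphism g ->
  (forall i a, f (act (gb i) a) = g (act (gb i) a)) -> f =1 g.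
Proof.
move=> fB gB fg x; rewrite (gsupp_sum x).
rewrite -[f]/(mkAdd fB : M -> W) -[g]/(mkAdd gB : M -> W) !raddf_sum.
by apply: eq_bigr => i _; apply: fg.
Qed.

Lemma gco_pr i n x : gco i (pr M n x) = pr A (n - gdeg i) (gco i x).
Proof.
move: x; apply: gb_ext => [x y|x y|j a]; rewrite ?raddfB//.
rewrite (pr_act_homog _ _ (gb_homog j)) !gco_gb_act.
by case: eqP => [->|]; rewrite ?raddf0.
Qed.

Lemma gco_deg i n x : homog M n x -> homog A (n - gdeg i) (gco i x).
Proof. by rewrite /homog -gco_pr => ->. Qed.

(** Coefficients have non-negative degree. Applied to the differential of a basis element, this
    makes the differential strictly triangular with respect to [gdeg]. *)
Lemma gco_eq0 i n x : homog M n x -> n < gdeg i -> gco i x = 0.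
Proof.
move=> /gco_deg xn ni; apply: dga_nneg (xn i); by rewrite subr_lt0.
Qed.

Definition gext (L : dgMod A) (v : gix b -> L) x : L :=
  \sum_(i <- gsupp x) act (v i) (gco i x).

Lemma gextE (L : dgMod A) (v : gix b -> L) (s : seq (gix b)) x : uniq s ->
  (forall i, i \notin s -> gco i x = 0) ->
  gext v x = \sum_(i <- s) act (v i) (gco i x).
Proof.
move=> us sx; apply: eq_sum_supp => // [|i /gco_notin->|i /sx->].
- exact: gsupp_uniq.
- exact: raddf0.
- exact: raddf0.
Qed.

Lemma gext_local (L : dgMod A) (v w : gix b -> L) x :
  (forall i, gco i x <> 0 -> v i = w i) -> gext v x = gext w x.
Proof.
move=> vw; apply: eq_bigr => i _; have [-> |/eqP/vw->//] := eqVneq (gco i x) 0.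
by rewrite !raddf0.
Qed.

Lemma gextB (L : dgMod A) (v : gix b -> L) : zmod_morphism (gext v).
Proof.
move=> x y; pose s := undup (gsupp x ++ gsupp y).
have xs i : i \notin s -> gco i x = 0.
  by rewrite mem_undup mem_cat negb_or => /andP[+ _]; apply: gco_notin.
have ys i : i \notin s -> gco i y = 0.
  by rewrite mem_undup mem_cat negb_or => /andP[_ +]; apply: gco_notin.
have us : uniq s by apply: undup_uniq.
rewrite !(gextE v us)//; last by move=> i si; rewrite raddfB xs// ys// subrr.
by rewrite -sumrB; apply: eq_bigr => i _; rewrite !raddfB.
Qed.

Lemma gext_gb (L : dgMod A) (v : gix b -> L) i a :
  gext v (act (gb i) a) = act (v i) a.
Proof.
rewrite (gextE v (s := [:: i])) ?big_seq1 ?gco_gb_act ?eqxx// => j.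
by rewrite inE gco_gb_act => /negPf->.
Qed.

Lemma gext_ghom (L : dgMod A) (v : gix b -> L) k :
  (forall i, homog L (gdeg i + k) (v i)) -> ghom k (gext v).
Proof.
move=> vd; split; first exact: gextB.
  move=> x a; rewrite (gextE v (gsupp_uniq x)).
    rewrite /gext -[RHS]/(mkAdd (actBl a) _) raddf_sum; apply: eq_bigr => i _.
    by rewrite gco_act -actA.
  by move=> i /gco_notin; rewrite gco_act => ->; rewrite mul0r.
move=> n x xn; rewrite /gext; elim/big_rec: _ => [|i y _ yn]; first exact: homog0.
apply: homogD => //; have := act_deg (vd i) (gco_deg i xn).
by rewrite addrC addrA subrK.
Qed.

End Coordinates.
End GradedBases.

Section BasisExistence.
Variables (R : comPzRingType) (A : dgAlg R) (M : dgMod A) (F : {pred M}).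
Hypothesis FP : graded_basis F.

Let rep (x : M) (c : M -> A) : Prop := exists s : seq M,
  [/\ uniq s, {subset s <= F}, forall f, f \notin s -> c f = 0 &
      x = \sum_(f <- s) act f (c f)].

Fact basis_rep x : exists c, rep x c.
Proof.
case: FP => _ /(_ x)[s [c [sF ->]]] _.
(* The spanning list may repeat an element; its copies share one coefficient, so merging them
   multiplies it by the multiplicity. *)
exists (fun f => c f *+ count_mem f s), (undup s); split.
- exact: undup_uniq.
- by move=> f; rewrite mem_undup; apply: sF.
- by move=> f; rewrite mem_undup => /count_memPn->; rewrite mulr0n.
rewrite -[LHS]big_undup_iterop_count/=; apply: eq_bigr => f _.
by rewrite raddfMn.
Qed.

Fact basis_rep_uniq x c c' : rep x c -> rep x c' -> c = c'.
Proof.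
move=> [s [us sF s0 xs]] [t [ut tF t0 xt]]; pose u := undup (s ++ t).
have uF : {subset u <= F}.
  by move=> f; rewrite mem_undup mem_cat => /orP[/sF|/tF].
have us0 f : f \notin u -> f \notin s /\ f \notin t.
  by rewrite mem_undup mem_cat negb_or => /andP[].
have E (d : M -> A) v : uniq v -> {subset v <= u} -> (forall f, f \notin v -> d f = 0) ->
    \sum_(f <- v) act f (d f) = \sum_(f <- u) act f (d f).
  move=> uv vu v0; apply: eq_sum_supp => // [|f /v0->|f fu].
  - exact: undup_uniq.
  - by rewrite raddf0.
  - by rewrite v0 ?raddf0//; apply: contra fu; apply: vu.
have Z : \sum_(f <- u) act f (c f - c' f) = 0.
  under eq_bigr do rewrite raddfB.
  rewrite sumrB -(E c s)// -?(E c' t)// -?xs -?xt ?subrr//.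
    by move=> f ft; rewrite mem_undup mem_cat ft orbT.
  by move=> f fs; rewrite mem_undup mem_cat fs.
apply/funext => f; case: (boolP (f \in u)) => fu; last first.
  by have [/s0-> /t0->] := us0 f fu.
apply/eqP; rewrite -subr_eq0; apply/eqP.
case: FP => _ _ /(_ u (fun f => c f - c' f)); apply=> //; exact: undup_uniq.
Qed.

Let co (x : M) : M -> A := sval (cid (basis_rep x)).
Let coP x : rep x (co x). Proof. exact: svalP (cid (basis_rep x)). Qed.
Let coE x c : rep x c -> co x = c. Proof. exact: basis_rep_uniq (coP x). Qed.

Fact rep_act x c a : rep x c -> rep (act x a) (fun f => c f * a).
Proof.
move=> [s [us sF s0 xs]]; exists s; split=> // [f /s0->|]; first by rewrite mul0r.
rewrite xs -[LHS]/(mkAdd (actBl a) _) raddf_sum; apply: eq_bigr => f _ /=.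
by rewrite actA.
Qed.

Fact rep_sub x c y d : rep x c -> rep y d -> rep (x - y) (fun f => c f - d f).
Proof.
move=> [s [us sF s0 xs]] [t [ut tF t0 yt]]; exists (undup (s ++ t)).
have N f : f \notin undup (s ++ t) -> f \notin s /\ f \notin t.
  by rewrite mem_undup mem_cat negb_or => /andP[].
split=> [||f /N[/s0-> /t0->]|]; first exact: undup_uniq.
- by move=> f; rewrite mem_undup mem_cat => /orP[/sF|/tF].
- by rewrite subr0.
under eq_bigr do rewrite raddfB; rewrite sumrB xs yt; congr (_ - _).
  apply: eq_sum_supp => // [|f /s0->|f /N[/s0-> _]]; rewrite ?raddf0//.
  exact: undup_uniq.
apply: eq_sum_supp => // [|f /t0->|f /N[_ /t0->]]; rewrite ?raddf0//.
exact: undup_uniq.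
Qed.

Fact rep_basis g : g \in F -> rep g (fun f => if f == g then 1 else 0).
Proof.
move=> gF; exists [:: g]; split=> // [f|f|].
- by rewrite inE => /eqP->.
- by rewrite inE => /negPf->.
by rewrite big_seq1 eqxx act1.
Qed.

Fact coB f : zmod_morphism (co ^~ f).
Proof. by move=> x y; rewrite (coE (rep_sub (coP x) (coP y))). Qed.

(** Degrees are chosen rather than computed, since over the zero ring basis elements are 0 and have
    every degree; hence the hypothesis asks only for some degree at least m. The last clause carries
    finiteness of F over to the index type. *)
Lemma graded_basis_gbasis m :
  (forall f, f \in F -> exists2 n, m <= n & homog M n f) ->
  exists b : gbasis M, (forall i : gix b, m <= gdeg i) /\
    forall s : seq M, F =i s -> exists t : seq (gix b), forall i, i \in t.
Proof.
move=> Fm; pose ix : eqType := {f : M | f \in F}.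
pose deg (i : ix) := s2val (cid2 (Fm (val i) (valP i))).
have degP (i : ix) : homog M (deg i) (val i) := s2valP' (cid2 (Fm (val i) (valP i))).
have degm (i : ix) : m <= deg i := s2valP (cid2 (Fm (val i) (valP i))).
have sp x : exists s : seq ix, [/\ uniq s, forall i, i \notin s -> co x (val i) = 0 &
    x = \sum_(i <- s) act (val i) (co x (val i))].
  have [s [us sF s0 xs]] := coP x; exists (pmap insub s).
  have vs : map val (pmap insub s : seq ix) = s.
    rewrite (pmap_filter (@insubK _ _ _)); apply/all_filterP/allP => f /sF fF.
    by rewrite /= insubT.
  split; first by rewrite -(map_inj_uniq val_inj) vs.
    by move=> i; rewrite -(mem_map val_inj) vs => /s0.
  by rewrite [LHS]xs -{1}vs big_map.
have act_co (i : ix) x a : mkAdd (coB (val i)) (act x a) = mkAdd (coB (val i)) x * a.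
  by rewrite /= (coE (rep_act a (coP x))).
have gb_co (i j : ix) : mkAdd (coB (val i)) (val j) = if i == j then 1 else 0.
  by rewrite /= (coE (rep_basis (valP j))).
exists (@GBasis R A M ix val deg (fun i => mkAdd (coB (val i))) degP act_co gb_co sp).
split=> [//|s Fs]; exists (pmap insub s) => -[f fF].
by rewrite mem_pmap_sub /= -Fs.
Qed.
End BasisExistence.

Section ProductBasis.
Variables (R : comPzRingType) (A B : dgAlg R) (phi : dgAlgHom A B).
Variables (N : dgMod B) (b : gbasis N) (e : gbasis (res phi (reg B))).

Let ix : eqType := (gix b * gix e)%type.
Let pb (i : ix) : res phi N := act (gb i.1) (gb i.2 : B).
Let pco_fun (i : ix) (x : res phi N) : A := gco i.2 (gco i.1 (x : N) : res phi (reg B)).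
Fact pcoB i : zmod_morphism (pco_fun i).
Proof. by move=> x y; rewrite /pco_fun !raddfB. Qed.
Let pco i : {additive res phi N -> A} := mkAdd (@pcoB i).

Fact pb_homog i : homog (res phi N) (gdeg i.1 + gdeg i.2) (pb i).
Proof.
by apply: (act_deg (d := N)); [exact: gb_homog|exact: (gb_homog (M := res phi (reg B)))].
Qed.
Fact pco_act i x a : pco i (act x a) = pco i x * a.
Proof.
rewrite /pco /= /pco_fun.
rewrite -(gco_act i.2 (gco i.1 (x : N) : res phi (reg B)) a); congr (gco _ _).
exact: (gco_act i.1 (x : N) (phi a)).
Qed.
Fact pco_gb i j : pco i (pb j) = if i == j then 1 else 0.
Proof.
case: i j => [i i'] [j j']; rewrite /pco /= /pco_fun /pb /= gco_gb_act xpair_eqE.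
by case: eqP => _; rewrite ?raddf0//= gco_gb.
Qed.
Fact pb_span x : exists s : seq ix, [/\ uniq s,
    forall i, i \notin s -> pco i x = 0 & x = \sum_(i <- s) act (pb i) (pco i x)].
Proof.
exists [seq (i, j) | i <- gsupp b x, j <- gsupp e (gco i (x : N) : res phi (reg B))].
split.
- apply: allpairs_uniq_dep => [|i _|[i j] [i' j'] _ _ [-> ->]//]; exact: gsupp_uniq.
- case=> i j ij; rewrite /pco /= /pco_fun /=.
  have [is'|/gco_notin->] := boolP (i \in gsupp b x); last by rewrite raddf0.
  apply: (gco_notin (M := res phi (reg B))); apply: contra ij => js; apply/allpairsPdep.
  by exists i, j.
rewrite big_allpairs_dep/= {1}[x in LHS](gsupp_sum b); apply: eq_bigr => i _.
rewrite {1}[gco i x in LHS](gsupp_sum e (gco i (x : N) : res phi (reg B))) raddf_sum.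
by apply: eq_bigr => j _; exact: (esym (actA (d := N) _ _ _)).
Qed.

Definition prod_gbasis : gbasis (res phi N) :=
  GBasis pb_homog pco_act pco_gb pb_span.
End ProductBasis.

(** * Semifree modules and quasiisomorphisms *)

(** Recursion along a measure when the next value is only known to exist: [Q i g t] states that t is
    admissible at i given g, and the first hypothesis says that only the values of g at smaller
    measure matter. *)
Lemma measure_rec (I T : Type) (t0 : T) (mu : I -> nat) (Q : I -> (I -> T) -> T -> Prop) :
  (forall i g g' t, (forall j, (mu j < mu i)%N -> g j = g' j) -> Q i g t -> Q i g' t) ->
  (forall i g, (forall j, (mu j < mu i)%N -> Q j g (g j)) -> exists t, Q i g t) ->
  exists g, forall i, Q i g (g i).
Proof.
move=> Qloc Qex.
pose ch i g := if pselect (exists t, Q i g t) is left h then sval (cid h) else t0.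
have chP i g t : Q i g t -> Q i g (ch i g).
  rewrite /ch => Qt; case: pselect => [h|[]]; last by exists t.
  exact: svalP (cid h).
pose G := fix G n := if n is n'.+1 then
  fun i => if mu i == n' then ch i (G n') else G n' i else fun=> t0.
pose g i := G (mu i).+1 i.
have gE n i : (mu i < n)%N -> G n i = g i.
  elim: n => // n IH; rewrite ltnS leq_eqVlt => /orP[/eqP <-//|lt].
  by rewrite /= (ltn_eqF lt) IH.
exists g => i; have [n] := ubnP (mu i); elim: n i => // n IH i; rewrite ltnS => le.
have lo j : (mu j < mu i)%N -> Q j g (g j).
  by move=> ji; apply: IH; apply: leq_trans ji le.
have [t Qt] := Qex i g lo.
rewrite {2}/g /= eqxx; apply: (Qloc _ (G (mu i))) => [j ji|]; first exact: gE.
by apply: (chP _ _ t); apply: Qloc Qt => j ji; rewrite gE.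
Qed.

Section Lifting.
Variables (R : comPzRingType) (A : dgAlg R).
Implicit Types (M S X Y : dgMod A).

Lemma quasi_iso_inj X Y (q : dgHom X Y) : quasi_iso q ->
  forall x y, dif X x = 0 -> q x = dif Y y -> exists x', x = dif X x'.
Proof.
move=> /bij_inj qi x y dx qx.
have xc : x \in cycles X by rewrite inE dx.
have : qpi (boundaries X) (exist _ x xc) = 0.
  apply: qi; rewrite [RHS]raddf0 [LHS]qliftE; apply/qpi_eq0/asboolP.
  by exists y.
by move=> /qpi_eq0/asboolP[x' xx']; exists x'.
Qed.

Lemma quasi_iso_surj X Y (q : dgHom X Y) : quasi_iso q ->
  forall y, dif Y y = 0 -> exists x y', dif X x = 0 /\ y = q x + dif Y y'.
Proof.
move=> [r _ qr] y dy.
have yc : y \in cycles Y by rewrite inE dy.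
pose yy : subg (cycles Y) := exist _ y yc.
have [xx rx] := qpi_surj (r (qpi (boundaries Y) yy)).
have E : homology_map q (qpi _ xx) = qpi (boundaries Y) (cycles_map q xx).
  exact: qliftE.
have : qpi (boundaries Y) (yy - cycles_map q xx) = 0.
  by rewrite raddfB -E -rx qr subrr.
move=> /qpi_eq0/asboolP[y' yy']; exists (val xx), y'; split.
  by apply/eqP; move: (valP xx); rewrite inE.
by rewrite -yy' raddfB /= addrC subrK.
Qed.

(** Injectivity on homology gives a primitive [t0] of x; then [y - q t0] is a cycle, which
    surjectivity represents by a cycle [t1] up to a boundary, and [t0 + t1] is the corrected
    primitive. *)
Lemma quasi_iso_lift X Y (q : dgHom X Y) : quasi_iso q ->
  forall n x y, homog X n x -> homog Y (n + 1) y -> dif X x = 0 -> q x = dif Y y ->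
  exists t z, [/\ homog X (n + 1) t, homog Y (n + 1 + 1) z, dif X t = x &
    dif Y z = y - q t].
Proof.
move=> qi n x y xn yn dx qxy; have [t0 xt0] := quasi_iso_inj qi dx qxy.
have dy0 : dif Y (y - q t0) = 0 by rewrite raddfB -dgh_dif -xt0 qxy subrr.
have [t1 [z [dt1 Ez]]] := quasi_iso_surj qi dy0.
(* [homology] carries no grading, so the elements found need not be homogeneous; their components of
   the right degrees satisfy the same equations. *)
exists (pr X (n + 1) (t0 + t1)), (pr Y (n + 1 + 1) z); split.
- exact: homog_pr.
- exact: homog_pr.
- by rewrite -pr_dif raddfD dt1 addr0 -xt0.
rewrite -pr_dif dgh_pr -[y in RHS]yn -raddfB (raddfD q) opprD addrA Ez.
by rewrite addrC addKr.
Qed.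

Lemma ghom_eq_on M (b : gbasis M) (L : dgMod A) j k (f g : M -> L) x :
  ghom j f -> ghom k g -> (forall i : gix b, gco i x <> 0 -> f (gb i) = g (gb i)) ->
  f x = g x.
Proof.
move=> [fB fl _] [gB gl _] fg; rewrite (gsupp_sum b x) (zmor_sum fB) (zmor_sum gB).
apply: eq_bigr => i _; have [->|/eqP/fg E] := eqVneq (gco i x) 0.
  by rewrite raddf0 (zmor0 fB) (zmor0 gB).
by rewrite fl gl E.
Qed.

Section Lift.
Variables (X Y : dgMod A) (q : dgHom X Y) (q_iso : quasi_iso q).
Variables (S : dgMod A) (b : gbasis S) (m : int).
Hypothesis b_ge : forall i : gix b, m <= gdeg i.

(* The acyclicity of the cone of [q], tested on maps out of S: the pair
   [(u, w)] is a cycle of degree k + 1 and [(t, z)] bounds it. *)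
Lemma cone_acyclic k (u : S -> X) (w : S -> Y) :
  ghom k u -> gclosed k u -> ghom (k + 1) w ->
  (forall x, q (u x) = dcomm (k + 1) w x) ->
  exists t z, [/\ ghom (k + 1) t, ghom (k + 1 + 1) z,
    forall x, dcomm (k + 1) t x = u x &
    forall x, w x = q (t x) + dcomm (k + 1 + 1) z x].
Proof.
move=> ug uc wg quw.
pose mu (i : gix b) := `|gdeg i - m|%N.
have muE i j : gdeg j < gdeg i -> (mu j < mu i)%N.
  move=> ji; rewrite -ltz_nat !gez0_abs ?subr_ge0 ?b_ge//.
  by rewrite ltrD2r.
pose D (i : gix b) := dif S (gb i).
have Ddeg i : homog S (gdeg i - 1) (D i) by apply/dif_deg/gb_homog.
have Dlow i j : gco j (D i) <> 0 -> gdeg j < gdeg i.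
  move=> Dj; rewrite ltNge; apply/negP => ij; apply: Dj.
  apply: gco_eq0 (Ddeg i) _; apply: lt_le_trans ij.
  by rewrite ltrBlDr ltrDl.
pose T1 (g : gix b -> X * Y) := gext (b := b) (fun i => (g i).1).
pose T2 (g : gix b -> X * Y) := gext (b := b) (fun i => (g i).2).
(* The conditions on the pair p of images of [gb i] under t and z. They involve the other values
   only through [D i], hence only at basis elements of smaller degree. *)
pose Q (i : gix b) (g : gix b -> X * Y) (p : X * Y) := [/\ homog X (gdeg i + k + 1) p.1,
  homog Y (gdeg i + k + 1 + 1) p.2,
  dif X p.1 = u (gb i) + sgn (k + 1) (T1 g (D i)) &
  dif Y p.2 = w (gb i) + sgn (k + 1 + 1) (T2 g (D i)) - q p.1].
have [i g g' p gg' [? ? e1 e2]||g gP] := @measure_rec (gix b) _ (0, 0) mu Q.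
- have E1 : T1 g (D i) = T1 g' (D i).
    by apply: gext_local => j /Dlow/muE/gg'->.
  have E2 : T2 g (D i) = T2 g' (D i).
    by apply: gext_local => j /Dlow/muE/gg'->.
  by split; rewrite // -?E1 -?E2.
(* Values not yet controlled are replaced by 0, which makes the linear extensions homogeneous
   without changing them on [D j] for [gdeg j <= gdeg i]. *)
- move=> i g gQ; pose g' j := if gdeg j < gdeg i then g j else (0, 0).
  have gg' j : gdeg j <= gdeg i -> T1 g' (D j) = T1 g (D j) /\ T2 g' (D j) = T2 g (D j).
    move=> ji; split; apply: gext_local => l /Dlow lj; by rewrite /g' (lt_le_trans lj ji).
  have g'1 : ghom (k + 1) (T1 g').
    apply: gext_ghom => j; rewrite /g'; case: ifP => [/muE/gQ[]|_ /=].
      by rewrite addrA.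
    exact: homog0.
  have g'2 : ghom (k + 1 + 1) (T2 g').
    apply: gext_ghom => j; rewrite /g'; case: ifP => [/muE/gQ[_]|_ /=].
      by rewrite !addrA.
    exact: homog0.
  have T1_gb j : gdeg j < gdeg i -> T1 g' (gb j) = (g j).1.
    by move=> ji; rewrite -[gb j]act1 [LHS]gext_gb act1 /g' ji.
  have T2_gb j : gdeg j < gdeg i -> T2 g' (gb j) = (g j).2.
    by move=> ji; rewrite -[gb j]act1 [LHS]gext_gb act1 /g' ji.
  (* On the support of [D i] the recursion equations already hold, so the wanted identities hold at
     [D i]. As [dif S (D i) = 0], the elements x and y below then meet the hypotheses of
     [quasi_iso_lift]. *)
  have c1 : dcomm (k + 1) (T1 g') (D i) = u (D i).
    apply: (ghom_eq_on (b := b) (ghom_dcomm g'1 erefl) ug) => j /Dlow ji.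
    rewrite /dcomm T1_gb// (gg' j (ltW ji)).1; have [_ _ -> _] := gQ j (muE _ _ ji).
    by rewrite addrK.
  have c2 : dcomm (k + 1 + 1) (T2 g') (D i) = w (D i) - q (T1 g' (D i)).
    apply: (ghom_eq_on (b := b) (g := fun x => w x - q (T1 g' x))
      (ghom_dcomm g'2 erefl)).
      apply: ghomD wg _; apply: ghomN.
      by rewrite -[k + 1]add0r; apply: ghom_comp (dgh_ghom q) g'1.
    move=> j /Dlow ji.
    rewrite /dcomm T2_gb// (gg' j (ltW ji)).2 T1_gb//; have [_ _ _ ->] := gQ j (muE _ _ ji).
    by rewrite addrAC addrK.
  have DD : dif S (D i) = 0 by exact: dif_dif.
  have [gg1 gg2] := gg' i (lexx _).
  pose x := u (gb i) + sgn (k + 1) (T1 g' (D i)).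
  pose y := w (gb i) + sgn (k + 1 + 1) (T2 g' (D i)).
  move: c1 c2; rewrite /dcomm DD (zmor0 (ghomB g'1)) (zmor0 (ghomB g'2)) !sgn0r !subr0.
  move=> c1 c2.
  have [ux wx] : dif X (u (gb i)) = sgn k (u (D i)) /\
      dif Y (w (gb i)) = q (u (gb i)) + sgn (k + 1) (w (D i)).
    split; apply/eqP; first by rewrite -subr_eq0; apply/eqP/uc.
    by rewrite -subr_eq; apply/eqP; rewrite quw.
  have [||||t [z [tn zn dt dz]]] := quasi_iso_lift q_iso (n := gdeg i + k) (x := x) (y := y).
  + apply: homogD; first by case: ug => _ _; apply; apply: gb_homog.
    apply: homog_sgn; case: g'1 => _ _ /(_ _ _ (Ddeg i)).
    by rewrite addrAC addrA addrK.
  + rewrite -addrA; apply: homogD; first by case: wg => _ _; apply; apply: gb_homog.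
    apply: homog_sgn; case: g'2 => _ _ /(_ _ _ (Ddeg i)).
    by rewrite addrAC !addrA addrK.
  + by rewrite raddfD ux sgn_add c1 sgnD sgn1 sgnNr subrr.
  + rewrite /x /y !raddfD wx !sgn_add c2 -addrA; congr (_ + _).
    by rewrite !sgnD !sgn1 !sgnNr !opprK sgnBr addrA addNr add0r.
  exists (t, z); split=> //=; first by rewrite dt -gg1.
  by rewrite dz -gg2.
pose t := T1 g; pose z := T2 g.
have tg : ghom (k + 1) t.
  by apply: gext_ghom => i; rewrite addrA; case: (gP i).
have zg : ghom (k + 1 + 1) z.
  by apply: gext_ghom => i; rewrite !addrA; case: (gP i).
have t_gb i : t (gb i) = (g i).1 by rewrite -[gb i]act1 [LHS]gext_gb act1.
have z_gb i : z (gb i) = (g i).2 by rewrite -[gb i]act1 [LHS]gext_gb act1.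
exists t, z; split=> // x.
  apply: (ghom_eq_on (b := b) (ghom_dcomm tg erefl) ug) => i _.
  by rewrite /dcomm t_gb; have [_ _ -> _] := gP i; rewrite addrK.
apply: (ghom_eq_on (b := b) (g := fun x => q (t x) + dcomm (k + 1 + 1) z x) wg).
  apply: ghomD (ghom_dcomm zg _); last by rewrite addrK.
  by rewrite -[k + 1]add0r; apply: ghom_comp (dgh_ghom q) tg.
move=> i _; rewrite /dcomm t_gb z_gb; have [_ _ _ ->] := gP i.
by rewrite addrAC addrK [RHS]addrC subrK.
Qed.
End Lift.
End Lifting.

Lemma sub_subl (V : zmodType) (a b c d : V) : a - b - (a - c - (b - d)) = c - d.
Proof.
apply/eqP; rewrite subr_eq [c - d + _]addrC -addrA opprB [d - b + _]addrC.
by rewrite [c - d + _]addrA subrK addrA subrK.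
Qed.

(** * Zigzags of quasiisomorphisms and homotopy classes of maps *)

Section Zigzags.
Variables (R : comPzRingType) (A : dgAlg R).
Implicit Types (M P S X Y Z : dgMod A).

(** Enough to build maps out of M degree by degree: by [gco_eq0] the differential of a basis element
    involves only basis elements of smaller degree, so M behaves as a semifree module. *)
Definition bounded_basis M : Prop :=
  exists (b : gbasis M) (m : int), forall i : gix b, m <= gdeg i.

Definition chain X Y (f : X -> Y) : Prop := ghom 0 f /\ gclosed 0 f.

Lemma chain_comp X Y Z (g : Y -> Z) (f : X -> Y) :
  chain g -> chain f -> chain (fun x => g (f x)).
Proof.
move=> [gg gc] [fg fc]; split; first by rewrite -[0]addr0; apply: ghom_comp.
by apply: (gclosed_comp (ghomB gg) (esym (addr0 0))).
Qed.

Lemma chain_id X : chain (fun x : X => x).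
Proof. by split; [apply: ghom_id|move=> x; rewrite /dcomm sgn0 subrr]. Qed.

Lemma chain_dgh X Y (q : dgHom X Y) : chain q.
Proof. by split; [apply: dgh_ghom|apply: dgh_closed]. Qed.

Lemma gexactB X Y k (f g : X -> Y) : gexact k f -> gexact k g ->
  gexact k (fun x => f x - g x).
Proof.
move=> fe /(gexact_sgn 1) ge; apply: gexact_ext (gexactD fe ge) => x.
by rewrite sgn1.
Qed.

Lemma chain_sub X Y (f g : X -> Y) : chain f -> chain g -> chain (fun x => f x - g x).
Proof.
move=> [fg fc] [gg gc]; split; first by apply: ghomD fg (ghomN gg).
by move=> x; rewrite dcommB fc gc subrr.
Qed.

Section QuasiIso.
Variables (X Y : dgMod A) (q : dgHom X Y) (q_iso : quasi_iso q).
Variables (S : dgMod A) (Sb : bounded_basis S).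

(** The case [u = 0] of [cone_acyclic] in degree -1: the resulting t is the lift and -z the
    homotopy. *)
Lemma quasi_iso_factor (v : S -> Y) : chain v ->
  exists2 u : S -> X, chain u & gexact 0 (fun x => q (u x) - v x).
Proof.
move=> [vg vc]; have [b [m bm]] := Sb.
have [|||| t [z [tg zg tc vE]]] := cone_acyclic q_iso bm (k := - 1) (u := fun=> 0) (w := v).
- exact: ghom0.
- by move=> x; rewrite /dcomm raddf0 sgn0r subr0.
- by rewrite addNr.
- by move=> x; rewrite raddf0 addNr vc.
move: tg zg tc vE; rewrite addNr => tg zg tc vE.
exists t; first by split.
exists (fun x => - z x); first exact: ghomN.
move=> x; rewrite vE opprD addrA subrr add0r /dcomm.
by rewrite (raddfN (dif Y)) sgnNr opprD.
Qed.

(** A null-homotopy of the composite with q is the map w that [cone_acyclic] asks for; the t it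
    returns bounds u. *)
Lemma quasi_iso_reflects (u : S -> X) : chain u ->
  gexact 0 (fun x => q (u x)) -> gexact 0 u.
Proof.
move=> [ug uc] [w wg quw]; have [b [m bm]] := Sb.
have [t [z [tg _ tu _]]] := cone_acyclic q_iso bm ug uc wg quw.
by exists t.
Qed.
End QuasiIso.

(* A correspondence between homotopy classes of maps into X and into Y,
   natural in the source. *)
Definition hom_corr X Y : Prop :=
  exists Phi : forall S, (S -> X) -> (S -> Y) -> Prop, [/\
    forall S (u : S -> X) (v : S -> Y), Phi S u v -> chain u /\ chain v,
    forall S, bounded_basis S ->
      (forall u : S -> X, chain u -> exists v, Phi S u v) /\
      (forall v : S -> Y, chain v -> exists u, Phi S u v),
    forall S, bounded_basis S -> forall (u u' : S -> X) (v v' : S -> Y),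
      Phi S u v -> Phi S u' v' ->
      (gexact 0 (fun x => u x - u' x) <-> gexact 0 (fun x => v x - v' x)) &
    forall S S' (w : S' -> S) u v, chain w -> Phi S u v ->
      Phi S' (fun x => u (w x)) (fun x => v (w x))].

Lemma hom_corr_refl X : hom_corr X X.
Proof.
exists (fun S u v => chain u /\ u = v); split.
- by move=> S u v [uc <-].
- by move=> S _; split=> u uc; exists u.
- by move=> S _ u u' v v' [_ <-] [_ <-].
by move=> S S' w u v wc [uc <-]; split=> //; apply: chain_comp.
Qed.

Lemma hom_corr_sym X Y : hom_corr X Y -> hom_corr Y X.
Proof.
move=> [Phi [P1 P2 P3 P4]]; exists (fun S u v => Phi S v u); split.
- by move=> S u v /P1[].
- by move=> S /P2[].
- by move=> S Sb u u' v v' uv uv'; split=> /(P3 S Sb _ _ _ _ uv uv').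
by move=> S S' w u v wc; apply: P4.
Qed.

Lemma hom_corr_trans X Y Z : hom_corr X Y -> hom_corr Y Z -> hom_corr X Z.
Proof.
move=> [Phi [P1 P2 P3 P4]] [Psi [Q1 Q2 Q3 Q4]].
exists (fun S u w => exists2 v, Phi S u v & Psi S v w); split.
- by move=> S u w [v /P1[uc _] /Q1[_ wc]].
- move=> S Sb; have [p1 p2] := P2 S Sb; have [q1 q2] := Q2 S Sb; split.
    move=> u /p1[v uv]; have [_ /q1[w vw]] := P1 _ _ _ uv.
    by exists w, v.
  move=> w /q2[v vw]; have [/p2[u uv] _] := Q1 _ _ _ vw.
  by exists u, v.
- move=> S Sb u u' w w' [v uv vw] [v' uv' vw'].
  exact: iff_trans (P3 S Sb _ _ _ _ uv uv') (Q3 S Sb _ _ _ _ vw vw').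
by move=> S S' t u w tc [v uv vw]; exists (fun x => v (t x)); [apply: P4|apply: Q4].
Qed.

(** Here u corresponds to v when [q \o u] and v are homotopic; every v is reached by
    [quasi_iso_factor], and homotopies are pulled back by [quasi_iso_reflects]. *)
Lemma hom_corr_quasi_iso X Y (q : dgHom X Y) : quasi_iso q -> hom_corr X Y.
Proof.
move=> qi; have qc := chain_dgh q.
exists (fun S u v => [/\ chain u, chain v & gexact 0 (fun x => q (u x) - v x)]).
split.
- by move=> S u v [].
- move=> S Sb; split=> [u uc|v vc].
    exists (fun x => q (u x)); split=> //; first exact: chain_comp.
    exists (fun=> 0); first exact: ghom0.
    by move=> x; rewrite subrr /dcomm raddf0 sgn0r subr0.
  by have [u uc uv] := quasi_iso_factor qi Sb vc; exists u.
- move=> S Sb u u' v v' [uc vc uv] [uc' vc' uv'].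
  have D := gexactB uv uv'; split=> E.
    have E' := gexact_compl qc.1 qc.2 E (esym (addr0 0)).
    apply: gexact_ext (gexactB E' D) => x.
    by rewrite raddfB sub_subl.
  apply: (quasi_iso_reflects qi Sb (chain_sub uc uc')).
  apply: gexact_ext (gexactD E D) => x.
  by rewrite raddfB -(sub_subl (q (u x)) (q (u' x)) (v x)) subrK.
move=> S S' w u v wc [uc vc uv]; split; try exact: chain_comp.
exact: (gexact_compr wc.1 wc.2 uv (esym (addr0 0))).
Qed.

(** A relation can be inverted, so arrows of either direction compose. Bases are asked of the
    sources S only, so the intermediate modules of the zigzag may be arbitrary. *)
Lemma quasi_isomorphic_corr X Y : quasi_isomorphic X Y -> hom_corr X Y.
Proof.
elim=> {X Y} [X Y [q qi]|X|X Y _ IH|X Y Z _ XY _ YZ].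
- exact: hom_corr_quasi_iso qi.
- exact: hom_corr_refl.
- exact: hom_corr_sym.
- exact: hom_corr_trans XY YZ.
Qed.

(** A Yoneda argument: [beta] corresponds to the identity of M, and [alpha] to the identity of P. By
    naturality along [beta], both [alpha \o beta] and the identity of M correspond to [beta], hence
    they are homotopic. *)
Lemma quasi_isomorphic_retract M P : bounded_basis M -> bounded_basis P ->
  quasi_isomorphic M P ->
  exists (alpha : P -> M) (beta : M -> P),
    [/\ chain alpha, chain beta & gexact 0 (fun x => alpha (beta x) - x)].
Proof.
move=> Mb Pb /quasi_isomorphic_corr[Phi [P1 P2 P3 P4]].
have [beta idb] := (P2 M Mb).1 _ (@chain_id M).
have [alpha aid] := (P2 P Pb).2 _ (@chain_id P).
have [_ bc] := P1 _ _ _ idb; have [ac _] := P1 _ _ _ aid.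
exists alpha, beta; split=> //.
apply/(P3 M Mb _ _ _ _ (P4 _ _ _ _ _ bc aid) idb).
exists (fun=> 0); first exact: ghom0.
by move=> x; rewrite subrr /dcomm raddf0 sgn0r subr0.
Qed.
End Zigzags.

(** * Maps into M (x) X for perfect M *)

(** A closed map of degree k is a chain map into the shift of L by -k, so this is the vanishing of
    Hom_K(N, Sigma^n L) for all n >= 1. *)
Definition vanish (R : comPzRingType) (B : dgAlg R) (N L : dgMod B) : Prop :=
  forall (k : int) (f : N -> L), k < 0 -> ghom k f -> gclosed k f -> gexact k f.

Definition nneg (R : comPzRingType) (A : dgAlg R) (M : dgMod A) : Prop :=
  forall n x, n < 0 -> homog M n x -> x = 0.

Section TensorMaps.
Variables (R : comPzRingType) (S T : dgAlg R).
Implicit Types (M : dgMod S) (X : dgBimod S T) (L : dgMod T).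

Section Lift.
Variables (M : dgMod S) (X : dgBimod S T) (L : dgMod T) (h : M -> X -> L).
Variables (h_bal : balanced h) (k : int).

Lemma tens_lift_ghom : (forall x y t, h x (act y t) = act (h x y) t) ->
  (forall i j x y, homog M i x -> homog X j y -> homog L (i + j + k) (h x y)) ->
  ghom k (tens_lift h_bal : tens M X -> L).
Proof.
move=> h_act h_deg; split; first exact: raddfB.
  move=> z t; move: z; apply: tens_ext => [z w|z w|x y].
  - by rewrite actBl raddfB.
  - by rewrite raddfB actBl.
  by rewrite [Z in tens_lift _ Z]tens_actE !tens_liftE h_act.
move=> n z zn; rewrite /homog -[in RHS]zn.
move: z {zn}; apply: tens_ext_homog => [z w|z w|i j x y xi yj].
- by rewrite !raddfB.
- by rewrite !raddfB.
rewrite [Z in _ = tens_lift _ Z](tens_prH n xi yj) tens_liftE.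
rewrite (pr_homog _ (h_deg _ _ _ _ xi yj)) (inj_eq (addIr k)).
by case: eqP => _; rewrite ?raddf0 ?tens_liftE.
Qed.

Lemma tens_lift_dcomm x y :
  dcomm k (tens_lift h_bal : tens M X -> L) (tens_elt x y) =
  dif L (h x y) - sgn k (h (dif M x) y + h (twist M 1 x) (dif X y)).
Proof.
by rewrite /dcomm [Z in sgn k (tens_lift _ Z)]tens_difE raddfD !tens_liftE.
Qed.
End Lift.

Section LeftFactor.
Variables (X : dgBimod S T) (M M' : dgMod S) (j : int) (f : M -> M').
Hypothesis fg : ghom j f.

Fact ltens_bal : balanced (fun (x : M) (y : X) => tens_elt (f x) y : tens M' X).
Proof.
case: fg => fB fl _; split=> [y x x'|x|x s y]; rewrite ?fB ?fl.
- exact: tens_eltBl.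
- exact: tens_eltBr.
exact: tens_elt_bal.
Qed.

Definition ltens : tens M X -> tens M' X := tens_lift ltens_bal.

Lemma ltensE x y : ltens (tens_elt x y) = tens_elt (f x) y.
Proof. exact: tens_liftE. Qed.

Lemma ltensB : zmod_morphism ltens.
Proof. exact: raddfB. Qed.

Lemma ltens_ghom : ghom j ltens.
Proof.
apply: tens_lift_ghom => [x y t|i l x y xi yl]; first by rewrite [RHS]tens_actE.
by rewrite addrAC; apply: tens_homog => //; case: fg => _ _; apply.
Qed.

Lemma ltens_dcomm x y : dcomm j ltens (tens_elt x y) = tens_elt (dcomm j f x) y.
Proof.
rewrite tens_lift_dcomm [Z in Z - _]tens_difE (ghom_twist fg) mul1r.
rewrite sgnDr -!tens_elt_sgnl opprD addrACA subrr addr0 /dcomm.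
by rewrite -(tens_eltBl (M := M')).
Qed.

Lemma ltens_closed : gclosed j f -> gclosed j ltens.
Proof.
move=> fc; apply: (tens_ext (h := fun=> 0)) => [z w|z w|x y].
- by apply: (ghomB (ghom_dcomm ltens_ghom erefl)).
- by rewrite subr0.
by rewrite ltens_dcomm fc tens_elt0l.
Qed.
End LeftFactor.

Lemma ltens_exact X M M' j (f h : M -> M') (fg : ghom j f) (hg : ghom (j + 1) h) :
  (forall x, f x = dcomm (j + 1) h x) ->
  forall z, ltens (X := X) fg z = dcomm (j + 1) (ltens (X := X) hg) z.
Proof.
move=> fh; apply: tens_ext => [z w|z w|x y].
- exact: ltensB.
- by apply: (ghomB (ghom_dcomm (ltens_ghom X hg) erefl)).
by rewrite ltens_dcomm ltensE fh.
Qed.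
End TensorMaps.

Section Vanishing.
Variables (R : comPzRingType) (A B : dgAlg R) (N : dgMod B) (X : dgBimod A B).
Hypothesis vX : vanish N X.

Section FiniteBasis.
Variables (P M : dgMod A) (b : gbasis P) (t : seq (gix b)).
Hypothesis t_all : forall i, i \in t.
Local Notation te := (@tens_elt R A B P X).

Fact coT_bal (j : gix b) :
  balanced (fun (p : P) (x : X) => lact (gco j p) x : X).
Proof.
split=> [x p q|p|p a x]; first by rewrite raddfB (lactBl (d := X)).
  exact: lactBr.
by rewrite gco_act lactA.
Qed.

Definition coT (j : gix b) : tens P X -> X := tens_lift (coT_bal j).

Lemma coTE j p x : coT j (te p x) = lact (gco j p) x.
Proof. exact: tens_liftE. Qed.
Lemma coTB j : zmod_morphism (coT j). Proof. exact: raddfB. Qed.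

Lemma coT_ghom j : ghom (- gdeg j) (coT j).
Proof.
apply: tens_lift_ghom => [p x a|i l p x pi xl]; first exact: lact_act.
by rewrite addrAC; apply: lact_deg => //; apply: gco_deg.
Qed.

Lemma te_ghom (i : gix b) : ghom (gdeg i) (fun x : X => te (gb i) x : tens P X).
Proof.
split=> [x y|x a|n x xn]; first exact: tens_eltBr.
  by rewrite [RHS]tens_actE.
by rewrite addrC; apply: tens_homog xn; apply: gb_homog.
Qed.

Lemma coT_gb j i x : coT j (te (gb i) x) = if j == i then x else 0.
Proof. by rewrite coTE gco_gb; case: eqP => _; rewrite ?lact1 ?lact0l. Qed.

(** By [gco_eq0] the part coming from [dif P (gb i)] has no coordinates in degree [gdeg i] or above;
    there only the differential of X survives. *)
Lemma coT_dif_gb j i x : gdeg i <= gdeg j ->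
  coT j (dif (tens P X) (te (gb i) x)) = if j == i then sgn (gdeg i) (dif X x) else 0.
Proof.
move=> ij; rewrite [Z in coT j Z]tens_difE (zmorD (coTB j)) coTE.
rewrite (gco_eq0 (dif_deg (gb_homog i))) ?lact0l ?add0r; last first.
  by apply: lt_le_trans ij; rewrite ltrBlDr ltrDl.
rewrite (twist_homog 1 (gb_homog i)) mul1r tens_elt_sgnl (zmor_sgn (coTB j)) coT_gb.
by case: eqP => _; rewrite ?sgn0r.
Qed.

Lemma coT_sum (z : tens P X) : z = \sum_(i <- undup t) te (gb i) (coT i z).
Proof.
move: z; apply: (tens_ext (f := fun z => z)) => [//|z w|p x].
  by rewrite -sumrB; apply: eq_bigr => i _; rewrite (coTB i) tens_eltBr.
rewrite {1}(gsupp_sum b p).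
rewrite -[LHS]/(mkAdd (@tens_eltBl R A B P X x) _) raddf_sum /=.
under [RHS]eq_bigr do rewrite coTE -tens_elt_bal.
apply: eq_sum_supp => [||i /gco_notin->|i].
- exact: gsupp_uniq.
- exact: undup_uniq.
- by rewrite raddf0 tens_elt0l.
by rewrite mem_undup t_all.
Qed.

Lemma sum_undup_delta (W : zmodType) (F : gix b -> W) j :
  \sum_(i <- undup t) (if j == i then F i else 0) = F j.
Proof.
rewrite (bigD1_seq j) ?mem_undup ?undup_uniq//= eqxx big1 ?addr0// => i.
by rewrite eq_sym => /negPf->.
Qed.

(** Coordinates do not commute with differentials in general, but those in the top degree do, up to
    sign: they factor through the top quotient of the filtration of P by [gdeg]. *)
Lemma coT_dif D j (z : tens P X) : gdeg j = D ->
  (forall i, D < gdeg i -> coT i z = 0) ->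
  coT j (dif (tens P X) z) = sgn D (dif X (coT j z)).
Proof.
move=> jD zD; rewrite {1}(coT_sum z) raddf_sum (zmor_sum (coTB j)).
transitivity (\sum_(i <- undup t) if j == i then sgn D (dif X (coT i z)) else 0).
  apply: eq_bigr => i _; have [Di|iD] := ltP D (gdeg i).
    by rewrite zD// !raddf0 if_same (zmor0 (coTB j)).
  by rewrite coT_dif_gb ?jD//; case: eqP => [<-|//]; rewrite jD.
exact: sum_undup_delta.
Qed.

Variables (alpha : P -> M).
Hypotheses (alpha_g : ghom 0 alpha) (alpha_c : gclosed 0 alpha) (M_nneg : nneg M).

(* Basis elements of negative degree are killed by [alpha]; the others are
   removed one degree at a time, from the top. *)
Lemma finite_basis_vanish (k : int) (f : N -> tens P X) : k < 0 -> ghom k f -> gclosed k f ->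
  gexact k (fun x => ltens (X := X) alpha_g (f x)).
Proof.
move=> k0 fg fc.
have [D fD] : exists D : nat, forall j, D%:Z <= gdeg j -> forall x, coT j (f x) = 0.
  have [D tD] : exists D : nat, forall j, j \in t -> gdeg j < D%:Z.
    elim: (t) => [|i s [D sD]]; first by exists 0%N.
    exists (maxn D `|gdeg i|%N.+1) => j; rewrite inE => /orP[/eqP->|/sD jD].
      apply: le_lt_trans (ler_norm _) _; rewrite -abszE ltz_nat.
      by rewrite leq_max ltnS leqnn orbT.
    by apply: lt_le_trans jD _; rewrite lez_nat leq_maxl.
  by exists D => j; rewrite leNgt tD.
elim: D => [|D IH] in f fg fc fD *.
  exists (fun=> 0); first exact: ghom0.
  move=> x; rewrite /dcomm raddf0 sgn0r subr0 (coT_sum (f x)).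
  rewrite (zmor_sum (ltensB alpha_g)) big1// => i _; rewrite ltensE.
  have [i0|i0] := leP 0 (gdeg i); first by rewrite fD// raddf0.
  have -> : alpha (gb i) = 0; last by rewrite tens_elt0l.
  apply: (M_nneg i0); case: alpha_g => _ _ /(_ _ _ (gb_homog i)).
  by rewrite addr0.
have fjg j : ghom (- gdeg j + k) (fun x => coT j (f x)).
  exact: ghom_comp (coT_ghom j) fg.
(* The coordinates in the top degree D are closed maps into X of degree [k - D], which is negative
   because D is a natural number, so [vX] provides primitives. *)
have [h hP] : exists h : gix b -> N -> X, forall i, gdeg i = D ->
    ghom (k + 1 - D%:Z) (h i) /\ forall x, coT i (f x) = dcomm (k + 1 - D%:Z) (h i) x.
  suff /choice[h hP] : forall i : gix b, exists h : N -> X, gdeg i = D ->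
      ghom (k + 1 - D%:Z) h /\ forall x, coT i (f x) = dcomm (k + 1 - D%:Z) h x.
    by exists h.
  move=> i.
  have [iD|iD] := eqVneq (gdeg i) D; last by exists (fun=> 0) => /eqP; rewrite (negPf iD).
  have [|x|h hg fh] := vX _ (fjg i).
  - by rewrite iD; apply: le_lt_trans k0; rewrite gerDr oppr_le0.
  - rewrite /dcomm; apply/eqP; rewrite subr_eq0; apply/eqP.
    apply: (can_inj (sgnK D)); rewrite -coT_dif//.
      have /eqP := fc x; rewrite subr_eq0 => /eqP->.
      by rewrite (zmor_sgn (coTB i)) iD -sgnD addrA subrr add0r.
    by move=> j Dj; apply: fD; rewrite intS addrC lezD1.
  have e : - gdeg i + k + 1 = k + 1 - D%:Z by rewrite iD -addrA addrC.
  by rewrite e in hg fh; exists h.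
(* The derivative of g has the same coordinates in degree D as f and none above, so subtracting it
   lowers the bound D by one. *)
pose g (x : N) : tens P X :=
  \sum_(i <- undup t) if gdeg i == D then sgn D (te (gb i) (h i x)) else 0.
have gg : ghom (k + 1) g.
  apply: ghom_sum => i; case: eqP => iD; last exact: ghom0.
  apply: ghom_sgn; have [hg _] := hP i iD.
  by have := ghom_comp (te_ghom i) hg; rewrite iD addrC subrK.
have cg j x : (D%:Z <= gdeg j) -> coT j (g x) = if gdeg j == D then sgn D (h j x) else 0.
  move=> Dj; rewrite (zmor_sum (coTB j)).
  rewrite -(sum_undup_delta (fun i => if gdeg i == D then sgn D (h i x) else 0)).
  apply: eq_bigr => i _; case: (gdeg i == D); last by rewrite (zmor0 (coTB j)) if_same.
  by rewrite (zmor_sgn (coTB j)) coT_gb; case: (j == i); rewrite ?sgn0r.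
have cdg j x : (D%:Z <= gdeg j) ->
    coT j (dif (tens P X) (g x)) = if gdeg j == D then dif X (h j x) else 0.
  move=> Dj; rewrite raddf_sum (zmor_sum (coTB j)).
  rewrite -(sum_undup_delta (fun i => if gdeg i == D then dif X (h i x) else 0)).
  apply: eq_bigr => i _; case: eqP => iD; last by rewrite raddf0 (zmor0 (coTB j)) if_same.
  rewrite sgn_add (zmor_sgn (coTB j)) coT_dif_gb ?iD//.
  by case: (j == i); rewrite ?sgnK ?sgn0r.
pose f' x := f x - dcomm (k + 1) g x.
have dgg : ghom k (dcomm (k + 1) g) by apply: ghom_dcomm gg _; rewrite addrK.
have dgc : gclosed k (dcomm (k + 1) g).
  by apply: gclosed_dcomm (ghomB gg) _; rewrite addrK.
have f'e : gexact k (fun x => ltens (X := X) alpha_g (f' x)).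
  apply: IH.
  - exact: ghomD fg (ghomN dgg).
  - by move=> x; rewrite dcommB fc dgc subrr.
  move=> j Dj x; rewrite /f' (coTB j) /dcomm (coTB j) (zmor_sgn (coTB j)) cdg// cg//.
  have [jD|jD] := eqVneq (gdeg j) D.
    have [_ ->] := hP j jD; rewrite /dcomm [sgn (k + 1 - _) _]sgnD sgnN.
    by rewrite subrr.
  rewrite fD ?sgn0r ?subrr// intS addrC lezD1 lt_neqAle Dj andbT.
  by rewrite eq_sym.
have ge : gexact k (dcomm (k + 1) g) by exists g.
have := gexactD f'e (gexact_compl (ltens_ghom X alpha_g) (ltens_closed (X := X) alpha_g alpha_c) ge (esym (add0r k))).
apply: gexact_ext => x; rewrite /f' ltensB subrK //.
Qed.
End FiniteBasis.

(** By [quasi_isomorphic_retract] the identity of M factors up to homotopy through some P with a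
    finite basis. So f agrees up to an exact map with a map passing through [tens P X], where
    [finite_basis_vanish] applies. *)
Lemma tens_vanish (M : dgMod A) : bounded_basis M -> nneg M -> perfect M ->
  vanish N (tens M X).
Proof.
move=> Mb M0 [P [F [le [[Fb _ _] [s Fs]]]] MP].
have Fh f : f \in s -> exists n, homog P n f by rewrite -Fs; case: Fb => + _ _; apply.
have [m sm] : exists m, forall f, f \in s -> exists2 n, m <= n & homog P n f.
  elim: s {Fs} Fh => [|f s IH] sh; first by exists 0.
  have [|m sm] := IH; first by move=> g gs; apply: sh; rewrite inE gs orbT.
  have [n fn] := sh f (mem_head _ _).
  exists (Num.min m n) => g; rewrite inE => /orP[/eqP->|/sm[l ml gl]].
    by exists n => //; rewrite ge_min lexx orbT.
  by exists l => //; rewrite ge_min ml.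
have Fm f : f \in F -> exists2 n, m <= n & homog P n f by rewrite Fs; apply: sm.
have [b [bm bfin]] := graded_basis_gbasis Fb Fm; have [t t_all] := bfin s Fs.
have Pb : bounded_basis P by exists b, m.
have [alpha [beta [[ag ac] [bg bc] [h hg ab]]]] := quasi_isomorphic_retract Mb Pb MP.
move=> k f k0 fg fc.
have bf : ghom k (fun x => ltens (X := X) bg (f x)).
  by rewrite -[k]add0r; apply: ghom_comp (ltens_ghom X bg) fg.
have bfc : gclosed k (fun x => ltens (X := X) bg (f x)).
  exact: gclosed_comp (ltensB bg) (esym (add0r k)) (ltens_closed (X := X) bg bc) fc.
have E1 := finite_basis_vanish t_all ag ac M0 k0 bf bfc.
have idg : ghom 0 (fun x : M => alpha (beta x) - x).
  by apply: ghomD (ghomN (ghom_id M)); rewrite -[0]addr0; apply: ghom_comp ag bg.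
have E2 : gexact 0 (ltens (X := X) idg).
  by exists (ltens (X := X) hg); [apply: ltens_ghom|apply: ltens_exact].
have E3 := gexact_compr fg fc E2 (esym (add0r k)).
apply: gexact_ext (gexactB E1 E3) => x.
move: (f x); apply: (tens_ext (f := fun z => z)) => [//|z w|p y].
  rewrite (ltensB (X := X) bg) (ltensB (X := X) ag) (ltensB (X := X) idg).
  by rewrite opprD addrACA -opprD.
rewrite !ltensE -(tens_eltBl (M := M)); congr tens_elt.
by rewrite opprB addrC subrK.
Qed.
End Vanishing.

(** * The diagonal ideal *)

Lemma dif1 (R : comPzRingType) (A : dgAlg R) : dif A (1 : A) = 0.
Proof. by apply: (dga_nneg (n := 0 - 1)) => //; apply: dif_deg (homog1 A). Qed.

Section DiagonalIdeal.
Variables (R : comPzRingType) (A B : dgAlg R) (phi : dgAlgHom A B).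
Local Notation Be := (Be phi).
Local Notation J := (J phi).
Local Notation mu := (mulmap phi (reg B)).
Local Notation tb := (@tens_elt R A B (rres phi (reg B)) (lres phi (reg B))).

Lemma mulmapE (X : dgBimod B B) (b : B) (x : X) :
  mulmap phi X (@tens_elt R A B (rres phi (reg B)) (lres phi X) b x) = lact b x.
Proof. exact: mulmap_homE. Qed.

Lemma Be_act (b b' c : B) : act (tb b b' : Be) c = tb b (b' * c).
Proof. exact: tens_actE. Qed.

Lemma Be_lact (c b b' : B) : lact c (tb b b' : Be) = tb (c * b) b'.
Proof. exact: tens_lactE. Qed.

Fact jproj_in (z : Be) : tb (mu z : B) 1 - z \in ker_bisub mu.
Proof. by rewrite inE raddfB mulmapE /= mulr1 subrr. Qed.

(* Minus the identity on J; left B-linear, but not right B-linear. *)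
Definition jproj (z : Be) : J := exist _ (tb (mu z : B) 1 - z) (jproj_in z).

Lemma J_val_inj (x y : J) : J_incl phi x = J_incl phi y -> x = y.
Proof. exact: val_inj. Qed.

Lemma jprojE z : J_incl phi (jproj z) = tb (mu z : B) 1 - z. Proof. by []. Qed.

Lemma mu_J (x : J) : mu (J_incl phi x) = 0.
Proof. by have /eqP := sub_val_in x. Qed.

Lemma jprojB : zmod_morphism jproj.
Proof.
move=> z w; apply: J_val_inj; rewrite raddfB !jprojE (raddfB mu).
by rewrite (tens_eltBl (M := rres phi (reg B))) !opprD !opprK addrACA.
Qed.

Lemma jproj_lact b z : jproj (lact b z) = lact b (jproj z).
Proof.
apply: J_val_inj; rewrite jprojE dgbh_lact.
rewrite -[RHS]/(lact b (J_incl phi (jproj z))) jprojE lactBr; congr (_ - _).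
exact: esym (tens_lactE _ _ _).
Qed.

Lemma jproj_J (x : J) : jproj (J_incl phi x) = - x.
Proof.
by apply: J_val_inj; rewrite jprojE mu_J (tens_elt0l (rres phi (reg B))) sub0r raddfN.
Qed.

Lemma jproj_dif z : dif J (jproj z) = jproj (dif Be z).
Proof.
apply: J_val_inj; rewrite dgh_dif !jprojE raddfB [X in X - _]tens_difE dgh_dif.
by rewrite [dif (lres phi (reg B)) 1]dif1 raddf0 addr0.
Qed.

Lemma jproj_deg n z : homog Be n z -> homog J n (jproj z).
Proof.
move=> zn; apply: J_val_inj; rewrite dgh_pr jprojE; apply: homogB => //.
rewrite -[n]addr0; apply: tens_homog; last exact: homog1.
exact: dgh_deg zn.
Qed.

(** The canonical derivation of B over A: the product rule [jdeltaM] has no sign since the degree is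
    0, and [jdelta_phi] says that it kills A. *)
Definition jdelta (b : B) : J := jproj (tb 1 b).

Lemma jdeltaE b : J_incl phi (jdelta b) = tb b 1 - tb 1 b.
Proof. by rewrite jprojE mulmapE /= mul1r. Qed.

(** The defect in right linearity is controlled by [mu z], so it disappears on the kernel of the
    multiplication; this is what makes the Atiyah class linear. *)
Lemma jproj_act z c : jproj (act z c) = act (jproj z) c + lact (mu z : B) (jdelta c).
Proof.
apply: J_val_inj; rewrite raddfD jprojE dgh_act jprojE actBl.
rewrite -[J_incl phi (lact _ _)]/(lact (mu z : B) (J_incl phi (jdelta c))) jdeltaE lactBr.
by rewrite !Be_lact Be_act dgh_act /= mul1r mulr1 [RHS]addrC addrA subrK.
Qed.

Lemma jdeltaB : zmod_morphism jdelta.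
Proof. by move=> b c; rewrite /jdelta tens_eltBr jprojB. Qed.

Lemma jdeltaM b c : jdelta (b * c) = act (jdelta b) c + lact b (jdelta c).
Proof.
rewrite {1}/jdelta -Be_act jproj_act mulmapE.
by rewrite (lact1 (d := reg B)).
Qed.

Lemma jdelta_phi a : jdelta (phi a) = 0.
Proof.
apply: J_val_inj; rewrite jdeltaE raddf0; apply/eqP; rewrite subr_eq0; apply/eqP.
have := @tens_elt_bal R A B (rres phi (reg B)) (lres phi (reg B)) 1 a 1.
by rewrite /= mul1r mulr1.
Qed.

Lemma jdelta_phiMr b a : jdelta (b * phi a) = act (jdelta b) (phi a).
Proof. by rewrite jdeltaM jdelta_phi raddf0 addr0. Qed.

Lemma jdelta_phiMl a b : jdelta (phi a * b) = lact (phi a) (jdelta b).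
Proof. by rewrite jdeltaM jdelta_phi act0l add0r. Qed.

Lemma jdelta_dif b : dif J (jdelta b) = jdelta (dif B b).
Proof.
rewrite /jdelta jproj_dif [dif Be _]tens_difE [dif (rres phi (reg B)) 1]dif1.
by rewrite (tens_elt0l (rres phi (reg B))) add0r [twist _ _ _]twist1.
Qed.

Lemma jdelta_deg n b : homog B n b -> homog J n (jdelta b).
Proof.
move=> bn; apply: jproj_deg; rewrite -[n]add0r; apply: tens_homog => //.
exact: homog1.
Qed.

Lemma jdelta_twist k b : jdelta (twist B k b) = twist J k (jdelta b).
Proof.
move: b; apply: (additive_homog (C := B)) => [x y|x y|n b bn].
- by rewrite raddfB jdeltaB.
- by rewrite jdeltaB raddfB.
by rewrite (twist_homog k bn) (twist_homog k (jdelta_deg bn)) (zmor_sgn jdeltaB).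
Qed.
End DiagonalIdeal.

(** * The right-linear splitting of J (x)_B X -> B (x)_A X -> X *)

Section Retraction.
Variables (R : comPzRingType) (A B : dgAlg R) (phi : dgAlgHom A B).
Variable X : dgBimod B B.
Local Notation Be := (Be phi).
Local Notation J := (J phi).
Local Notation mu := (mulmap phi (reg B)).
Local Notation te := (@tens_elt R A B (rres phi (reg B)) (lres phi X)).
Local Notation tj := (@tens_elt R B B J X).

Lemma BA_act (b t : B) (x : X) : act (te b x : BA phi X) t = te b (act x t).
Proof. exact: tens_actE. Qed.
Lemma BA_lact (c b : B) (x : X) : lact c (te b x : BA phi X) = te (c * b) x.
Proof. exact: tens_lactE. Qed.
Lemma BA_dif (b : B) (x : X) : dif (BA phi X) (te b x) =
  te (dif B b) x + te (twist B 1 b) (dif X x).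
Proof. exact: tens_difE. Qed.
Lemma BA_bal (b : B) a (x : X) : te (b * phi a) x = te b (lact (phi a) x).
Proof. exact: (@tens_elt_bal R A B (rres phi (reg B)) (lres phi X) b a x). Qed.
Lemma BA_homog i j b (x : X) : homog B i b -> homog X j x ->
  homog (BA phi X) (i + j) (te b x).
Proof. exact: (@tens_homog R A B (rres phi (reg B)) (lres phi X)). Qed.
Lemma te0l (x : X) : te 0 x = 0.
Proof. exact: (@tens_elt0l R A B (rres phi (reg B))). Qed.

Lemma JX_act (j : J) (x : X) t : act (tj j x : tens_bimod J X) t = tj j (act x t).
Proof. exact: tens_actE. Qed.
Lemma JX_lact c (j : J) (x : X) : lact c (tj j x : tens_bimod J X) = tj (lact c j) x.
Proof. exact: tens_lactE. Qed.

Lemma iotaE (j : J) (x : X) : Defs.iota phi X (tj j x) = contract (J_incl phi j) x.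
Proof. exact: tens_homE. Qed.

Lemma iota_jproj (z : Be) (x : X) :
  Defs.iota phi X (tj (jproj z) x) = te (mu z : B) x - contract z x.
Proof.
rewrite iotaE jprojE contractBl; congr (_ - _).
by rewrite contractE lact1.
Qed.

Definition unitl (x : X) : BA phi X := te 1 x.

Lemma unitlB : zmod_morphism unitl.
Proof. exact: (@tens_eltBr R A B (rres phi (reg B)) (lres phi X) 1). Qed.
Lemma unitl_act x t : unitl (act x t) = act (unitl x) t.
Proof. by rewrite BA_act. Qed.
Lemma unitl_deg n x : homog X n x -> homog (BA phi X) n (unitl x).
Proof. by move=> xn; rewrite -[n]add0r; apply: BA_homog (homog1 B) xn. Qed.
Lemma unitl_dif x : dif (BA phi X) (unitl x) = unitl (dif X x).
Proof. by rewrite BA_dif dif1 te0l add0r twist1. Qed.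
Lemma unitl_lact a x : unitl (lact (phi a) x) = lact (phi a) (unitl x).
Proof. by rewrite /unitl -BA_bal BA_lact mul1r mulr1. Qed.
Lemma mulmap_unitl x : mulmap phi X (unitl x) = x.
Proof. by rewrite mulmapE lact1. Qed.

Fact retr_bal : balanced (fun (b : rres phi (reg B)) (x : lres phi X) =>
  tj (jdelta phi (b : B)) x).
Proof.
split=> [x b c|b|b a x].
- by rewrite jdeltaB; apply: (@tens_eltBl R B B J X).
- exact: (@tens_eltBr R B B J X).
rewrite -[act b a]/((b : B) * phi a) jdelta_phiMr.
exact: (tens_elt_bal (M := J)).
Qed.

(* A retraction of [iota], right but not left B-linear. *)
Definition retr : BA phi X -> tens_bimod J X := tens_lift retr_bal.

Lemma retrE (b : B) (x : X) : retr (te b x) = tj (jdelta phi b) x.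
Proof. exact: tens_liftE. Qed.

Lemma retrB : zmod_morphism retr.
Proof. exact: raddfB. Qed.

Lemma retr_ghom : ghom 0 retr.
Proof.
apply: (@tens_lift_ghom R A B (rres phi (reg B)) (lres phi X) (tens_bimod J X) _ retr_bal) => [b x t|i j b x bi xj]; first by rewrite -JX_act.
by rewrite addr0; apply: (@tens_homog R B B J X i j _ x (jdelta_deg phi bi) xj).
Qed.

Lemma retr_dif y : dif (tens_bimod J X) (retr y) = retr (dif (BA phi X) y).
Proof.
move: y; apply: tens_ext => [y z|y z|b x].
- by rewrite retrB raddfB.
- by rewrite raddfB retrB.
rewrite retrE BA_dif (zmorD retrB) !retrE jdelta_twist -jdelta_dif.
exact: tens_difE.
Qed.

Lemma retr_lact a y : retr (lact (phi a) y) = lact (phi a) (retr y).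
Proof.
move: y; apply: tens_ext => [y z|y z|b x].
- by rewrite lactBr retrB.
- by rewrite retrB lactBr.
by rewrite BA_lact !retrE jdelta_phiMl JX_lact.
Qed.

Lemma retr_contract (z : Be) (x : X) :
  retr (contract z x) = tj (jdelta phi (mu z : B) - jproj z) x.
Proof.
move: z; apply: tens_ext => [z w|z w|b b'].
- by rewrite contractBl retrB.
- by rewrite (raddfB mu) jdeltaB jprojB -(tens_eltBl (M := J)) !opprD !opprK addrACA.
rewrite contractE retrE -(tens_elt_bal (M := J)) mulmapE.
congr (tens_elt _ _); apply: (canRL (addrK _)).
have -> : jproj (@tens_elt R A B (rres phi (reg B)) (lres phi (reg B)) b b') =
    lact b (jdelta phi b').
  by rewrite -jproj_lact Be_lact mulr1.
exact: esym (jdeltaM phi b b').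
Qed.

Lemma retr_iota w : retr (Defs.iota phi X w) = w.
Proof.
move: w; apply: (tens_ext (h := fun w => w)) => [y z|//|j x].
  by rewrite raddfB retrB.
by rewrite iotaE retr_contract mu_J jproj_J (zmor0 (jdeltaB phi)) sub0r opprK.
Qed.

(** With [retr_iota] and [mulmap_unitl] this splits the short exact sequence; as [retr] and [unitl]
    are right linear and commute with differentials, the splitting is one of right DG modules. *)
Lemma iota_retr y : Defs.iota phi X (retr y) = y - unitl (mulmap phi X y).
Proof.
move: y; apply: tens_ext => [y z|y z|b x].
- by rewrite retrB raddfB.
- by rewrite (raddfB (mulmap phi X)) unitlB !opprD !opprK addrACA.
by rewrite retrE iota_jproj contractE !mulmapE (lact1 (d := reg B)).
Qed.
End Retraction.

(** * The contraction of the bar construction *)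

Section BarComponents.
Variables (R : comPzRingType) (A B : dgAlg R) (phi : dgAlgHom A B).
Local Notation Jp := (Jpow phi).

(** Reads a summand in the unshifted module, so that the shift shows only in the explicit signs and
    twists below. *)
Definition bcomp n (f : bar phi) : BA phi (Jp n) := ds_fun f n.

Lemma bar_ext (f g : bar phi) : (forall n, bcomp n f = bcomp n g) -> f = g.
Proof. exact: dsumP. Qed.

Lemma bcompB n : zmod_morphism (bcomp n). Proof. by []. Qed.
Lemma bcomp_dif n f : bcomp n (dif (bar phi) f) =
  sgn n%:Z (dif (BA phi (Jp n)) (bcomp n f)) + bar_bd phi n (bcomp n.+1 f).
Proof. by []. Qed.
Lemma bcomp_act n f t : bcomp n (act f t) = act (bcomp n f) t.
Proof. by []. Qed.
Lemma bcomp_lact n s f : bcomp n (lact s f) = lact (twist B n%:Z s) (bcomp n f).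
Proof. by []. Qed.
Lemma bcomp_deg n i f : homog (bar phi) i f -> homog (BA phi (Jp n)) (i - n%:Z) (bcomp n f).
Proof. by move=> fi; rewrite /homog -{2}fi. Qed.
Lemma bar_homog i f : (forall n, homog (BA phi (Jp n)) (i - n%:Z) (bcomp n f)) ->
  homog (bar phi) i f.
Proof. by move=> fi; apply: bar_ext => n; apply: fi. Qed.
Lemma bar_bdE n y : bar_bd phi n y = Defs.iota phi (Jp n) (mulmap phi (Jp n.+1) y).
Proof. by []. Qed.

Definition degen n (y : BA phi (Jp n)) : BA phi (Jp n.+1) :=
  unitl phi (X := Jp n.+1) (retr (X := Jp n) y).

Lemma degenB n : zmod_morphism (@degen n).
Proof.
move=> y z; rewrite /degen (retrB (X := Jp n)).
exact: (unitlB phi (X := Jp n.+1)).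
Qed.
Lemma degen_act n y t : degen (act y t : BA phi (Jp n)) = act (degen y) t.
Proof.
have [_ ra _] := retr_ghom phi (Jp n).
by rewrite /degen ra (unitl_act phi (X := Jp n.+1)).
Qed.
Lemma degen_lact n a y : degen (lact (phi a) y : BA phi (Jp n)) = lact (phi a) (degen y).
Proof.
rewrite /degen (retr_lact (X := Jp n)).
exact: (unitl_lact phi (X := Jp n.+1)).
Qed.
Lemma degen_deg n i y : homog (BA phi (Jp n)) i y -> homog (BA phi (Jp n.+1)) i (degen y).
Proof.
move=> yi; apply: (unitl_deg phi (X := Jp n.+1)).
by have [_ _ /(_ i y yi)] := retr_ghom phi (Jp n); rewrite addr0.
Qed.
Lemma degen_dif n y : dif (BA phi (Jp n.+1)) (degen y) = degen (dif (BA phi (Jp n)) y).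
Proof.
rewrite /degen (unitl_dif phi (X := Jp n.+1)); congr (unitl _ _).
exact: (retr_dif (X := Jp n)).
Qed.
Lemma bd_degen n (y : BA phi (Jp n)) :
  bar_bd phi n (degen y) = y - unitl phi (mulmap phi (Jp n) y).
Proof.
rewrite bar_bdE /degen (mulmap_unitl phi (X := Jp n.+1)).
exact: (iota_retr (X := Jp n)).
Qed.
(** Together with [bd_degen]: in the sum of the two composites the terms through [unitl] cancel,
    leaving the identity. *)
Lemma degen_bd n (y : BA phi (Jp n.+1)) :
  degen (bar_bd phi n y) = unitl phi (mulmap phi (Jp n.+1) y).
Proof. by rewrite bar_bdE /degen (retr_iota (X := Jp n)). Qed.

Fact contr_fin (f : bar phi) : exists K : nat, forall n : nat, (K <= n)%N ->
  (match n return bshift n%:Z (BA phi (Jp n)) with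
   | 0 => 0 | m.+1 => degen (bcomp m f) end) = 0.
Proof.
have [K fK] := ds_fin f; exists K.+1 => -[//|n] /fK fn.
by rewrite /bcomp fn (zmor0 (@degenB n)).
Qed.

(* The extra degeneracy of the bar construction. *)
Definition contr (f : bar phi) : bar phi := DSum (contr_fin f).

Lemma contr0 f : bcomp 0 (contr f) = 0. Proof. by []. Qed.
Lemma contrS n f : bcomp n.+1 (contr f) = degen (bcomp n f).
Proof. by []. Qed.

Lemma contrB : zmod_morphism contr.
Proof.
move=> f g; apply: bar_ext => -[|n]; rewrite bcompB.
  by rewrite !contr0 subrr.
by rewrite !contrS bcompB degenB.
Qed.

Lemma contr_act f t : contr (act f t) = act (contr f) t.
Proof.
apply: bar_ext => -[|n]; rewrite bcomp_act; first by rewrite !contr0 act0l.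
by rewrite !contrS bcomp_act degen_act.
Qed.

(** The twist reflects that the contraction has degree 1. Only scalars from A pass through it,
    because [retr] is not left B-linear; so it acts on N (x)_A bar, and descending to N (x)_B bar
    takes a section of pi_N. *)
Lemma contr_lact a f :
  contr (lact (phi a) f) = lact (twist B 1 (phi a)) (contr f).
Proof.
have tw k c : twist B k (phi c) = phi (twist A k c).
  move: c; apply: (additive_homog (C := A)) => [x y|x y|n x xn].
  - by rewrite !raddfB.
  - by rewrite !raddfB.
  by rewrite (twist_homog k xn) (twist_homog k (dgah_deg phi xn)) sgn_add.
apply: bar_ext => -[|n]; rewrite bcomp_lact; first by rewrite !contr0 raddf0.
rewrite !contrS bcomp_lact !tw degen_lact; congr (lact (phi _) _).
move: a; apply: (additive_homog (C := A)) => [x y|x y|m x xm].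
- by rewrite !raddfB.
- by rewrite !raddfB.
rewrite [in RHS](twist_homog 1 xm) (zmor_sgn (@twistB A A n.+1)).
by rewrite !(twist_homog _ xm) intS mulrDl [in RHS]sgnD sgnK.
Qed.

Lemma contr_deg i f : homog (bar phi) i f -> homog (bar phi) (i + 1) (contr f).
Proof.
move=> fi; apply: bar_homog => -[|n]; first by rewrite contr0; apply: homog0.
rewrite contrS; apply: degen_deg; rewrite intS opprD addrA addrK.
exact: bcomp_deg.
Qed.

(** Component 0 is excluded: there the sum misses the identity by [unitl] of [mulmap]. Every
    [omega phi l] kills that component, which gives [omega_contr]. *)
Lemma contr_dif f n : (0 < n)%N ->
  bcomp n (dif (bar phi) (contr f) + contr (dif (bar phi) f)) = bcomp n f.
Proof.
case: n => // n _.
rewrite -[LHS]/(bcomp n.+1 (dif (bar phi) (contr f)) + bcomp n.+1 (contr (dif (bar phi) f))).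
rewrite bcomp_dif !contrS bcomp_dif degen_dif bd_degen.
rewrite (zmorD (@degenB n)) (zmor_sgn (@degenB n)) degen_bd.
by rewrite intS sgnD sgn1 addrACA addNr add0r subrK.
Qed.

Lemma omega_eq0 l (f : bar phi) : (forall n, (0 < n)%N -> bcomp n f = 0) ->
  omega phi l f = 0.
Proof.
move=> f0; apply/qpi_eq0/asboolP => n ln; apply: f0; exact: leq_ltn_trans ln.
Qed.

Lemma omega_contr l f : omega phi l (dif (bar phi) (contr f)) +
  omega phi l (contr (dif (bar phi) f)) = omega phi l f.
Proof.
apply/eqP; rewrite -subr_eq0 -raddfD -raddfB; apply/eqP; apply: omega_eq0 => n n0.
by rewrite bcompB contr_dif// subrr.
Qed.

End BarComponents.

(** * Null-homotopies obtained from a section of pi_N *)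

Section LiftableNull.
Variables (R : comPzRingType) (A B : dgAlg R) (phi : dgAlgHom A B) (N : dgMod B).
Variable s : dgHom N (tens (res phi N) (lres phi (reg B))).
Hypothesis piN_s : forall x, piN phi N (s x) = x.
Variable l : nat.
Local Notation Q := (bar_quo phi l).
Local Notation U := (tens (res phi N) (lres phi (reg B))).
Local Notation tu := (@tens_elt R A B (res phi N) (lres phi (reg B))).
Local Notation tq := (@tens_elt R B B N Q).
Local Notation om := (omega phi l).

Lemma piNE (x : N) (b : B) : piN phi N (tu x b) = act x b.
Proof. exact: tens_homE. Qed.

Lemma U_dif (x : N) (b : B) :
  dif U (tu x b) = tu (dif N x) b + tu (twist N 1 x) (dif B b).
Proof. exact: tens_difE. Qed.

Lemma NQ_dif (x : N) (z : Q) :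
  dif (tens N Q) (tq x z) = tq (dif N x) z + tq (twist N 1 x) (dif Q z).
Proof. exact: tens_difE. Qed.

(** The contraction of [b y] weighted by x (x) b; the twist on x absorbs the one in [contr_lact],
    which gives balancedness over A. *)
Fact lam_bal (y : bar phi) : balanced (fun (x : res phi N) (b : lres phi (reg B)) =>
  tq (twist N 1 x) (om (contr (lact (b : B) y)))).
Proof.
split=> [b x x'|x b b'|x a b].
- by rewrite raddfB (tens_eltBl (M := N)).
- by rewrite (lactBl (d := bar phi)) contrB !raddfB.
rewrite -[act x a]/(act (x : N) (phi a)) twist_act (tens_elt_bal (M := N)).
by rewrite -[lact a b]/(phi a * (b : B)) -(lactA (d := bar phi)) contr_lact dgbh_lact.
Qed.

Definition lam (y : bar phi) (w : U) : tens N Q := tens_lift (lam_bal y) w.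

Lemma lamE y x b : lam y (tu x b) = tq (twist N 1 x) (om (contr (lact (b : B) y))).
Proof. exact: tens_liftE. Qed.
Lemma lamB y : zmod_morphism (lam y). Proof. exact: raddfB. Qed.
Lemma lamBl w : zmod_morphism (lam^~ w).
Proof.
move=> y z; move: w; apply: tens_ext => [v w|v w|x b].
- exact: lamB.
- by rewrite !lamB !opprD !opprK addrACA.
by rewrite !lamE raddfB contrB !raddfB.
Qed.

Lemma lam_act_bal y w b : lam y (act w b) = lam (lact b y) w.
Proof.
move: w; apply: tens_ext => [v w|v w|x c].
- by rewrite actBl lamB.
- exact: lamB.
rewrite [Z in lam _ Z]tens_actE !lamE (lactA (d := bar phi)).
by [].
Qed.

Lemma lam_act y w t : lam (act y t) w = act (lam y w) t.
Proof.
move: w; apply: tens_ext => [v w|v w|x c].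
- exact: lamB.
- by rewrite lamB actBl.
by rewrite !lamE [RHS]tens_actE (lact_act (d := bar phi)) contr_act dgh_act.
Qed.

Lemma lam_deg i j y w : homog (bar phi) j y -> homog U i w ->
  homog (tens N Q) (i + j + 1) (lam y w).
Proof.
move=> yj wi; rewrite /homog -[in RHS]wi.
move: w {wi}; apply: tens_ext_homog => [v w|v w|m n x b xm bn].
- by rewrite lamB raddfB.
- by rewrite raddfB lamB.
rewrite [Z in _ = lam _ Z](tens_prH i xm bn) lamE.
have h : homog (tens N Q) (m + n + j + 1)
    (tq (twist N 1 x) (om (contr (lact (b : B) y)))).
  rewrite -!addrA; apply: tens_homog; first exact: homog_twist.
  by rewrite !addrA; apply: dgh_deg; apply: contr_deg; apply: lact_deg.
rewrite (pr_homog _ h) !(inj_eq (addIr _)).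
by case: eqP => _; rewrite ?lamE// (zmor0 (lamB y)).
Qed.

(** For w = x (x) b the terms in [dif N x] and [dif B b] cancel, and [omega_contr] collapses the
    rest to x (x) omega (b y), which is x b (x) omega y. *)
Lemma lam_dif y w : dif (tens N Q) (lam y w) + (lam y (dif U w) +
  lam (dif (bar phi) y) (twist U 1 w)) = tq (piN phi N w) (om y).
Proof.
move: w; apply: tens_ext_homog => [v w|v w|m n x b xm bn].
- rewrite lamB (raddfB (dif (tens N Q))) (raddfB (dif U)) lamB (raddfB (twist U 1)) lamB.
  by rewrite [X in _ + X]addrACA -opprD addrACA -opprD.
- by rewrite raddfB (tens_eltBl (M := N)).
rewrite U_dif (zmorD (lamB y)) !lamE.
have -> : twist U 1 (tu x b) = tu (twist N 1 x) (twist B 1 b).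
  rewrite (twist_homog 1 (tens_homog xm bn)) (twist_homog (C := N) 1 xm).
  rewrite (twist_homog (C := B) 1 bn) mulrDr sgnD.
  by rewrite (@tens_elt_sgnl _ _ _ (res phi N)) tens_elt_sgnr.
have tt : twist N 1 (twist N 1 x) = x.
  rewrite (twist_homog (C := N) 1 xm) (zmor_sgn (@twistB N N 1)).
  by rewrite (twist_homog (C := N) 1 xm) sgnK.
have dt : dif N (twist N 1 x) = - twist N 1 (dif N x) by rewrite twist_dif sgn1 opprK.
rewrite lamE NQ_dif !tt dt piNE (tens_elt_bal (M := N)) -dgbh_lact.
rewrite -(omega_contr l (lact (b : B) y)) (dif_lact (M := bar phi)).
rewrite (zmorD (contrB (phi := phi))) (raddfD om) -dgh_dif.
rewrite !(@tens_eltDr R B B N Q (x : N)) (zmorN (@tens_eltBl R B B N Q _)).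
by rewrite -[X in _ + X]addrA addrACA addNr add0r.
Qed.

Fact lift_bal : balanced (fun (x : N) (y : bar phi) => lam y (s x)).
Proof.
split=> [y x x'|x y y'|x b y]; first by rewrite raddfB lamB.
  exact: lamBl.
by rewrite dgh_act lam_act_bal.
Qed.

Lemma section_null_homotopic : null_homotopic (tens_map N (omega phi l)).
Proof.
apply/null_homotopicP.
(* The homotopy sends x (x) y to [lam y (s x)], which is balanced over B because s is B-linear. *)
have hg : ghom (0 + 1) (tens_lift lift_bal : tens N (bar phi) -> tens N Q).
  apply: (@tens_lift_ghom R B B N (bar phi) (tens N Q)) => [x y t|i j x y xi yj].
    exact: lam_act.
  by rewrite add0r; apply: lam_deg => //; apply: dgh_deg.
exists (tens_lift lift_bal) => //; apply: tens_ext => [z w|z w|x y].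
- by rewrite raddfB.
- by apply: (ghomB (ghom_dcomm hg erefl)).
rewrite (@tens_lift_dcomm R B B N (bar phi) (tens N Q)) [LHS]tens_homE.
rewrite add0r sgn1 opprK dgh_dif dgh_twist -[in LHS](piN_s x).
exact: esym (lam_dif y (s x)).
Qed.

End LiftableNull.

(** * The Atiyah class *)

Section Associator.
Variables (R : comPzRingType) (S T U : dgAlg R).
Variables (M : dgMod S) (Y : dgBimod S T) (X : dgBimod T U).
Local Notation ty := (@tens_elt R T U Y X).
Local Notation tm := (@tens_elt R S U M (tens_bimod Y X)).
Local Notation ti := (@tens_elt R S T M Y).

Lemma YX_lact s (y : Y) (x : X) : lact s (ty y x : tens_bimod Y X) = ty (lact s y) x.
Proof. exact: tens_lactE. Qed.
Lemma YX_act t (y : Y) (x : X) : act (ty y x : tens_bimod Y X) t = ty y (act x t).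
Proof. exact: tens_actE. Qed.
Lemma YX_dif (y : Y) (x : X) : dif (tens_bimod Y X) (ty y x) =
  ty (dif Y y) x + ty (twist Y 1 y) (dif X x).
Proof. exact: tens_difE. Qed.
Lemma YX_homog i j y x : homog Y i y -> homog X j x ->
  homog (tens_bimod Y X) (i + j) (ty y x).
Proof. exact: (@tens_homog R T U Y X). Qed.

Fact assoc_fun_bal (x : X) : balanced (fun (m : M) (y : Y) => tm m (ty y x)).
Proof.
split=> [y m n|m y z|m s y].
- exact: (@tens_eltBl R S U M).
- by rewrite (@tens_eltBl R T U Y X) (@tens_eltBr R S U M).
by rewrite (@tens_elt_bal R S U M) YX_lact.
Qed.

Definition assoc_fun (w : tens M Y) (x : X) : tens M (tens_bimod Y X) :=
  tens_lift (assoc_fun_bal x) w.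

Lemma assoc_funE m y x : assoc_fun (ti m y) x = tm m (ty y x).
Proof. exact: tens_liftE. Qed.
Lemma assoc_funB x : zmod_morphism (assoc_fun^~ x).
Proof. exact: (raddfB (tens_lift (assoc_fun_bal x))). Qed.

Fact assoc_bal : balanced assoc_fun.
Proof.
split=> [x|w x z|w t x]; first exact: assoc_funB.
  move: w; apply: tens_ext => [v w|v w|m y].
  - exact: assoc_funB.
  - by rewrite !assoc_funB !opprD !opprK addrACA.
  by rewrite !assoc_funE (@tens_eltBr R T U Y X) (@tens_eltBr R S U M).
move: w; apply: tens_ext => [v w|v w|m y].
- by rewrite actBl assoc_funB.
- exact: assoc_funB.
rewrite [Z in assoc_fun Z]tens_actE !assoc_funE.
by rewrite (@tens_elt_bal R T U Y X).
Qed.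

Fact assoc_act w x t : assoc_fun w (act x t) = act (assoc_fun w x) t.
Proof.
move: w; apply: tens_ext => [v w|v w|m y].
- exact: assoc_funB.
- by rewrite assoc_funB actBl.
by rewrite !assoc_funE [RHS]tens_actE YX_act.
Qed.

Fact assoc_deg i j w x : homog (tens M Y) i w -> homog X j x ->
  homog (tens M (tens_bimod Y X)) (i + j) (assoc_fun w x).
Proof.
move=> wi xj; rewrite /homog -[in RHS]wi.
move: w {wi}; apply: tens_ext_homog => [v w|v w|k l m y mk yl].
- by rewrite assoc_funB raddfB.
- by rewrite raddfB assoc_funB.
rewrite [Z in _ = assoc_fun Z _](tens_prH i mk yl) assoc_funE.
have h := @tens_homog R S U M _ _ _ _ _ mk (YX_homog yl xj).
rewrite (pr_homog _ h) addrA (inj_eq (addIr j)).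
by case: eqP => _; rewrite ?assoc_funE// (zmor0 (assoc_funB x)).
Qed.

Fact assoc_dif w x : dif (tens M (tens_bimod Y X)) (assoc_fun w x) =
  assoc_fun (dif (tens M Y) w) x + assoc_fun (twist (tens M Y) 1 w) (dif X x).
Proof.
move: w; apply: tens_ext_homog => [v w|v w|k l m y mk yl].
- by rewrite assoc_funB raddfB.
- by rewrite (raddfB (dif _)) (raddfB (twist _ _)) !assoc_funB !opprD addrACA.
rewrite assoc_funE [LHS]tens_difE YX_dif (@tens_eltDr R S U M) addrA.
rewrite [Z in assoc_fun Z x]tens_difE (zmorD (assoc_funB x)) !assoc_funE; congr (_ + _).
rewrite (twist_homog 1 (tens_homog mk yl)) (zmor_sgn (assoc_funB _)) assoc_funE.
rewrite (twist_homog (C := M) 1 mk) (twist_homog (C := Y) 1 yl) mulrDr sgnD.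
by rewrite (@tens_elt_sgnl R S U M) (@tens_elt_sgnl R T U Y) (@tens_elt_sgnr R S U M).
Qed.

Definition assoc : dgHom (tens (tens M Y) X) (tens M (tens_bimod Y X)) :=
  tens_hom assoc_bal assoc_act assoc_deg assoc_dif.

Lemma assocE w x : assoc (@tens_elt R T U (tens M Y) X w x) = assoc_fun w x.
Proof. exact: tens_homE. Qed.
End Associator.

Section DgHomComp.
Variables (R : comPzRingType) (A : dgAlg R) (L M N : dgMod A).
Variables (g : dgHom M N) (f : dgHom L M).

Fact dgHom_compB : zmod_morphism (fun x => g (f x)).
Proof. by move=> x y; rewrite !raddfB. Qed.
Fact dgHom_comp_act x a : mkAdd dgHom_compB (act x a) = act (mkAdd dgHom_compB x) a.
Proof. by rewrite /= !dgh_act. Qed.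
Fact dgHom_comp_deg n x : homog L n x -> homog N n (mkAdd dgHom_compB x).
Proof. by move=> xn; apply/dgh_deg/dgh_deg. Qed.
Fact dgHom_comp_dif x : mkAdd dgHom_compB (dif L x) = dif N (mkAdd dgHom_compB x).
Proof. by rewrite /= !dgh_dif. Qed.

Definition dgHom_comp : dgHom L N :=
  DGHom dgHom_comp_act dgHom_comp_deg dgHom_comp_dif.

Lemma dgHom_compE x : dgHom_comp x = g (f x). Proof. by []. Qed.
End DgHomComp.

Section Atiyah.
Variables (R : comPzRingType) (A B : dgAlg R) (phi : dgAlgHom A B) (N : dgMod B).
Local Notation Be := (Be phi).
Local Notation J := (J phi).
Local Notation mu := (mulmap phi (reg B)).
Local Notation tn X := (@tens_elt R B B N X).
Local Notation tb := (@tens_elt R A B (rres phi (reg B)) (lres phi (reg B))).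

Definition pN (X : dgBimod B B) := tens_map N (mulmap phi X).
Definition ioN (X : dgBimod B B) := tens_map N (Defs.iota phi X).

Lemma tn_dif (X : dgBimod B B) n (x : X) :
  dif (tens N X) (tn X n x) = tn X (dif N n) x + tn X (twist N 1 n) (dif X x).
Proof. exact: tens_difE. Qed.
Lemma tn_act (X : dgBimod B B) n (x : X) t : act (tn X n x : tens N X) t = tn X n (act x t).
Proof. exact: tens_actE. Qed.

Lemma pNE X n y : pN X (tn (BA phi X) n y) = tn X n (mulmap phi X y).
Proof. exact: tens_homE. Qed.
Lemma ioNE X n y : ioN X (tn (tens_bimod J X) n y) = tn (BA phi X) n (Defs.iota phi X y).
Proof. exact: tens_homE. Qed.

Lemma pN_ioN X z : pN X (ioN X z) = 0.
Proof.
move: z; apply: (tens_ext (h := fun=> 0)) => [z w|z w|n y].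
- by rewrite !raddfB.
- by rewrite subr0.
by rewrite ioNE pNE [mulmap _ _ _]mulmap_iota raddf0.
Qed.

Section Contract.
Variable X : dgBimod B B.

Fact contract_balanced : balanced (fun (z : Be) (x : X) => contract z x : BA phi X).
Proof.
split=> [x z w|z x y|z b x]; [exact: contractBl|exact: contractBr|exact: contract_bal_act].
Qed.

Definition contract_hom : dgHom (tens Be X) (BA phi X) :=
  tens_hom contract_balanced (@contract_act _ _ _ phi X) (@contract_deg _ _ _ phi X)
    (@contract_dif _ _ _ phi X).

Lemma contract_homE z x : contract_hom (@tens_elt R B B Be X z x) = contract z x.
Proof. exact: tens_homE. Qed.

Fact contract_hom_lact b w :
  contract_hom (lact b (w : tens_bimod Be X)) = lact b (contract_hom w).
Proof.
move: w; apply: tens_ext => [v w|v w|z x].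
- by rewrite lactBr raddfB.
- by rewrite raddfB lactBr.
by rewrite YX_lact !contract_homE contract_lact.
Qed.

Definition contract_bihom : dgBiHom (tens_bimod Be X) (BA phi X) :=
  @DGBiHom R B B (tens_bimod Be X) (BA phi X) contract_hom contract_hom_lact.

Definition kN : dgHom (tens (tens N Be) X) (tens N (BA phi X)) :=
  dgHom_comp (tens_map N contract_bihom) (assoc N Be X).

Lemma kNE n z x : kN (@tens_elt R B B (tens N Be) X (tn Be n z) x) =
  tn (BA phi X) n (contract z x).
Proof.
rewrite dgHom_compE assocE assoc_funE [LHS]tens_homE.
exact: congr1 (contract_homE z x).
Qed.
End Contract.

Fact jpN_bal : balanced (fun (n : N) (z : Be) => tn J n (jproj z)).
Proof.
split=> [z|n z w|n b z]; first exact: (@tens_eltBl R B B N J).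
  by rewrite jprojB (@tens_eltBr R B B N J).
by rewrite jproj_lact; apply: (@tens_elt_bal R B B N J).
Qed.

Definition jpN : tens N Be -> tens N J := tens_lift jpN_bal.

Lemma jpNE n z : jpN (tn Be n z) = tn J n (jproj z).
Proof. exact: tens_liftE. Qed.
Lemma jpNB : zmod_morphism jpN. Proof. exact: raddfB. Qed.

Lemma jpN_closed : gclosed 0 jpN.
Proof.
move=> w; rewrite /dcomm sgn0; apply/eqP; rewrite subr_eq0; apply/eqP.
move: w; apply: tens_ext => [v w|v w|n z].
- by rewrite jpNB raddfB.
- by rewrite raddfB jpNB.
by rewrite jpNE !tn_dif (zmorD jpNB) !jpNE -jproj_dif.
Qed.

Lemma jpN_deg n w : homog (tens N Be) n w -> homog (tens N J) n (jpN w).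
Proof.
move=> wn; rewrite /homog -[in RHS]wn.
move: w {wn}; apply: tens_ext_homog => [v w|v w|k l m z mk zl].
- by rewrite jpNB raddfB.
- by rewrite raddfB jpNB.
rewrite [Z in _ = jpN Z](tens_prH n mk zl) jpNE.
rewrite [LHS](tens_prH n mk (jproj_deg zl)).
by case: eqP => _; rewrite ?jpNE// (zmor0 jpNB).
Qed.

Fact mN_bal (c : B) :
  balanced (fun (n : N) (b : reg B) => tn J n (lact (b : B) (jdelta phi c))).
Proof.
split=> [b|n b b'|n a b]; first exact: (@tens_eltBl R B B N J).
  by rewrite (lactBl (d := J)) (@tens_eltBr R B B N J).
by rewrite (@tens_elt_bal R B B N J) (lactA (d := J)).
Qed.

Lemma jpN_act w c :
  jpN (act w c) = act (jpN w) c + tens_lift (mN_bal c) (pN (reg B) w).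
Proof.
move: w; apply: tens_ext => [v w|v w|n z].
- by rewrite actBl jpNB.
- by rewrite jpNB actBl !(raddfB (pN (reg B))) !(raddfB (tens_lift _)) opprD addrACA.
by rewrite tn_act !jpNE pNE tens_liftE jproj_act (@tens_eltDr R B B N J) tn_act.
Qed.

Fact qN_bal (X : dgBimod B B) (x : X) : balanced (fun (n : N) (b : reg B) =>
  tn (BA phi X) n (@tens_elt R A B (rres phi (reg B)) (lres phi X) b x)).
Proof.
split=> [b|n b b'|n a b]; first exact: (@tens_eltBl R B B N (BA phi X)).
  rewrite (@tens_eltBl R A B (rres phi (reg B)) (lres phi X)).
  exact: (@tens_eltBr R B B N (BA phi X)).
by rewrite (@tens_elt_bal R B B N (BA phi X)) BA_lact.
Qed.

Lemma ioN_jpN (X : dgBimod B B) w (x : X) :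
  ioN X (assoc N J X (@tens_elt R B B (tens N J) X (jpN w) x)) =
  tens_lift (qN_bal x) (pN (reg B) w) - kN X (@tens_elt R B B (tens N Be) X w x).
Proof.
move: w; apply: tens_ext => [v w|v w|n z].
- by rewrite jpNB (@tens_eltBl R B B (tens N J) X) !raddfB.
- rewrite (@tens_eltBl R B B (tens N Be) X) (raddfB (pN (reg B))).
  by rewrite (raddfB (tens_lift _)) (raddfB (kN X)) !opprD !opprK addrACA.
rewrite jpNE pNE tens_liftE kNE assocE assoc_funE ioNE iota_jproj.
exact: (@tens_eltBr R B B N (BA phi X)).
Qed.

Fact asN_bal (X : dgBimod B B) (x : X) :
  balanced (fun (n : N) (b : reg B) => tn X n (lact (b : B) x)).
Proof.
split=> [b|n b b'|n a b]; first exact: (@tens_eltBl R B B N X).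
  by rewrite (lactBl (d := X)) (@tens_eltBr R B B N X).
by rewrite (@tens_elt_bal R B B N X) (lactA (d := X)).
Qed.

Lemma pN_kN (X : dgBimod B B) w (x : X) :
  pN X (kN X (@tens_elt R B B (tens N Be) X w x)) =
  tens_lift (asN_bal x) (pN (reg B) w).
Proof.
move: w; apply: tens_ext => [v w|v w|n z].
- by rewrite (@tens_eltBl R B B (tens N Be) X) !raddfB.
- by rewrite !raddfB.
by rewrite kNE !pNE tens_liftE [mulmap _ _ _]mulmap_contract.
Qed.

Section Connection.
Variable s0 : N -> tens N Be.
Hypotheses (s0g : ghom 0 s0) (s0p : forall n, pN (reg B) (s0 n) = tn (reg B) n 1).

(* [s0] plays the role of a connection; its covariant derivative, read in
   N (x)_B J, is the Atiyah class. *)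
Definition atiyah (n : N) : tens N J := jpN (dcomm 0 s0 n).

(** Composed with [pN], the connection becomes the chain map n |-> n (x) 1. So its derivative lies
    in the kernel of [pN], where the error term of [jpN_act] vanishes. *)
Lemma pN_dcomm n : pN (reg B) (dcomm 0 s0 n) = 0.
Proof.
rewrite /dcomm !sgn0 raddfB dgh_dif !s0p tn_dif.
by rewrite [dif (reg B) 1]dif1 raddf0 addr0 subrr.
Qed.

Lemma atiyah_ghom : ghom (- 1) atiyah.
Proof.
have [dB dl dd] := ghom_dcomm s0g (esym (sub0r 1)).
split=> [m n|n c|i n ni].
- by rewrite /atiyah dB jpNB.
- by rewrite /atiyah dl jpN_act pN_dcomm raddf0 addr0.
exact/jpN_deg/dd.
Qed.

Lemma atiyah_closed : gclosed (- 1) atiyah.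
Proof.
apply: (gclosed_comp jpNB (esym (add0r _)) jpN_closed).
exact: gclosed_dcomm (ghomB s0g) (esym (sub0r 1)).
Qed.

Variable X : dgBimod B B.

Definition atX (z : tens N X) : tens N (tens_bimod J X) :=
  assoc N J X (ltens (X := X) atiyah_ghom z).

Lemma atX_ghom : ghom (- 1) atX.
Proof. by rewrite -[- 1]add0r; apply: ghom_comp (dgh_ghom _) (ltens_ghom _ _). Qed.

Lemma atX_closed : gclosed (- 1) atX.
Proof.
apply: (gclosed_comp (raddfB (assoc N J X)) (esym (add0r _)) (dgh_closed _)).
exact: ltens_closed atiyah_closed.
Qed.

Definition cX (z : tens N X) : tens N (BA phi X) := kN X (ltens (X := X) s0g z).

Lemma cX_ghom : ghom 0 cX.
Proof. by rewrite -[0]add0r; apply: ghom_comp (dgh_ghom _) (ltens_ghom _ _). Qed.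

Lemma pN_cX z : pN X (cX z) = z.
Proof.
move: z; apply: (tens_ext (h := fun z => z)) => [z w|//|n x].
  by rewrite (ghomB cX_ghom) raddfB.
by rewrite /cX ltensE pN_kN s0p tens_liftE lact1.
Qed.

(** By [ioN_jpN], following [jpN] by iota gives minus [kN] up to a term through [pN], and that term
    is zero on derivatives of [s0]. Thus the Atiyah class is the whole failure of the section [cX]
    to be a chain map. *)
Lemma dcomm_cX z : dcomm 0 cX z = - ioN X (atX z).
Proof.
rewrite (dcomm_comp_closedl _ _ (raddfB (kN X)) (dgh_closed _) (esym (addr0 0))) sgn0.
move: z; apply: tens_ext => [z w|z w|n x].
- by rewrite (ghomB (ghom_dcomm (ltens_ghom X s0g) erefl)) raddfB.
- by rewrite (ghomB atX_ghom) raddfB opprD.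
rewrite ltens_dcomm /atX ltensE ioN_jpN pN_dcomm raddf0 sub0r opprK.
by [].
Qed.
End Connection.
End Atiyah.

(** * Lifting the identity to the bar construction *)

Lemma twistK (V : zmodType) (C : cpx V) k x : twist C k (twist C k x) = x.
Proof.
move: x; apply: (additive_homog (C := C)) => [x y|//|n x xn].
  by rewrite !raddfB.
rewrite (twist_homog k xn) (zmor_sgn (@twistB V C k)).
by rewrite (twist_homog k xn) sgnK.
Qed.

Lemma twistD (V : zmodType) (C : cpx V) k l x :
  twist C (k + l) x = twist C k (twist C l x).
Proof.
move: x; apply: (additive_homog (C := C)) => [x y|x y|n x xn].
- by rewrite !raddfB.
- by rewrite !raddfB.
rewrite !(twist_homog _ xn) (zmor_sgn (@twistB V C k)) (twist_homog _ xn) -sgnD.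
by rewrite mulrDl addrC.
Qed.

Section BarSummands.
Variables (R : comPzRingType) (A B : dgAlg R) (phi : dgAlgHom A B).
Local Notation Jp := (Jpow phi).

Fact bsing_fin n (y : bshift n%:Z (BA phi (Jp n))) : exists K : nat, forall m : nat, (K <= m)%N ->
  dfwith (fun m => 0 : bshift m%:Z (BA phi (Jp m))) y m = 0.
Proof. by exists n.+1 => m nm; rewrite dfwith_out// (ltn_eqF nm). Qed.

Definition bsing n (y : BA phi (Jp n)) : bar phi := DSum (bsing_fin y).

Lemma bsing_in n y : bcomp n (@bsing n y) = y.
Proof. exact: dfwith_in. Qed.
Lemma bsing_out n m y : n != m -> bcomp m (@bsing n y) = 0.
Proof. exact: dfwith_out. Qed.

Lemma bsingB n : zmod_morphism (@bsing n).
Proof.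
move=> x y; apply: bar_ext => m; rewrite bcompB.
have [<-|nm] := eqVneq n m; first by rewrite !bsing_in.
by rewrite !bsing_out// subr0.
Qed.

Lemma bsing_act n y t : bsing (act y t : BA phi (Jp n)) = act (bsing y) t.
Proof.
apply: bar_ext => m; rewrite bcomp_act.
have [<-|nm] := eqVneq n m; first by rewrite !bsing_in.
by rewrite !bsing_out// act0l.
Qed.

Lemma lact_bsing n b y :
  lact b (bsing (y : BA phi (Jp n))) = bsing (lact (twist B n%:Z b) y : BA phi (Jp n)).
Proof.
apply: bar_ext => m; rewrite bcomp_lact.
have [<-|nm] := eqVneq n m; first by rewrite !bsing_in.
by rewrite !bsing_out// raddf0.
Qed.

Lemma bsing_deg n i y : homog (BA phi (Jp n)) i y -> homog (bar phi) (i + n%:Z) (bsing y).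
Proof.
move=> yi; apply: bar_homog => m.
have [<-|nm] := eqVneq n m; first by rewrite bsing_in addrK.
by rewrite bsing_out//; apply: homog0.
Qed.

Lemma bsing_dif0 y : dif (bar phi) (bsing (y : BA phi (Jp 0))) = bsing (dif (BA phi (Jp 0)) y).
Proof.
apply: bar_ext => -[|m]; rewrite bcomp_dif.
  by rewrite !bsing_in sgn0 bsing_out// (raddf0 (bar_bd phi 0)) addr0.
by rewrite !bsing_out// (raddf0 (bar_bd phi _)) (raddf0 (dif _)) sgn0r addr0.
Qed.

Lemma bsing_difS n y : dif (bar phi) (bsing (y : BA phi (Jp n.+1))) =
  sgn n.+1%:Z (bsing (dif (BA phi (Jp n.+1)) y)) + bsing (bar_bd phi n y).
Proof.
apply: bar_ext => m; rewrite bcomp_dif.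
rewrite (zmorD (@bcompB _ _ _ phi m)) (zmor_sgn (@bcompB _ _ _ phi m)).
have [<-|mn] := eqVneq n.+1 m.
  rewrite !bsing_in [bcomp n.+2 _]bsing_out ?(ltn_eqF (ltnSn _))//.
  rewrite [bcomp n.+1 (bsing (bar_bd _ _ _))]bsing_out ?(ltn_eqF (ltnSn _))//.
  by rewrite (raddf0 (bar_bd phi _)).
rewrite ![bcomp m (bsing _)](bsing_out _ mn) (raddf0 (dif _)) !sgn0r !add0r.
have [<-|mn'] := eqVneq n m; first by rewrite !bsing_in.
by rewrite !bsing_out// (raddf0 (bar_bd phi _)).
Qed.
End BarSummands.

(** * The summands of N (x)_B bar and the projection to N (x)_B J^(l+1) *)

Section TensorBar.
Variables (R : comPzRingType) (A B : dgAlg R) (phi : dgAlgHom A B) (N : dgMod B).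
Local Notation Jp := (Jpow phi).
Local Notation tn X := (@tens_elt R B B N X).

(** The twist on x compensates the sign of the left action on the n-th shift, visible in
    [lact_bsing]. *)
Fact iN_bal n : balanced (fun (x : N) (y : BA phi (Jp n)) =>
  tn (bar phi) (twist N n%:Z x) (bsing y)).
Proof.
split=> [y x x'|x y y'|x b y].
- by rewrite raddfB; apply: (@tens_eltBl R B B N (bar phi)).
- by rewrite bsingB; apply: (@tens_eltBr R B B N (bar phi)).
by rewrite twist_act (@tens_elt_bal R B B N (bar phi)) lact_bsing twistK.
Qed.

Definition iN n : tens N (BA phi (Jp n)) -> tens N (bar phi) := tens_lift (iN_bal n).

Lemma iNE n x y : iN (tn (BA phi (Jp n)) x y) = tn (bar phi) (twist N n%:Z x) (bsing y).
Proof. exact: tens_liftE. Qed.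

Lemma iN_ghom n : ghom n%:Z (@iN n).
Proof.
apply: (@tens_lift_ghom R B B N (BA phi (Jp n)) (tens N (bar phi))) => [x y t|i j x y xi yj].
  by rewrite bsing_act tn_act.
rewrite -addrA; apply: tens_homog; first exact: homog_twist.
exact: bsing_deg.
Qed.

Lemma iN_dif0 v : dif (tens N (bar phi)) (iN v) = iN (dif (tens N (BA phi (Jp 0))) v).
Proof.
move: v; apply: tens_ext => [v w|v w|x y].
- by rewrite (ghomB (iN_ghom 0)) raddfB.
- by rewrite raddfB (ghomB (iN_ghom 0)).
rewrite iNE !tn_dif (zmorD (ghomB (iN_ghom 0))) !iNE bsing_dif0.
by rewrite twist_dif sgn0 -!twistD [1 + _]addrC.
Qed.

Lemma iN_difS n v : dif (tens N (bar phi)) (iN v) =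
  sgn n.+1%:Z (iN (dif (tens N (BA phi (Jp n.+1))) v)) +
  iN (ioN phi N (Jp n) (pN phi N (Jp n.+1) v)).
Proof.
move: v; apply: tens_ext => [v w|v w|x y].
- by rewrite (ghomB (iN_ghom n.+1)) raddfB.
- rewrite (raddfB (dif (tens N (BA phi (Jp n.+1))))) (ghomB (iN_ghom n.+1)) sgnBr.
  rewrite (raddfB (pN phi N (Jp n.+1))) (raddfB (ioN phi N (Jp n))) (ghomB (iN_ghom n)).
  by rewrite opprD addrACA.
have -> : ioN phi N (Jp n) (pN phi N (Jp n.+1) (tn (BA phi (Jp n.+1)) x y)) =
    tn (BA phi (Jp n)) x (bar_bd phi n y).
  rewrite (@pNE R A B phi N (Jp n.+1)) bar_bdE.
  exact: (@ioNE R A B phi N (Jp n)).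
rewrite (@tn_dif R B N (BA phi (Jp n.+1))) (zmorD (ghomB (iN_ghom n.+1))).
rewrite !(@iNE n.+1) (@iNE n) (@tn_dif R B N (bar phi)) bsing_difS.
rewrite (@tens_eltDr R B B N (bar phi)) sgnDr addrA twist_dif.
rewrite (@tens_elt_sgnl R B B N (bar phi)) sgnK (@tens_elt_sgnr R B B N (bar phi)).
rewrite -!twistD [1 + _]addrC; congr (_ + _).
by rewrite intS [1 + _]addrC -addrA twistD (twistD _ 1 1) twistK.
Qed.

Section Projection.
Variable l : nat.
Local Notation Q := (bar_quo phi l).

Fact psi_funB : zmod_morphism (fun f => mulmap phi (Jp l.+1) (bcomp l.+1 f)).
Proof. by move=> f g; rewrite bcompB (raddfB (mulmap phi (Jp l.+1))). Qed.

Fact psi_subproof (f : bar phi) : f \in dgs_closed (bar_le phi l) -> mkAdd psi_funB f = 0.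
Proof.
move=> /asboolP/(_ l.+1 (ltnSn l)) f0.
rewrite -[LHS]/(mulmap phi (Jp l.+1) (bcomp l.+1 f)).
have -> : bcomp l.+1 f = 0 by exact: f0.
exact: (raddf0 (mulmap phi (Jp l.+1))).
Qed.

(** The map from bar / bar^{<=l} to the module J^(l+1) at which the spliced sequence is cut. *)
Definition psi : Q -> Jp l.+1 := qlift psi_subproof.

Lemma psiE f : psi (omega phi l f) = mulmap phi (Jp l.+1) (bcomp l.+1 f).
Proof. exact: qliftE. Qed.

Lemma psiB : zmod_morphism psi. Proof. exact: raddfB. Qed.

Lemma omega_surj (q : Q) : exists f, q = omega phi l f.
Proof. exact: qpi_surj. Qed.

Lemma psi_act q t : psi (act q t) = act (psi q) t.
Proof.
by have [f ->] := omega_surj q; rewrite -dgh_act !psiE bcomp_act dgh_act.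
Qed.

Lemma psi_lact b q : psi (lact b q) = lact (twist B l.+1%:Z b) (psi q).
Proof.
by have [f ->] := omega_surj q; rewrite -dgbh_lact !psiE bcomp_lact dgbh_lact.
Qed.

(** The spliced part of the differential dies because [mulmap] kills the image of iota. *)
Lemma psi_dif q : psi (dif Q q) = sgn l.+1%:Z (dif (Jp l.+1) (psi q)).
Proof.
have [f ->] := omega_surj q; rewrite -dgh_dif !psiE bcomp_dif raddfD.
rewrite bar_bdE [X in _ + X](mulmap_iota (X := Jp l.+1)) addr0 -dgh_dif.
exact: (zmor_sgn (raddfB (mulmap phi (Jp l.+1)))).
Qed.

Lemma psi_deg i q : homog Q i q -> homog (Jp l.+1) (i - l.+1%:Z) (psi q).
Proof.
have [f ->] := omega_surj q => qi.
rewrite -qi -dgh_pr psiE; apply: dgh_deg; apply: bcomp_deg; exact: homog_pr.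
Qed.

Fact rN_bal : balanced (fun (x : N) (q : Q) =>
  tn (Jp l.+1) (twist N l.+1%:Z x) (psi q)).
Proof.
split=> [y x x'|x y y'|x b y].
- by rewrite raddfB; apply: (@tens_eltBl R B B N (Jp l.+1)).
- by rewrite psiB; apply: (@tens_eltBr R B B N (Jp l.+1)).
by rewrite twist_act (@tens_elt_bal R B B N (Jp l.+1)) psi_lact.
Qed.

Definition rN : tens N Q -> tens N (Jp l.+1) := tens_lift rN_bal.

Lemma rNE x q : rN (tn Q x q) = tn (Jp l.+1) (twist N l.+1%:Z x) (psi q).
Proof. exact: tens_liftE. Qed.

Lemma rN_ghom : ghom (- l.+1%:Z) rN.
Proof.
apply: (@tens_lift_ghom R B B N Q (tens N (Jp l.+1))) => [x y t|i j x y xi yj].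
  by rewrite psi_act tn_act.
rewrite -addrA; apply: tens_homog; first exact: homog_twist.
exact: psi_deg.
Qed.

Lemma rN_closed : gclosed (- l.+1%:Z) rN.
Proof.
apply: (tens_ext (h := fun=> 0)) => [v w|v w|x q].
- by apply: (ghomB (ghom_dcomm rN_ghom erefl)).
- by rewrite subr0.
rewrite /dcomm rNE !tn_dif (zmorD (ghomB rN_ghom)) !rNE psi_dif sgnN sgnDr.
rewrite -(@tens_elt_sgnl R B B N (Jp l.+1)) -(@tens_elt_sgnr R B B N (Jp l.+1)) sgnK.
by rewrite twist_dif sgnK -!twistD [1 + _]addrC subrr.
Qed.

Lemma rN_omega_iN_out n v : n != l.+1 -> rN (tens_map N (omega phi l) (@iN n v)) = 0.
Proof.
move=> nl; move: v; apply: (tens_ext (h := fun=> 0)) => [v w|v w|x y].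
- by rewrite (ghomB (iN_ghom n)) (raddfB (tens_map N (omega phi l))) (ghomB rN_ghom).
- by rewrite subr0.
rewrite iNE [tens_map _ _ _]tens_homE rNE psiE bsing_out// (raddf0 (mulmap phi _)).
exact: (zmor0 (@tens_eltBr R B B N (Jp l.+1) _)).
Qed.

Lemma rN_omega_iN_in v :
  rN (tens_map N (omega phi l) (@iN l.+1 v)) = pN phi N (Jp l.+1) v.
Proof.
move: v; apply: tens_ext => [v w|v w|x y].
- by rewrite (ghomB (iN_ghom l.+1)) (raddfB (tens_map N (omega phi l))) (ghomB rN_ghom).
- exact: (raddfB (pN phi N (Jp l.+1))).
rewrite iNE [tens_map _ _ _]tens_homE rNE psiE bsing_in twistK.
exact: esym (pNE _ _).
Qed.
End Projection.
End TensorBar.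

Lemma tens_nneg (R : comPzRingType) (S T : dgAlg R) (M : dgMod S) (X : dgBimod S T) :
  nneg M -> nneg X -> nneg (tens M X).
Proof.
move=> M0 X0 n z n0 <-; move: z; apply: (tens_ext_homog (h := fun=> 0)) => [v w|v w|i j x y xi yj].
- exact: (raddfB (pr (tens M X) n)).
- by rewrite subr0.
rewrite [LHS](tens_prH n xi yj); case: eqP => // nij.
have [i0|i0] := ltP i 0; first by rewrite (M0 i x i0 xi) tens_elt0l.
have [j0|j0] := ltP j 0; first by rewrite (X0 j y j0 yj) raddf0.
by move: n0; rewrite nij ltNge addr_ge0.
Qed.

(** * Vanishing for the targets J^n and N (x)_B (B (x)_A J^n) *)

Section Vanishing.
Variables (R : comPzRingType) (A B : dgAlg R) (phi : dgAlgHom A B).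
Local Notation Jp := (Jpow phi).

Lemma Jpow_nneg n : nneg (Jp n).
Proof.
have B0 : nneg (reg B) by move=> n' x; apply: dga_nneg.
elim: n => [//|n IH]; apply: tens_nneg IH => k x k0 xk.
apply: J_val_inj; rewrite raddf0; apply: (tens_nneg (M := rres phi (reg B))
  (X := lres phi (reg B)) _ _ k0) => //.
exact: (dgh_deg (J_incl phi) xk).
Qed.

Lemma vanish_retract (N L L' : dgMod B) (i : L -> L') (p : L' -> L) :
  ghom 0 i -> gclosed 0 i -> ghom 0 p -> gclosed 0 p -> (forall x, p (i x) = x) ->
  vanish N L' -> vanish N L.
Proof.
move=> ig ic pg pc pi v k f k0 fg fc.
have e : gexact k (fun x => i (f x)).
  apply: v => //; first by rewrite -[k]add0r; apply: ghom_comp.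
  exact: gclosed_comp (ghomB ig) (esym (add0r k)) ic fc.
by apply: gexact_ext (gexact_compl pg pc e (esym (add0r k))) => x; rewrite pi.
Qed.

Variable N : dgMod B.
Hypothesis vN : vanish N (reg B).
Hypotheses (Bb : bounded_basis (res phi (reg B))) (Bp : perfect (res phi (reg B))).

(** By induction: [tens_vanish] with M = B passes from J^n to B (x)_A J^n, and [retr] makes J^(n+1)
    a right DG retract of the latter. *)
Lemma Jpow_vanish n : vanish N (Jp n).
Proof.
elim: n => [//|n IH].
apply: (vanish_retract (i := Defs.iota phi (Jp n)) (p := retr (X := Jp n))).
- exact: dgh_ghom.
- exact: dgh_closed.
- exact: retr_ghom.
- by move=> y; rewrite /dcomm sgn0 retr_dif subrr.
- exact: retr_iota.
apply: (@tens_vanish R A B N (lres phi (Jp n)) IH (res phi (reg B)) Bb _ Bp).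
by move=> k x; apply: dga_nneg.
Qed.

Fact unital_bal (X : dgBimod B B) : balanced (fun (x : res phi N) (y : lres phi X) =>
  @tens_elt R B B N (BA phi X) x (unitl phi (y : X)) : tens N (BA phi X)).
Proof.
split=> [y|x y z|x a y]; first exact: (@tens_eltBl R B B N (BA phi X)).
  by rewrite unitlB; apply: (@tens_eltBr R B B N (BA phi X)).
apply: etrans (@tens_elt_bal R B B N (BA phi X) x (phi a) (unitl phi (y : X))) _.
exact: congr1 (esym (unitl_lact phi a (y : X))).
Qed.

Fact cancel_bal (X : dgBimod B B) (x : N) :
  balanced (fun (b : rres phi (reg B)) (y : lres phi X) =>
    @tens_elt R A B (res phi N) (lres phi X) (act x (b : B)) y : tens (res phi N) (lres phi X)).
Proof.
split=> [y b c|b|b a y].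
- by rewrite actBr; apply: (@tens_eltBl R A B (res phi N) (lres phi X)).
- exact: (@tens_eltBr R A B (res phi N) (lres phi X)).
rewrite -(@tens_elt_bal R A B (res phi N) (lres phi X)); congr (tens_elt _ _).
exact: esym (actA (d := N) _ _ _).
Qed.

Fact cancel2_bal (X : dgBimod B B) :
  balanced (fun (x : N) (w : BA phi X) => tens_lift (@cancel_bal X x) w).
Proof.
split=> [w x x'|x|x c w]; last 1 first.
- move: w; apply: tens_ext => [v w|v w|b y]; rewrite ?lactBr ?(raddfB (tens_lift _))//.
  by rewrite BA_lact !tens_liftE actA.
- move: w; apply: tens_ext => [v w|v w|b y]; rewrite ?(raddfB (tens_lift _))//.
    by rewrite !opprD !opprK addrACA.
  by rewrite !tens_liftE actBl; apply: (@tens_eltBl R A B (res phi N) (lres phi X)).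
exact: (raddfB (tens_lift (cancel_bal X x))).
Qed.

Section Cancel.
Variable X : dgBimod B B.
Local Notation U := (tens (res phi N) (lres phi X)).
Local Notation V := (tens N (BA phi X)).

(* N (x)_B (B (x)_A X) = N (x)_A X *)
Definition cancelN : V -> U := tens_lift (@cancel2_bal X).
Definition unitalN : U -> V := tens_lift (@unital_bal X).

Lemma cancelNE x (b : B) (y : X) : cancelN (@tens_elt R B B N (BA phi X) x
    (@tens_elt R A B (rres phi (reg B)) (lres phi X) b y)) =
  @tens_elt R A B (res phi N) (lres phi X) (act x b) y.
Proof. by rewrite /cancelN !tens_liftE. Qed.

Lemma unitalNE x (y : X) : unitalN (@tens_elt R A B (res phi N) (lres phi X) x y) =
  @tens_elt R B B N (BA phi X) x (unitl phi y).
Proof. exact: tens_liftE. Qed.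

Lemma cancelNB : zmod_morphism cancelN. Proof. exact: raddfB. Qed.
Lemma unitalNB : zmod_morphism unitalN. Proof. exact: raddfB. Qed.

Lemma V_ext (W : zmodType) (f g : V -> W) : zmod_morphism f -> zmod_morphism g ->
  (forall x b y, f (@tens_elt R B B N (BA phi X) x
     (@tens_elt R A B (rres phi (reg B)) (lres phi X) b y)) =
   g (@tens_elt R B B N (BA phi X) x
     (@tens_elt R A B (rres phi (reg B)) (lres phi X) b y))) -> f =1 g.
Proof.
move=> fB gB fg; apply: tens_ext => // x w; move: w.
have tB : zmod_morphism (@tens_elt R B B N (BA phi X) x).
  exact: (@tens_eltBr R B B N (BA phi X)).
by apply: tens_ext => [v w|v w|b y]; rewrite ?tB ?fB ?gB.
Qed.

Lemma unitalNK w : unitalN (cancelN w) = w.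
Proof.
move: w; apply: (V_ext (g := fun w => w)) => [v w|//|x b y].
  by rewrite cancelNB unitalNB.
rewrite cancelNE unitalNE (@tens_elt_bal R B B N (BA phi X)).
by congr (tens_elt _ _); rewrite /unitl BA_lact mulr1.
Qed.

Lemma unitalN_ghom : ghom 0 unitalN.
Proof.
apply: (@tens_lift_ghom R A B (res phi N) (lres phi X) V) => [x y t|i j x y xi yj].
  by apply: etrans (esym (tn_act _ _ _)); congr tens_elt; exact: (unitl_act phi (y : X) t).
rewrite addr0; apply: (@tens_homog R B B N (BA phi X)) xi _.
exact: (unitl_deg phi (X := X)).
Qed.

Lemma unitalN_closed : gclosed 0 unitalN.
Proof.
apply: (tens_ext (h := fun=> 0)) => [v w|v w|x y].
- by apply: (ghomB (ghom_dcomm unitalN_ghom erefl)).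
- by rewrite subr0.
rewrite (@tens_lift_dcomm R A B (res phi N) (lres phi X) V) sgn0.
rewrite [X in X - _]tens_difE (unitl_dif phi (X := X)).
exact: subrr.
Qed.

Lemma cancelN_unitalN v : cancelN (unitalN v) = v.
Proof.
move: v; apply: (tens_ext (h := fun v => v)) => [v w'|//|x y].
  by rewrite unitalNB cancelNB.
by rewrite unitalNE cancelNE act1.
Qed.

Lemma cancelN_ghom : ghom 0 cancelN.
Proof.
split; [exact: cancelNB|move=> w t|move=> n w wn].
  move: w; apply: V_ext => [v w|v w|x b y].
  - by rewrite actBl cancelNB.
  - by rewrite cancelNB actBl.
  by rewrite tn_act BA_act !cancelNE [RHS]tens_actE.
(* Homogeneity is transported from the inverse bijection [unitalN], whose source is a single tensor
   product. *)
have cn v : unitalN (pr U n v) = pr V n (unitalN v).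
  move: v; apply: (additive_homog (C := U)) => [v v'|v v'|m v vm].
  - by rewrite raddfB unitalNB.
  - by rewrite unitalNB raddfB.
  have := unitalN_ghom; case=> _ _ /(_ m v vm); rewrite addr0 => um.
  by rewrite (pr_homog _ vm) (pr_homog _ um); case: eqP => // _; rewrite (zmor0 unitalNB).
by rewrite addr0 /homog -[in RHS]wn -[in RHS](unitalNK w) -cn cancelN_unitalN.
Qed.

Lemma cancelN_closed : gclosed 0 cancelN.
Proof.
move=> w; rewrite -(unitalNK w) /dcomm sgn0 cancelN_unitalN.
have := unitalN_closed (cancelN w); rewrite /dcomm sgn0 => /eqP.
by rewrite subr_eq0 => /eqP->; rewrite cancelN_unitalN subrr.
Qed.
End Cancel.

(** Through [cancelN] the target becomes N (x)_A J^n, and [tens_vanish] applies again, now with M =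
    N over A. *)
Lemma BA_vanish n : bounded_basis (res phi N) -> nneg N -> perfect (res phi N) ->
  vanish N (tens N (BA phi (Jp n))).
Proof.
move=> Nb N0 Np.
apply: (vanish_retract (@cancelN_ghom (Jp n)) (@cancelN_closed (Jp n))
  (@unitalN_ghom (Jp n)) (@unitalN_closed (Jp n)) (@unitalNK (Jp n))).
exact: (@tens_vanish R A B N (lres phi (Jp n)) (@Jpow_vanish n) (res phi N) Nb N0 Np).
Qed.
End Vanishing.

Lemma sum_nat_widen (W : zmodType) (F : nat -> W) K L : (K <= L)%N ->
  (forall n : nat, (K <= n)%N -> F n = 0) ->
  \sum_(0 <= n < L) F n = \sum_(0 <= n < K) F n.
Proof.
move=> KL F0; rewrite (big_cat_nat (leq0n K) KL) /= [X in _ + X]big_nat_cond.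
by rewrite [X in _ + X]big1 ?addr0// => n /andP[/andP[/F0]].
Qed.

Lemma sum_nat_shift (W : zmodType) (f d e : nat -> W) K :
  f 0%N = d 0%N -> (forall n, f n.+1 = d n.+1 + e n) -> e K = 0 ->
  \sum_(0 <= n < K.+1) f n = \sum_(0 <= n < K.+1) (d n + e n).
Proof.
move=> f0 fS eK; rewrite big_split /= [X in _ + X]big_nat_recr//= eK addr0.
rewrite [LHS]big_nat_recl// [X in _ = X + _]big_nat_recl// f0 -addrA -big_split.
by congr (_ + _); apply: eq_bigr => n _; rewrite fS.
Qed.

Lemma sum_nat_single (W : zmodType) (F : nat -> W) n K : (n < K)%N ->
  (forall m, m != n -> F m = 0) -> \sum_(0 <= m < K) F m = F n.
Proof.
move=> nK F0; rewrite (bigD1_seq n) ?iota_uniq ?mem_index_iota//=.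
by rewrite big1 ?addr0.
Qed.

(** * Powers of the Atiyah class *)

Section AtiyahPowers.
Variables (R : comPzRingType) (A B : dgAlg R) (phi : dgAlgHom A B) (N : dgMod B).
Hypothesis N0 : nneg N.
Local Notation Jp := (Jpow phi).
Local Notation Be := (Be phi).
Local Notation tn X := (@tens_elt R B B N X).
Variable s0 : N -> tens N Be.
Hypotheses (s0g : ghom 0 s0) (s0p : forall n, pN phi N (reg B) (s0 n) = tn (reg B) n 1).
Local Notation at_ n := (atX s0g s0p (X := Jp n)).
Local Notation c_ n := (cX s0g (X := Jp n)).

(** The n-th power of the Atiyah class, with signs chosen so that the sum [bar_lift] is closed. *)
Fixpoint theta (n : nat) : N -> tens N (Jp n) :=
  if n is m.+1 then fun x => sgn m%:Z (at_ m (theta m x)) else fun x => tn (reg B) x 1.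

Lemma theta_ghom n : ghom (- n%:Z) (theta n).
Proof.
elim: n => [|n IH].
  split=> [x y|x b|i x xi]; first exact: (@tens_eltBl R B B N (reg B)).
    by rewrite /theta (@tens_elt_bal R B B N (reg B)) [RHS]tens_actE /= mul1r mulr1.
  by rewrite oppr0; apply: (@tens_homog R B B N (reg B)) xi (homog1 B).
rewrite intS opprD; apply: ghom_sgn; exact: ghom_comp (atX_ghom s0g s0p (Jp n)) IH.
Qed.

Lemma theta_closed n : gclosed (- n%:Z) (theta n).
Proof.
elim: n => [|n IH] x.
  rewrite /dcomm oppr0 sgn0 /theta tn_dif.
  rewrite [dif (reg B) 1]dif1 (zmor0 (@tens_eltBr R B B N (reg B) _)) addr0.
  exact: subrr.
rewrite dcomm_sgn intS opprD.
by rewrite (gclosed_comp (ghomB (atX_ghom s0g s0p (Jp n))) erefl (@atX_closed _ _ _ _ _ _ s0g s0p (Jp n)) IH) sgn0r.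
Qed.

(** [theta n] lowers degrees by n and lands in a non-negatively graded module, so it kills elements
    of degree below n. *)
Lemma theta_fin x : exists K : nat, forall n : nat, (K <= n)%N -> theta n x = 0.
Proof.
move: x; apply: (homog_ind (C := N)) => [|x y [K xK] [L yL]|i x xi].
- by exists 0%N => n _; rewrite (zmor0 (ghomB (theta_ghom n))).
- exists (maxn K L) => n; rewrite geq_max => /andP[/xK Ex /yL Ey].
  by rewrite (zmorD (ghomB (theta_ghom n))) Ex Ey addr0.
exists `|i|%N.+1 => n ni; have [_ _ /(_ i x xi) h] := theta_ghom n.
apply: (tens_nneg N0 (@Jpow_nneg _ _ _ phi n) _ h); rewrite subr_lt0.
by apply: le_lt_trans (ler_norm i) _; rewrite -abszE ltz_nat.
Qed.

Definition lift_comp n (x : N) : tens N (BA phi (Jp n)) := c_ n (theta n x).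

Lemma lift_comp_ghom n : ghom (- n%:Z) (lift_comp n).
Proof. by rewrite -[- _]add0r; apply: ghom_comp (cX_ghom s0g (Jp n)) (theta_ghom n). Qed.

Lemma pN_lift_comp n x : pN phi N (Jp n) (lift_comp n x) = theta n x.
Proof. exact: (pN_cX s0g s0p (X := Jp n)). Qed.

Lemma dcomm_lift_comp n x : dcomm (- n%:Z) (lift_comp n) x =
  - sgn n%:Z (ioN phi N (Jp n) (theta n.+1 x)).
Proof.
have cB : zmod_morphism (c_ n) by exact: (ghomB (cX_ghom s0g (Jp n))).
rewrite (dcomm_comp_closedr x cB (@theta_closed n) (esym (add0r _))).
rewrite (dcomm_cX s0g s0p (X := Jp n)).
have -> : ioN phi N (Jp n) (theta n.+1 x) = sgn n%:Z (ioN phi N (Jp n) (at_ n (theta n x))).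
  exact: (zmor_sgn (raddfB (ioN phi N (Jp n))) n%:Z (at_ n (theta n x))).
by rewrite sgnK.
Qed.

Lemma lift_comp_eq0 n x : theta n x = 0 -> lift_comp n x = 0.
Proof. by move=> e; rewrite /lift_comp e (zmor0 (ghomB (cX_ghom s0g (Jp n)))). Qed.

Definition bar_lift (x : N) : tens N (bar phi) :=
  \sum_(0 <= n < sval (cid (theta_fin x))) iN (lift_comp n x).

Lemma bar_liftE K x : (forall n : nat, (K <= n)%N -> theta n x = 0) ->
  bar_lift x = \sum_(0 <= n < K) iN (lift_comp n x).
Proof.
move=> xK; have zK := svalP (cid (theta_fin x)).
have F0 n : theta n x = 0 -> iN (lift_comp n x) = 0.
  by move=> /lift_comp_eq0->; apply: (zmor0 (ghomB (iN_ghom phi N n))).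
rewrite /bar_lift -(sum_nat_widen (leq_maxl K (sval (cid (theta_fin x))))); last first.
  by move=> n /xK/F0.
by rewrite -(sum_nat_widen (leq_maxr K _)) // => n /zK/F0.
Qed.

Lemma bar_lift_ghom : ghom 0 bar_lift.
Proof.
split=> [x y|x b|i x xi].
- have [K xK] := theta_fin x; have [L yL] := theta_fin y.
  rewrite !(@bar_liftE (maxn K L)) => [|n|n|n]; try rewrite geq_max => /andP[/xK Ex /yL Ey] //.
    rewrite -sumrB; apply: eq_bigr => n _.
    by rewrite (ghomB (lift_comp_ghom n)) (ghomB (iN_ghom phi N n)).
  by rewrite (ghomB (theta_ghom n)) Ex Ey subr0.
- have [K xK] := theta_fin x; have xbK n : (K <= n)%N -> theta n (act x b) = 0.
    by move=> /xK Ex; have [_ -> _] := theta_ghom n; rewrite Ex act0l.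
  rewrite (bar_liftE xK) (bar_liftE xbK) -[RHS]/(mkAdd (actBl b) _) raddf_sum.
  apply: eq_bigr => n _; have [_ -> _] := lift_comp_ghom n.
  by have [_ -> _] := iN_ghom phi N n.
rewrite addr0 /bar_lift; elim/big_rec: _ => [|n y _ yi]; first exact: homog0.
apply: homogD yi; have [_ _ /(_ i x xi) h] := lift_comp_ghom n.
by have [_ _ /(_ _ _ h)] := iN_ghom phi N n; rewrite subrK.
Qed.

(** The failure of summand n to be closed, given by [dcomm_lift_comp], cancels the spliced part of
    the differential of summand n + 1. *)
Lemma bar_lift_closed : gclosed 0 bar_lift.
Proof.
move=> x; have [K xK] := theta_fin x.
have dxK n : (K <= n)%N -> theta n (dif N x) = 0.
  move=> /xK Ex; have := theta_closed n x; rewrite /dcomm Ex (raddf0 (dif _)) sub0r.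
  move=> /eqP; rewrite oppr_eq0 => /eqP e.
  by rewrite -[LHS](sgnK (- n%:Z)) e sgn0r.
have up (z : N) : (forall n : nat, (K <= n)%N -> theta n z = 0) ->
  forall n : nat, (K.+1 <= n)%N -> theta n z = 0 by move=> zK n /ltnW/zK.
(* The sums get K + 1 terms so that [sum_nat_shift] can reindex the spliced parts; the extra term
   [e K] is zero. *)
rewrite /dcomm sgn0 (bar_liftE (up _ xK)) (bar_liftE (up _ dxK)) raddf_sum.
pose d n := iN (dif (tens N (BA phi (Jp n))) (lift_comp n x)).
pose e n := iN (ioN phi N (Jp n) (theta n.+1 x)).
rewrite (@sum_nat_shift _ (fun n => dif (tens N (bar phi)) (iN (lift_comp n x)))
  (fun n => sgn n%:Z (d n)) e).
- rewrite -sumrB big1// => n _.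
  have := dcomm_lift_comp n x; rewrite /dcomm sgnN => /eqP; rewrite subr_eq => /eqP E.
  have iB := ghomB (iN_ghom phi N n).
  rewrite /d E (zmorD iB) (zmorN iB) !(zmor_sgn iB) sgnDr sgnNr !sgnK -/(e n).
  by rewrite addrAC addrK addNr.
- by rewrite iN_dif0 sgn0.
- by move=> n; rewrite iN_difS pN_lift_comp.
rewrite /e (xK K.+1 (leqnSn K)) (raddf0 (ioN phi N (Jp K))).
exact: (zmor0 (ghomB (iN_ghom phi N K))).
Qed.

(** Preceded by [bar_lift] and followed by [rN], both closed, the null-homotopic map becomes
    [theta l.+1]: only the summand l + 1 survives the projection. *)
Lemma theta_exact_of_null l : null_homotopic (tens_map N (omega phi l)) ->
  gexact (- l.+1%:Z) (theta l.+1).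
Proof.
move=> /null_homotopicP h.
have h1 := gexact_compr bar_lift_ghom bar_lift_closed h (esym (addr0 0)).
have h2 := gexact_compl (rN_ghom phi N l) (@rN_closed _ _ _ phi N l) h1 (esym (addr0 _)).
apply: gexact_ext h2 => x; have [K xK] := theta_fin x.
have lK : (l.+1 < maxn K l.+2)%N by rewrite leq_max leqnn orbT.
rewrite (@bar_liftE (maxn K l.+2)); last first.
  by move=> n; rewrite geq_max => /andP[/xK].
rewrite (zmor_sum (raddfB (tens_map N (omega phi l)))) (zmor_sum (ghomB (rN_ghom phi N l))).
rewrite (sum_nat_single lK) ?rN_omega_iN_in ?pN_lift_comp// => n nl.
exact: rN_omega_iN_out.
Qed.

Section Descent.
Hypothesis vBA : forall n, vanish N (tens N (BA phi (Jp n))).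

(* Given a primitive of the (n+1)-st power, [lift_comp n] corrected by it is
   closed and still lifts the n-th power. *)
Lemma theta_descent n : gexact (- n.+1%:Z) (theta n.+1) ->
  exists w : N -> tens N (BA phi (Jp n)), [/\ ghom (- n%:Z) w, gclosed (- n%:Z) w &
    forall x, pN phi N (Jp n) (w x) = theta n x].
Proof.
have e : - n.+1%:Z + 1 = - n%:Z by rewrite intS opprD addrC addrA subrr add0r.
move=> [t]; rewrite e => tg tE.
pose iot x := sgn n%:Z (ioN phi N (Jp n) (t x)).
have iog : ghom (- n%:Z) iot.
  by apply: ghom_sgn; rewrite -[- _]add0r; apply: ghom_comp (dgh_ghom _) tg.
exists (fun x => lift_comp n x + iot x); split.
- exact: ghomD (lift_comp_ghom n) iog.
- move=> x; rewrite dcommD dcomm_lift_comp dcomm_sgn.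
  rewrite (dcomm_comp_closedl _ _ (raddfB (ioN phi N (Jp n))) (dgh_closed _) (esym (add0r _))).
  by rewrite sgn0 tE addNr.
move=> x; rewrite (raddfD (pN phi N (Jp n))) pN_lift_comp.
by rewrite (zmor_sgn (raddfB (pN phi N (Jp n)))) pN_ioN sgn0r addr0.
Qed.

Lemma theta_exact_pred n : (0 < n)%N -> gexact (- n.+1%:Z) (theta n.+1) ->
  gexact (- n%:Z) (theta n).
Proof.
move=> n0 /theta_descent[w [wg wc wE]].
(* Since [0 < n], the degree of w is negative, so w is exact, and so is its image [theta n] under
   [pN]. *)
have we : gexact (- n%:Z) w by apply: vBA => //; rewrite oppr_lt0 ltz_nat.
apply: gexact_ext (gexact_compl (dgh_ghom (pN phi N (Jp n))) (dgh_closed _) we (esym (add0r _))).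
by move=> x; rewrite wE.
Qed.

Lemma theta1_exact n : gexact (- n.+1%:Z) (theta n.+1) -> gexact (- 1%:Z) (theta 1).
Proof. by elim: n => // n IH /theta_exact_pred-/(_ isT)/IH. Qed.

Lemma liftable_of_null l : null_homotopic (tens_map N (omega phi l)) ->
  naively_liftable phi N.
Proof.
move=> /theta_exact_of_null/theta1_exact/theta_descent[w [wg wc wE]].
(* At n = 0, w is a chain map lifting x |-> x (x) 1; [cancelN] turns it into a section of pi_N. *)
rewrite oppr0 in wg wc.
pose c := @cancelN R A B phi N (reg B).
have [|| s sE] := @ghom_dgHom R B N (tens (res phi N) (lres phi (reg B))) (fun x => c (w x)).
- by rewrite -[0]addr0; apply: ghom_comp (cancelN_ghom phi N (reg B)) wg.
- apply: (gclosed_comp (ghomB (cancelN_ghom phi N (reg B))) (esym (addr0 0)) _ wc).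
  exact: cancelN_closed.
exists s => x; rewrite sE.
have mul_bal : balanced (fun (n : N) (b : reg B) => act n (b : B) : N).
  by split=> [b|n|n b b'] /=; [exact: actBl|exact: actBr|rewrite actA].
(* After multiplication N (x)_B B -> N, the map [pN] becomes [piN]. *)
have E v : piN phi N (c v) = tens_lift mul_bal (pN phi N (reg B) v).
  move: v; apply: V_ext => [v v'|v v'|n b b'].
  - by rewrite /c (ghomB (cancelN_ghom phi N (reg B))) (raddfB (piN phi N)).
  - by rewrite (raddfB (pN phi N (reg B))) raddfB.
  by rewrite /c cancelNE piNE pNE tens_liftE mulmapE actA.
rewrite E wE -[theta 0 x]/(tn (reg B) x 1) tens_liftE.
exact: act1.
Qed.
End Descent.
End AtiyahPowers.

(** * Existence of connections, degrees of bases, and the equivalence *)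

Lemma connection_exists (R : comPzRingType) (A B : dgAlg R) (phi : dgAlgHom A B)
    (N : dgMod B) (b : gbasis N) :
  exists2 s0 : N -> tens N (Be phi), ghom 0 s0 &
    forall n, pN phi N (reg B) (s0 n) = @tens_elt R B B N (reg B) n 1.
Proof.
(* The connection sends each basis element to its tensor with u = 1 (x) 1; compatibility with
   differentials is not demanded of it. *)
pose u : Be phi := unitl phi (X := reg B) (1 : B).
exists (gext (b := b) (fun i => @tens_elt R B B N (Be phi) (gb i) u : tens N (Be phi))).
  apply: gext_ghom => i; apply: (@tens_homog R B B N (Be phi)); first exact: gb_homog.
  exact: (unitl_deg phi (X := reg B) (homog1 B)).
apply: (gb_ext (b := b)) => [x y|x y|i a].
- by rewrite gextB (raddfB (pN phi N (reg B))).
- exact: (@tens_eltBl R B B N (reg B)).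
rewrite gext_gb dgh_act pNE [mulmap _ _ _](mulmap_unitl phi (X := reg B)).
by rewrite tn_act (@tens_elt_bal R B B N (reg B)) /= mul1r mulr1.
Qed.

Lemma nneg_gbasis (R : comPzRingType) (A : dgAlg R) (M : dgMod A) :
  semifree M -> nneg M -> exists b : gbasis M, forall i : gix b, 0 <= gdeg i.
Proof.
move=> [F [le [Fb _ _]]] M0.
have F0 f : f \in F -> exists2 n, 0 <= n & homog M n f.
  move=> fF; case: (Fb) => /(_ f fF)[n fn] _ _.
  have [n0|n0] := leP 0 n; first by exists n.
  (* A basis element of negative degree is 0, so it may be given degree 0. *)
  by exists 0 => //; rewrite (M0 n f n0 fn); apply: homog0.
by have [b [b0 _]] := graded_basis_gbasis Fb F0; exists b.
Qed.

(** A closed map of degree -(n+1) commutes with differentials up to (-1)^(n+1), which is exactly the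
    sign in the differential of the shift by n + 1. *)
Lemma vanish_reg (R : comPzRingType) (B : dgAlg R) (N : dgMod B) :
  (forall n : nat, (1 <= n)%N -> homK_eq0 N (shift n%:Z (reg B))) -> vanish N (reg B).
Proof.
move=> v [//|n] f _ fg fc; have [fB fl fd] := fg; rewrite NegzE in fg fc fd *.
have fdeg i x : homog N i x -> homog (shift n.+1%:Z (reg B)) i (mkAdd fB x).
  exact: fd.
have fdif x : mkAdd fB (dif N x) = dif (shift n.+1%:Z (reg B)) (mkAdd fB x).
  have := fc x; rewrite /dcomm sgnN => /eqP; rewrite subr_eq0 => /eqP E.
  by rewrite /= E sgnK.
have [h [hl hd hE]] := v n.+1 isT (@DGHom R B N (shift n.+1%:Z (reg B)) (mkAdd fB) fl fdeg fdif).
exists (fun x => sgn n.+1%:Z (h x)).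
  apply: ghom_sgn; split=> [||i x xi]; [exact: raddfB|exact: hl|].
  by have := hd i x xi; rewrite /homog /= opprK addrAC addrA.
move=> x; have := hE x; rewrite /= subr0 => ->.
rewrite /dcomm sgn_add sgnD sgnN sgn1 sgnNr sgnK opprK.
by [].
Qed.

Theorem corollary6p8 (R : comPzRingType) (A B : dgAlg R) (phi : dgAlgHom A B)
    (hphi : setting phi) (N : dgMod B) (hN : AR1 phi N) :
  [<-> naively_liftable phi N;
       null_homotopic (tens_map N (omega phi 0));
       forall l : nat, null_homotopic (tens_map N (omega phi l));
       exists2 l : nat, (1 <= l)%N & null_homotopic (tens_map N (omega phi l))].
Proof.
have [_ Bsf _ _] := hphi; have [[Nsf N0] [Bp Np] Nv] := hN.
have B0 : nneg (res phi (reg B)) by move=> n x; apply: dga_nneg.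
have [b b0] := nneg_gbasis Nsf N0; have [e e0] := nneg_gbasis Bsf B0.
have Nb : bounded_basis (res phi N).
  by exists (prod_gbasis b e), 0 => -[i j]; apply: addr_ge0.
have Bb : bounded_basis (res phi (reg B)) by exists e, 0.
have vBA n : vanish N (tens N (BA phi (Jpow phi n))).
  exact: (@BA_vanish R A B phi N (vanish_reg Nv) Bb Bp n Nb N0 Np).
have [s0 s0g s0p] := connection_exists phi b.
have null l : naively_liftable phi N -> null_homotopic (tens_map N (omega phi l)).
  by move=> [s sP]; apply: section_null_homotopic sP l.
have liftable l : null_homotopic (tens_map N (omega phi l)) -> naively_liftable phi N.
  exact: (liftable_of_null N0 s0g s0p vBA).
(* [null] and [liftable] hold for every l, so a null-homotopy for a single l yields liftability and
   with it all the others. *)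
tfae.
- exact: null.
- by move=> /liftable/null.
- by move=> h; exists 1%N.
- by move=> [l _ /liftable].
Qed.
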